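(* Let $I$ be a set and $1 \leq p < \infty$. The Banach space $\mathfrak{R}_{p}^I$ equipped with the Schur product is a commutative Banach algebra.
   Context: For $1\le p<\infty$, $S_p^I$ is the Schatten class of compact operators $A$ on $\ell_2^I$ with $\|A\|_{S_p^I}=(\mathrm{Tr}\,(A^*A)^{p/2})^{1/p}<\infty$; $S_\infty^I$ is the space of compact operators on $\ell_2^I$ with the operator norm. Elements are regarded as $I\times I$ matrices. $p^*$ is the conjugate exponent. $*$ is the Schur (entrywise) product $[a_{ij}]*[b_{ij}]=[a_{ij}b_{ij}]$. $\otimes_\gamma$ is the Banach space projective tensor product, and $\varphi_p^I: S_p^I\otimes_\gamma S_{p^*}^I\to S_1^I$ is the contractive linear map with $\varphi_p^I(A\otimes B)=A*B$. $\mathfrak{R}_p^I$ is $\mathrm{Im}\,\varphi_p^I\subset S_1^I$ with the norm of $(S_p^I\otimes_\gamma S_{p^*}^I)/\mathrm{Ker}\,\varphi_p^I$. *)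

(* Defs.v *)
From HB Require Import structures.
From mathcomp Require Import all_boot all_order all_algebra.
From mathcomp Require Import all_classical all_reals all_analysis.
From mathcomp Require Import finmap complex.
From mathcomp Require summability.
From mathcomp Require Import ring lra.

Set Implicit Arguments.
Unset Strict Implicit.
Unset Printing Implicit Defensive.

Import Order.TTheory GRing.Theory Num.Theory Normc.
Import numFieldNormedType.Exports.

Local Open Scope classical_set_scope.
Local Open Scope ring_scope.
Local Open Scope complex_scope.

(* The scalars C.  R[i] also carries a structure of R-module; its regular
   module R[i]^o makes R[i] itself the ring of scalars. *)
Local Notation C R := (R[i]^o).

Lemma sqrt_sum_sqrD (R : realType) (J : Type) (r : seq J) (a b : J -> R) :
  Num.sqrt (\sum_(i <- r) (a i + b i) ^+ 2) <=
  Num.sqrt (\sum_(i <- r) a i ^+ 2) + Num.sqrt (\sum_(i <- r) b i ^+ 2).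
Proof.
set s := \sum_(i <- r) a i ^+ 2; set t := \sum_(i <- r) b i ^+ 2.
have s0 : 0 <= s by apply: sumr_ge0 => i _; rewrite sqr_ge0.
have t0 : 0 <= t by apply: sumr_ge0 => i _; rewrite sqr_ge0.
pose c := \sum_(i <- r) a i * b i.
have cst : c ^+ 2 <= s * t.
  have D x y : \sum_(i <- r) (x * a i - y * b i) ^+ 2 =
      x ^+ 2 * s - 2 * x * y * c + y ^+ 2 * t.
    rewrite !mulr_sumr -sumrB -big_split/=.
    by apply: eq_bigr => i _; ring.
  have D0 x y : 0 <= x ^+ 2 * s - 2 * x * y * c + y ^+ 2 * t.
    by rewrite -D; apply: sumr_ge0 => i _; rewrite sqr_ge0.
  have := D0 t c; have := D0 c (s + 1).
  have [t_gt0 _ H|t_le0] := ltP 0 t.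
    have : 0 <= t * (s * t - c ^+ 2) by nra.
    by rewrite pmulr_rge0// subr_ge0.
  have -> : t = 0 by apply: le_anti; rewrite t_le0 t0.
  by nra.
rewrite -(@ler_pXn2r _ 2) ?nnegrE ?addr_ge0 ?sqrtr_ge0//.
rewrite sqrrD !sqr_sqrtr//; last by apply: sumr_ge0 => i _; rewrite sqr_ge0.
have -> : \sum_(i <- r) (a i + b i) ^+ 2 = s + c *+ 2 + t.
  rewrite -sumrMnl -!big_split/=.
  by apply: eq_bigr => i _; rewrite sqrrD.
rewrite lerD2r lerD2l lerMn2r/= -sqrtrM// (le_trans (ler_norm _))//.
by rewrite -sqrtr_sqr ler_wsqrtr.
Qed.

Lemma normcD (R : realType) (x y : R[i]) : normc (x + y) <= normc x + normc y.
Proof. by rewrite -lecR rmorphD/=; exact: (@ler_normD _ R[i]). Qed.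

Lemma normc_ge0 (R : realType) (x : R[i]) : 0 <= normc x.
Proof. by case: x => a b; exact: sqrtr_ge0. Qed.

Section SquareSummable.
Variables (R : realType) (I : choiceType).
Implicit Types x y : I -> C R.

Definition sqnorm x : \bar R := (\esum_(i in setT) (normc (x i) ^+ 2)%:E)%E.

Definition square_summable : {pred I -> C R} :=
  fun x => `[< (sqnorm x < +oo)%E >].

Lemma sqnorm_ge0 x : (0 <= sqnorm x)%E.
Proof. by apply: esum_ge0 => i _; rewrite lee_fin sqr_ge0. Qed.

Lemma sqnorm_le x (c : R) :
  (forall A : {fset I}, \sum_(i <- A) normc (x i) ^+ 2 <= c) ->
  (sqnorm x <= c%:E)%E.
Proof.
move=> h; apply: ge_ereal_sup => _ [A [finA _] <-].
by rewrite fsbig_finite//= sumEFin lee_fin; exact: h.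
Qed.

Lemma sqnorm_ge x (A : {fset I}) :
  ((\sum_(i <- A) normc (x i) ^+ 2)%:E <= sqnorm x)%E.
Proof.
apply: ereal_sup_ubound; exists [set` A] => //.
by rewrite fsbig_finite//= set_fsetK sumEFin.
Qed.

Lemma square_summableP x (c : R) :
  (forall A : {fset I}, \sum_(i <- A) normc (x i) ^+ 2 <= c) ->
  x \in square_summable.
Proof.
by move=> h; apply/asboolP; rewrite (le_lt_trans (sqnorm_le h))// ltry.
Qed.

Definition hnorm x : R := Num.sqrt (fine (sqnorm x)).

Lemma hnorm_ge0 x : 0 <= hnorm x. Proof. exact: sqrtr_ge0. Qed.

Lemma hnorm_ge x (A : {fset I}) : x \in square_summable ->
  Num.sqrt (\sum_(i <- A) normc (x i) ^+ 2) <= hnorm x.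
Proof.
move=> /asboolP x2; apply: ler_wsqrtr; rewrite -lee_fin fineK ?sqnorm_ge//.
by rewrite ge0_fin_numE ?sqnorm_ge0.
Qed.

Lemma hnorm_le x (c : R) : 0 <= c ->
  (forall A : {fset I}, Num.sqrt (\sum_(i <- A) normc (x i) ^+ 2) <= c) ->
  x \in square_summable /\ hnorm x <= c.
Proof.
move=> c0 h.
have h2 (A : {fset I}) : \sum_(i <- A) normc (x i) ^+ 2 <= c ^+ 2.
  rewrite -[leLHS]sqr_sqrtr; [by rewrite lerXn2r ?nnegrE ?sqrtr_ge0//; exact: h|].
  by apply: sumr_ge0 => i _; rewrite sqr_ge0.
have x2 := square_summableP h2; split=> //.
rewrite -[leRHS]ger0_norm// -sqrtr_sqr ler_wsqrtr// -lee_fin fineK ?sqnorm_le//.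
by rewrite ge0_fin_numE ?sqnorm_ge0//; exact/asboolP.
Qed.

Lemma hnormD x y : x \in square_summable -> y \in square_summable ->
  x + y \in square_summable /\ hnorm (x + y) <= hnorm x + hnorm y.
Proof.
move=> x2 y2; apply: hnorm_le => [|A]; first by rewrite addr_ge0 ?hnorm_ge0.
apply: (le_trans _ (lerD (hnorm_ge A x2) (hnorm_ge A y2))).
apply: (le_trans _ (sqrt_sum_sqrD _ _ _)); apply: ler_wsqrtr.
by apply: ler_sum => i _; rewrite lerXn2r ?nnegrE ?addr_ge0 ?normc_ge0 ?normcD.
Qed.

Lemma hnormZ_le (a : R[i]) x : x \in square_summable ->
  a *: x \in square_summable /\ hnorm (a *: x) <= normc a * hnorm x.
Proof.
move=> x2; apply: hnorm_le => [|A]; first by rewrite mulr_ge0 ?normc_ge0 ?hnorm_ge0.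
apply: (le_trans _ (ler_wpM2l (normc_ge0 a) (hnorm_ge A x2))).
rewrite -[normc a]ger0_norm ?normc_ge0// -sqrtr_sqr -sqrtrM ?sqr_ge0//.
rewrite mulr_sumr ler_wsqrtr// ler_sum// => i _.
by rewrite -exprMn -normcM.
Qed.

Lemma square_summable_submod : submod_closed square_summable.
Proof.
split=> [|a x y x2 y2].
- apply: (@square_summableP _ 0) => A; rewrite big1// => i _.
  by rewrite normc0 expr0n.
- by apply: (hnormD _ _).1 => //; apply: (hnormZ_le _ _).1.
Qed.

HB.instance Definition _ :=
  GRing.isSubmodClosed.Build _ _ square_summable square_summable_submod.

Record ell2 := Ell2 {
  ell2_fun :> I -> C R ;
  ell2_funP : ell2_fun \in square_summable }.

HB.instance Definition _ := [isSub for ell2_fun].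
HB.instance Definition _ := [Choice of ell2 by <:].
HB.instance Definition _ := [SubChoice_isSubLmodule of ell2 by <:].

Lemma ell2_normD (x y : ell2) :
  (hnorm (x + y))%:C <= (hnorm x)%:C + (hnorm y)%:C :> R[i].
Proof.
by rewrite -rmorphD lecR; apply: (hnormD _ _).2; exact: ell2_funP.
Qed.

Lemma ell2_normZ (a : R[i]) (x : ell2) :
  (hnorm (a *: x))%:C = `|a| * (hnorm x)%:C.
Proof.
rewrite -[ `|a| ]/((normc a)%:C) -rmorphM; congr (_%:C).
apply/eqP; rewrite eq_le (hnormZ_le _ (ell2_funP x)).2/=.
have [->|a0] := eqVneq a 0; first by rewrite normc0 mul0r hnorm_ge0.
have na : 0 < normc a.
  by rewrite lt_neqAle normc_ge0 andbT eq_sym; apply: contra_neq a0 => /eq0_normc.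
rewrite -ler_pdivlMl// -normcV.
have := (hnormZ_le a^-1 (hnormZ_le a (ell2_funP x)).1).2.
by rewrite scalerA mulVf// scale1r.
Qed.

Lemma ell2_norm_eq0 (x : ell2) : (hnorm x)%:C = 0 :> R[i] -> x = 0.
Proof.
move=> [] nx0; apply/val_inj/funext => i /=; apply: eq0_normc.
have := hnorm_ge [fset i]%fset (ell2_funP x).
rewrite nx0 big_seq_fset1 sqrtr_sqr ger0_norm ?normc_ge0// => xi.
by apply/eqP; rewrite eq_le xi normc_ge0.
Qed.

HB.instance Definition _ := Lmodule_isNormed.Build R[i] ell2
  ell2_normD ell2_normZ ell2_norm_eq0.

End SquareSummable.

Section Operators.
Variables (R : realType) (I : choiceType).
Local Notation H := (ell2 R I).
Local Notation mx := (I -> I -> C R).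
Implicit Types (T S : H -> H) (a : mx) (p : \bar R).

Definition inner (x y : H) : C R :=
  summability.sum (fun i => x i * (y i)^* : C R).

Lemma dirac_square_summable (i : I) :
  (fun j => (j == i)%:R : C R) \in @square_summable R I.
Proof.
apply: (@square_summableP _ _ _ 1) => A.
have E j : normc ((j == i)%:R : R[i]) ^+ 2 = (j == i)%:R :> R.
  by case: (j == i); rewrite ?normc1 ?normc0 ?expr1n ?expr0n.
under eq_bigr do rewrite E.
have [iA|iA] := boolP (i \in A).
  rewrite (big_fsetD1 i)//= eqxx big_seq big1 ?addr0// => j.
  by rewrite in_fsetD1 => /andP[/negbTE ->].
by rewrite big_seq big1// => j jA; case: eqP => // ji; rewrite -ji jA in iA.
Qed.

Definition basis_vec (i : I) : H := Ell2 (dirac_square_summable i).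

Definition bounded_operator T := linear T /\ continuous T.

Definition compact_operator T :=
  bounded_operator T /\ compact (closure (T @` [set x : H | hnorm x <= 1])).

Definition matrix_of T : mx := fun i j => T (basis_vec j) i.

(* A bounded operator is determined by its matrix. *)
Definition operator_of a : H -> H :=
  get [set T | bounded_operator T /\ matrix_of T = a].

Definition adjoint T : H -> H :=
  get [set S | bounded_operator S /\
               forall x y, inner (T x) y = inner x (S y)].

(* The power T^s, s > 0, of a positive compact operator T: by functional
   calculus it acts as l^s on the eigenspace of T for the eigenvalue l, and
   this determines it, since the eigenvectors of T span a dense subspace. *)
Definition operator_pow T (s : R) : H -> H :=
  get [set S | bounded_operator S /\
               forall (l : R) (x : H), 0 <= l ->
                 T x = l%:C *: x -> S x = (l `^ s)%:C *: x].

(* The trace of a positive operator, whose diagonal coefficients are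
   nonnegative reals. *)
Definition trace T : \bar R :=
  (\esum_(i in setT) (complex.Re (matrix_of T i i))%:E)%E.

Definition operator_norm T : \bar R :=
  ereal_sup [set (hnorm (T x))%:E | x in [set x : H | hnorm x <= 1]].

(* Meaningful for compact T and 1 <= p <= +oo. *)
Definition operator_schatten_norm p T : \bar R :=
  match p with
  | r%:E => poweR (trace (operator_pow (adjoint T \o T) (r / 2))) r^-1
  | _ => operator_norm T
  end.

Definition schatten_carrier p : set mx :=
  [set a | exists T, [/\ compact_operator T, matrix_of T = a
                       & (operator_schatten_norm p T < +oo)%E]].

Definition schatten_norm p a : R :=
  fine (operator_schatten_norm p (operator_of a)).

Definition schur a b : mx := fun i j => a i j * b i j.

End Operators.

(* A subset of an ambient vector space, together with a candidate for a norm on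
   it.  That it is a Banach space is asserted by banach_space below. *)
Record normed_data (R : realType) (V : lmodType R[i]) := NormedData {
  carrier :> V -> Prop ;
  nrm : V -> R }.

Definition schatten (R : realType) (I : choiceType) (p : \bar R) :
    normed_data (I -> I -> C R) :=
  NormedData (schatten_carrier p) (schatten_norm p).

Section ProjectiveTensorProduct.
Variables (R : realType) (V W : lmodType R[i]).
Variables (E : normed_data V) (F : normed_data W).

(* The sequence [:: (x_1, y_1); ...; (x_n, y_n)] stands for the element
   x_1 (x) y_1 + ... + x_n (x) y_n of the algebraic tensor product. *)
Implicit Types u v : seq (V * W).

Definition tensor u := forall z, z \in u -> E z.1 /\ F z.2.

Definition bilinear_on (Z : lmodType R[i]) (f : V -> W -> Z) :=
  (forall (a : R[i]) x x' y, E x -> E x' -> F y ->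
     f (a *: x + x') y = a *: f x y + f x' y) /\
  (forall (a : R[i]) x y y', E x -> F y -> F y' ->
     f x (a *: y + y') = a *: f x y + f x y').

(* Equality in the algebraic tensor product, by its universal property. *)
Definition tensor_eq u v :=
  forall (Z : lmodType R[i]) (f : V -> W -> Z), bilinear_on f ->
    \sum_(z <- u) f z.1 z.2 = \sum_(z <- v) f z.1 z.2.

Definition tensor_sub u v := u ++ [seq (- z.1, z.2) | z <- v].

Definition projective_norm u : R :=
  inf [set \sum_(z <- v) nrm E z.1 * nrm F z.2
      | v in [set v | tensor v /\ tensor_eq u v]].

(* The projective tensor product is the completion of the algebraic tensor
   product for the projective norm.  Its elements are represented by Cauchy
   sequences of algebraic tensors, and its norm is the limit of their norms. *)
Definition ptensor (w : nat -> seq (V * W)) :=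
  (forall n, tensor (w n)) /\
  forall e : R, 0 < e -> exists n0 : nat, forall m n : nat,
    (n0 <= m)%N -> (n0 <= n)%N -> projective_norm (tensor_sub (w m) (w n)) < e.

Definition ptensor_norm (w : nat -> seq (V * W)) : R :=
  limn (fun n => projective_norm (w n)).

End ProjectiveTensorProduct.

Section FrakR.
Variables (R : realType) (I : choiceType) (p : R).
Local Notation mx := (I -> I -> C R).
Local Notation S := (@schatten R I).
Implicit Types (w : nat -> seq (mx * mx)) (a : mx).

Definition schur_sum (u : seq (mx * mx)) : mx := \sum_(z <- u) schur z.1 z.2.

(* varphi w a: the continuous linear map extending A (x) B |-> A * B sends the
   element of the completion represented by w to a. *)
Definition varphi w a :=
  S 1%:E a /\ (nrm (S 1%:E) (schur_sum (w n) - a) @[n --> \oo] --> (0 : R)).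

Definition preimage_varphi a : set (nat -> seq (mx * mx)) :=
  [set w | ptensor (S p%:E) (S (hoelder_conjugate p%:E)) w /\ varphi w a].

(* The image of varphi, with the quotient norm: the coset modulo Ker varphi of
   an element sent to a is the whole fibre over a. *)
Definition frakR : normed_data mx :=
  NormedData
    [set a | exists w, preimage_varphi a w]
    (fun a => inf [set ptensor_norm (S p%:E) (S (hoelder_conjugate p%:E)) w
                  | w in preimage_varphi a]).

End FrakR.

Section BanachAlgebra.
Variables (R : realType) (V : lmodType R[i]) (E : normed_data V).

Record banach_space : Prop := BanachSpace {
  banach_zero : E 0 ;
  banach_linear : forall (a : R[i]) x y, E x -> E y -> E (a *: x + y) ;
  banach_norm_ge0 : forall x, E x -> 0 <= nrm E x ;
  banach_norm_eq0 : forall x, E x -> nrm E x = 0 -> x = 0 ;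
  banach_normZ : forall (a : R[i]) x, E x -> nrm E (a *: x) = normc a * nrm E x ;
  banach_normD : forall x y, E x -> E y -> nrm E (x + y) <= nrm E x + nrm E y ;
  banach_complete : forall x : nat -> V, (forall n, E (x n)) ->
    (forall e : R, 0 < e -> exists n0 : nat, forall m n : nat,
       (n0 <= m)%N -> (n0 <= n)%N -> nrm E (x m - x n) < e) ->
    exists2 l, E l & nrm E (x n - l) @[n --> \oo] --> (0 : R) }.

Record commutative_banach_algebra (mul : V -> V -> V) : Prop :=
    CommutativeBanachAlgebra {
  alg_banach : banach_space ;
  alg_closed : forall x y, E x -> E y -> E (mul x y) ;
  alg_assoc : forall x y z, E x -> E y -> E z ->
    mul x (mul y z) = mul (mul x y) z ;
  alg_comm : forall x y, E x -> E y -> mul x y = mul y x ;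
  alg_linearl : forall (a : R[i]) x y z, E x -> E y -> E z ->
    mul (a *: x + y) z = a *: mul x z + mul y z ;
  alg_linearr : forall (a : R[i]) x y z, E x -> E y -> E z ->
    mul z (a *: x + y) = a *: mul z x + mul z y ;
  alg_normM : forall x y, E x -> E y ->
    nrm E (mul x y) <= nrm E x * nrm E y }.

End BanachAlgebra.

(* Main.v *)
(* A compact operator T has a singular value decomposition T = sum_n s_n <., v_n> u_n:
   remove successively from T the pairs (u, v) with T v = s u and T* u = s v, where
   s = ||T||.  By uniqueness of the power of T* T, Tr (T* T)^(r/2) = sum_n s_n^r, and
   sum_n s_n^r is the supremum of sum_k |<T f_k, g_k>|^r over orthonormal families f, g.
     The Schur product of T and T' = sum_m t_m <., v'_m> u'_m is the sum over n, m of
   s_n t_m <., v_n v'_m> (u_n u'_m), with pointwise products of vectors.  Bessel's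
   inequality, in l_2 and at each coordinate, makes the relevant weights doubly
   substochastic.  Jensen's inequality then gives |A * B|_p <= |A|_p |B|_p, and
   Hoelder's inequality |A * B|_1 <= |A|_p |B|_p*.
     The first bound makes (A (x) B)(A' (x) B') = (A * A') (x) (B * B') a contractive
   product on the projective tensor product, for which varphi is multiplicative; the
   quotient norm is thus submultiplicative.  The second bound and the completeness of
   S_1 give completeness: a geometrically convergent series in the quotient lifts to
   the tensor product, and the image of its sum is computed in S_1. *)
From HB Require Import structures.
Require Import Defs.
From mathcomp Require Import all_boot all_order all_algebra.
From mathcomp Require Import all_classical all_reals all_analysis.
From mathcomp Require Import finmap complex.
From mathcomp Require summability.
From mathcomp Require Import ring lra.

Set Implicit Arguments.
Unset Strict Implicit.
Unset Printing Implicit Defensive.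

Import Order.TTheory GRing.Theory Num.Theory Normc.
Import numFieldNormedType.Exports.

Local Open Scope classical_set_scope.
Local Open Scope ring_scope.
Local Open Scope complex_scope.

Local Notation C R := (R[i]^o).

(** * The Hilbert space l_2 *)

(** The Schatten norm is given as a trace of a power, a form in which neither the triangle
    inequality nor stability under limits is visible. The pairings <T f_k, g_k> supply both: finite
    sums of their r-th powers pass to limits, and a bound on all of them bounds the norm of a
    compact operator. Each product |<x, b>| |<y, d>| is replaced by the mean of the two squares, so
    that Bessel's inequality alone controls row and column sums. Adjoints, powers and the operator
    of a matrix are picked by [get], so each has to be identified by existence and uniqueness before
    anything is computed. For the power, the delicate place is the kernel of T, which is pinned by
    the eigenvalue 0 and 0^s = 0. [I] is an arbitrary index set: sums over coordinates are limits
    along finite subsets, whereas singular values always form a sequence, padded with zeros.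
    Elements of the completion are Cauchy sequences of lists. An infinite sum of such elements is a
    diagonal sequence, whose convergence requires every term to be Cauchy at a prescribed speed. *)

Section Scalars.
Variable R : realType.
Implicit Types z w : R[i].

(** A positive element of [R[i]] has zero imaginary part in the order of [R[i]], so complex radii of
    neighbourhoods can be traded for real ones. *)
Lemma gt0C (e : R[i]) : 0 < e -> exists2 r : R, 0 < r & e = r%:C.
Proof.
by case: e => a b; rewrite ltcE/= => /andP[/eqP -> a0]; exists a.
Qed.

Lemma cvgCP (T : Type) (F : set_system T) (f : T -> C R) (l : C R) :
  Filter F ->
  f @ F --> l <-> (forall e : R, 0 < e -> \forall t \near F, normc (l - f t) < e).
Proof.
move=> FF; split=> [/cvgrPdist_lt h e e0|h].
  have := h e%:C; rewrite ltcR => /(_ e0); apply: filterS => t.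
  by rewrite -[ `|_|]/((normc (l - f t))%:C) ltcR.
apply/cvgrPdist_lt => e /gt0C[r r0 ->]; have := h r r0; apply: filterS => t.
by rewrite -[ `|_|]/((normc (l - f t))%:C) ltcR.
Qed.

Lemma sqr_normcE z : (normc z ^+ 2)%:C = z * conjc z.
Proof. by rewrite rmorphXn/= -/((normc z)%:C) [(normc z)%:C](_ : _ = `|z|)// sqr_normc. Qed.

Lemma normc_conj z : normc (conjc z) = normc z.
Proof. by case: z => a b /=; rewrite sqrrN. Qed.

Lemma normc_real (a : R) : normc a%:C = `|a|.
Proof. by rewrite /= expr0n addr0 sqrtr_sqr. Qed.

Lemma norm_Re_le z : `|complex.Re z| <= normc z.
Proof. by case: z => a b /=; rewrite -sqrtr_sqr ler_wsqrtr// lerDl sqr_ge0. Qed.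

Lemma norm_Im_le z : `|complex.Im z| <= normc z.
Proof. by case: z => a b /=; rewrite -sqrtr_sqr ler_wsqrtr// lerDr sqr_ge0. Qed.

Lemma normc_le_ReIm z : normc z <= `|complex.Re z| + `|complex.Im z|.
Proof.
case: z => a b /=; have /= := normcD a%:C (b *i).
by rewrite addr0 add0r !expr0n !addr0 !add0r !sqrtr_sqr.
Qed.

Lemma normc_sum (J : Type) (r : seq J) (P : pred J) (F : J -> R[i]) :
  normc (\sum_(i <- r | P i) F i) <= \sum_(i <- r | P i) normc (F i).
Proof.
elim/big_ind2 : _ => [|x a y b xa yb|//]; first by rewrite normc0.
by apply: le_trans (normcD _ _) _; exact: lerD.
Qed.

Lemma polarization z w : z * conjc w = 4^-1 *
  (((normc (z + w) ^+ 2)%:C - (normc (z - w) ^+ 2)%:C) +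
   (0 +i* 1) * ((normc (z + (0 +i* 1) * w) ^+ 2)%:C -
                (normc (z - (0 +i* 1) * w) ^+ 2)%:C)).
Proof.
have -> : (4 : R[i]) = (4 : R)%:C by rewrite rmorph_nat.
rewrite -fmorphV/=.
case: z w => [a b] [c d] /=.
rewrite !sqr_sqrtr ?addr_ge0 ?sqr_ge0//.
by apply/eqP; rewrite eq_complex/=; apply/andP; split; apply/eqP; field.
Qed.

Lemma distcC z w : normc (z - w) = normc (w - z).
Proof. by rewrite -normcN opprB. Qed.

End Scalars.

#[local] Existing Instance summability.totally_filter.

(* The norm as a function on ell2, so that the vector operations in its argument
   are those of ell2 and not those of functions. *)
Definition hn (R : realType) (I : choiceType) (x : ell2 R I) : R := hnorm x.

Section Inner.
Variables (R : realType) (I : choiceType).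
Local Notation H := (ell2 R I).
Local Notation totally := (@summability.totally I).
Implicit Types x y z : H.

Lemma totally_ge (A : {fset I}) : totally [set B | (A `<=` B)%fset].
Proof. by exists A. Qed.

Lemma partial_sumE (V : zmodType) (f : I -> V) (A : {fset I}) :
  summability.partial_sum f A = \sum_(i <- A) f i.
Proof. by rewrite /summability.partial_sum big_seq_fsetE. Qed.

Lemma hn_ge0 x : 0 <= hn x. Proof. exact: hnorm_ge0. Qed.

Lemma sqr_hnorm x : sqnorm x = (hn x ^+ 2)%:E.
Proof.
have fx : sqnorm x \is a fin_num.
  by rewrite ge0_fin_numE ?sqnorm_ge0//; exact/asboolP/(ell2_funP x).
by rewrite sqr_sqrtr ?fineK// fine_ge0 ?sqnorm_ge0.
Qed.

Lemma sum_sqr_le_hnorm x (A : {fset I}) :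
  \sum_(i <- A) normc (x i) ^+ 2 <= hn x ^+ 2.
Proof. by rewrite -lee_fin -sqr_hnorm sqnorm_ge. Qed.

Lemma sqr_hnorm_le x (c : R) :
  (forall A : {fset I}, \sum_(i <- A) normc (x i) ^+ 2 <= c) ->
  hn x ^+ 2 <= c.
Proof. by move=> h; rewrite -lee_fin -sqr_hnorm sqnorm_le. Qed.

Lemma normc_le_hnorm x i : normc (x i) <= hn x.
Proof.
rewrite -(@ler_pXn2r _ 2) ?nnegrE ?normc_ge0 ?hn_ge0//.
by have := sum_sqr_le_hnorm x [fset i]%fset; rewrite big_seq_fset1.
Qed.

(** The partial sums increase with the finite set, so one set that comes within e of the supremum
    settles all larger sets. *)
Lemma sqr_hnorm_cvg x :
  (fun A : {fset I} => \sum_(i <- A) normc (x i) ^+ 2) @ totally -->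
    (hn x ^+ 2 : R).
Proof.
apply/cvgrPdist_lt => e e0.
have [A hA] : exists A : {fset I},
    hn x ^+ 2 - e < \sum_(i <- A) normc (x i) ^+ 2.
  apply: contrapT => /forallNP h.
  have : hn x ^+ 2 <= hn x ^+ 2 - e.
    by apply: sqr_hnorm_le => A; rewrite leNgt; apply/negP/h.
  by lra.
apply: filterS (totally_ge A) => B AB.
rewrite ger0_norm ?subr_ge0 ?sum_sqr_le_hnorm//.
suff : \sum_(i <- A) normc (x i) ^+ 2 <= \sum_(i <- B) normc (x i) ^+ 2 by lra.
rewrite -lee_fin -!sumEFin; apply: lee_sum_nneg_subfset; first exact/fsubsetP.
by move=> i _ _; rewrite lee_fin sqr_ge0.
Qed.

(* The polarization identity reduces the convergence of the partial sums of an
   inner product to that of monotone sums of squares. *)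
Lemma inner_cvg x y :
  summability.partial_sum (fun i => x i * conjc (y i) : C R) @ totally --> inner x y.
Proof.
pose q (z : H) (A : {fset I}) : C R := (\sum_(i <- A) normc (z i) ^+ 2)%:C.
have qcvg z : q z @ totally --> ((hn z ^+ 2)%:C : C R).
  apply/cvgCP => e e0; have /cvgrPdist_lt/(_ e e0) := @sqr_hnorm_cvg z.
  by apply: filterS => A; rewrite /q -rmorphB normc_real.
rewrite /inner /summability.sum.
have E : summability.partial_sum (fun i => x i * conjc (y i) : C R) =
  (fun A => (4^-1 : R[i]) *: ((q (x + y) A - q (x - y) A) +
     (0 +i* 1) *: (q (x + (0 +i* 1) *: y) A - q (x - (0 +i* 1) *: y) A)) : C R).
  apply/funext => A; rewrite partial_sumE /q -!rmorphB -!sumrB.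
  rewrite !rmorph_sum/= !scaler_sumr -big_split/= scaler_sumr.
  by apply: eq_bigr => i _; rewrite !rmorphB; exact: polarization.
have qc z : cvg (q z @ totally) by apply/cvg_ex; exists (hn z ^+ 2)%:C; exact: qcvg.
rewrite E; apply: is_cvgZr; apply: is_cvgD.
  by apply: (is_cvgB (qc _) (qc _)).
by apply: is_cvgZr; apply: (is_cvgB (qc _) (qc _)).
Qed.

Lemma inner_unique x y (l : C R) :
  summability.partial_sum (fun i => x i * conjc (y i) : C R) @ totally --> l ->
  inner x y = l.
Proof. by apply: (@cvg_unique _ (@norm_hausdorff _ (C R))); exact: inner_cvg. Qed.

(** Freezing the second argument gives a function that can carry the structure of a linear map. *)
Definition innerl z : H -> C R := fun x => inner x z.

Lemma inner_linear z : linear (innerl z).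
Proof.
move=> a x y; apply: inner_unique; rewrite /innerl.
have -> : summability.partial_sum (fun i => (a *: x + y) i * conjc (z i) : C R) =
  (fun A => (a : R[i]) *: summability.partial_sum (fun i => x i * conjc (z i) : C R) A
     + summability.partial_sum (fun i => y i * conjc (z i) : C R) A).
  apply/funext => A; rewrite !partial_sumE scaler_sumr -big_split/=.
  by apply: eq_bigr => i _; rewrite mulrDl; congr (_ + _); exact/esym/mulrA.
by apply: cvgD; [apply: cvgZr|]; exact: inner_cvg.
Qed.

HB.instance Definition _ z :=
  GRing.isLinear.Build R[i] H (C R) _ (innerl z) (inner_linear z).

Lemma innerC x y : inner y x = conjc (inner x y).
Proof.
apply: inner_unique; apply/cvgCP => e e0.
have /cvgCP/(_ e e0) := @inner_cvg x y; apply: filterS => A.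
rewrite -normc_conj rmorphB/= partial_sumE rmorph_sum/= partial_sumE => h.
apply: le_lt_trans h; rewrite le_eqVlt; apply/orP; left; apply/eqP.
congr (normc (_ - _)); apply: eq_bigr => i _.
by rewrite rmorphM/= conjcK mulrC.
Qed.

Lemma innerxx x : inner x x = (hn x ^+ 2)%:C.
Proof.
apply: inner_unique; apply/cvgCP => e e0.
have /cvgrPdist_lt/(_ e e0) := @sqr_hnorm_cvg x; apply: filterS => A.
rewrite partial_sumE => h; apply: le_lt_trans h.
rewrite -normc_real rmorphB rmorph_sum/=.
by under [in leLHS]eq_bigr do rewrite -sqr_normcE.
Qed.

Lemma innerDl x y z : inner (x + y) z = inner x z + inner y z.
Proof. exact: (raddfD (innerl z)). Qed.

Lemma innerZl a x z : inner (a *: x) z = a * inner x z.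
Proof. exact: (linearZ_LR (innerl z)). Qed.

Lemma innerBl x y z : inner (x - y) z = inner x z - inner y z.
Proof. exact: (raddfB (innerl z)). Qed.

Lemma inner0l z : inner 0 z = 0 :> C R.
Proof. exact: (raddf0 (innerl z)). Qed.

Lemma inner_suml (J : Type) (r : seq J) (P : pred J) (F : J -> H) z :
  inner (\sum_(j <- r | P j) F j) z = \sum_(j <- r | P j) inner (F j) z.
Proof. exact: (raddf_sum (innerl z)). Qed.

Lemma innerDr x y z : inner z (x + y) = inner z x + inner z y.
Proof. by rewrite innerC innerDl rmorphD/= -!innerC. Qed.

Lemma innerZr a x z : inner z (a *: x) = conjc a * inner z x.
Proof. by rewrite innerC innerZl rmorphM/= -innerC. Qed.

Lemma innerBr x y z : inner z (x - y) = inner z x - inner z y.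
Proof. by rewrite innerC innerBl rmorphB/= -!innerC. Qed.

Lemma inner0r z : inner z 0 = 0 :> C R.
Proof. by rewrite innerC inner0l rmorph0. Qed.

Lemma inner_sumr (J : Type) (r : seq J) (P : pred J) (F : J -> H) z :
  inner z (\sum_(j <- r | P j) F j) = \sum_(j <- r | P j) inner z (F j).
Proof.
by rewrite innerC inner_suml rmorph_sum/=; apply: eq_bigr => j _; rewrite -innerC.
Qed.

Lemma ell2_hnormZ a x : hn (a *: x) = normc a * hn x.
Proof. by apply: (@complexI R); rewrite rmorphM/= ell2_normZ. Qed.

Lemma ell2_hnormN x : hn (- x) = hn x.
Proof. by rewrite -scaleN1r ell2_hnormZ normcN normc1 mul1r. Qed.

Lemma ell2_hnorm0 : hn (0 : H) = 0.
Proof. by rewrite -(scale0r (0 : H)) ell2_hnormZ normc0 mul0r. Qed.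

Lemma ell2_hnorm_eq0 x : hn x = 0 -> x = 0.
Proof. by move=> x0; apply: ell2_norm_eq0; rewrite -/(hn x) x0. Qed.

Lemma ler_hnormD x y : hn (x + y) <= hn x + hn y.
Proof. exact: (Defs.hnormD (ell2_funP x) (ell2_funP y)).2. Qed.

Lemma hdistC x y : hn (x - y) = hn (y - x).
Proof. by rewrite -ell2_hnormN opprB. Qed.

Lemma ler_hdistD z x y : hn (x - y) <= hn (x - z) + hn (z - y).
Proof. by rewrite -[x - y](subrKA z) ler_hnormD. Qed.

Lemma sqr_hnormD x y :
  hn (x + y) ^+ 2 = hn x ^+ 2 + hn y ^+ 2 + 2 * complex.Re (inner x y).
Proof.
have := congr1 (@complex.Re R) (innerxx (x + y)).
rewrite innerDl !innerDr (innerC x y) !innerxx/= => <-.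
by case: (inner x y) => a b /=; ring.
Qed.

Lemma normc_inner x y : normc (inner x y) <= hn x * hn y.
Proof.
have [y0|y0] := eqVneq (hn y) 0.
  by rewrite (ell2_hnorm_eq0 y0) inner0r normc0 ell2_hnorm0 mulr0.
rewrite -(@ler_pXn2r _ 2) ?nnegrE ?mulr_ge0 ?normc_ge0 ?hn_ge0//.
set c := inner x y; set h := hn y ^+ 2.
have h0 : 0 < h by rewrite exprn_even_gt0.
(* Cauchy-Schwarz from the vector |y|^2 x - <x, y> y; scaling by |y|^2 avoids dividing by it before
   the end. *)
have : 0 <= hn (h%:C *: x + - (c *: y)) ^+ 2 by rewrite sqr_ge0.
rewrite sqr_hnormD ell2_hnormN !ell2_hnormZ -scaleNr innerZr innerZl -/c normc_real.
rewrite ger0_norm ?(ltW h0)//.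
have -> : complex.Re (conjc (- c) * (h%:C * c)) = - (h * normc c ^+ 2).
  by case: (c) => a b /=; rewrite sqr_sqrtr ?addr_ge0 ?sqr_ge0//; ring.
rewrite !exprMn -/h => H0.
have : 0 <= h * (hn x ^+ 2 * h - normc c ^+ 2).
  by lra.
by rewrite pmulr_rge0// subr_ge0 -exprMn.
Qed.

End Inner.

(** * Bessel's inequality *)

Section Bessel.
Variables (R : realType) (I : choiceType).
Local Notation H := (ell2 R I).
Implicit Types x y z : H.

(* Zero vectors are allowed: they pad the decomposition of a finite rank operator. *)
Definition suborthonormal (v : nat -> H) :=
  (forall m n, m <> n -> inner (v m) (v n) = 0 :> C R) /\
  (forall n, v n = 0 \/ hn (v n) = 1).

Definition fourier (v : nat -> H) (N : nat) x : H :=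
  \sum_(n < N) (inner x (v n) : R[i]) *: v n.

Variable v : nat -> H.
Hypothesis ov : suborthonormal v.

Lemma inner_suborthonormal (c : nat -> R[i]) (N n : nat) :
  inner (\sum_(m < N) c m *: v m) (v n) =
  (if (n < N)%N then c n * inner (v n) (v n) else 0).
Proof.
rewrite inner_suml; case: ifPn => [nN|].
  rewrite (bigD1 (Ordinal nN))//= innerZl big1 ?addr0// => m /eqP mn.
  rewrite innerZl ov.1 ?mulr0// => /= mn'; apply: mn; exact: val_inj.
rewrite -leqNgt => Nn; rewrite big1// => m _.
by rewrite innerZl ov.1 ?mulr0// => mn; move: (ltn_ord m); rewrite mn ltnNge Nn.
Qed.

Lemma sqr_hnorm_comb (c : nat -> R[i]) N :
  hn (\sum_(n < N) c n *: v n : H) ^+ 2 =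
  \sum_(n < N) normc (c n) ^+ 2 * hn (v n) ^+ 2.
Proof.
apply: (@complexI R); rewrite -innerxx inner_sumr rmorph_sum/=.
apply: eq_bigr => n _; rewrite innerZr inner_suborthonormal ltn_ord.
rewrite innerxx; apply: etrans (mulrA (conjc (c n)) (c n) _) _.
have -> : conjc (c n) * c n = (normc (c n) ^+ 2)%:C by rewrite mulrC -sqr_normcE.
by rewrite -rmorphM.
Qed.

(** Pythagoras. A zero vector of the family contributes nothing to either side, since its Fourier
    coefficient vanishes. *)
Lemma sqr_hnorm_sub_fourier x N :
  hn (x - fourier v N x) ^+ 2 =
  hn x ^+ 2 - \sum_(n < N) normc (inner x (v n)) ^+ 2.
Proof.
set f := fourier v N x; set S := \sum_(n < N) _.
have A : hn f ^+ 2 = S.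
  rewrite (sqr_hnorm_comb (fun n => inner x (v n)) N).
  apply: eq_bigr => n _; case: (ov.2 n) => [->|->]; last by rewrite expr1n mulr1.
  by rewrite inner0r normc0 expr0n mul0r.
have B : inner x f = S%:C.
  rewrite inner_sumr rmorph_sum/=; apply: eq_bigr => n _.
  by rewrite innerZr mulrC -sqr_normcE.
have -> : x - f = x + (-1) *: f by rewrite scaleN1r.
rewrite sqr_hnormD ell2_hnormZ innerZr B normcN normc1 mul1r A.
by rewrite rmorphN rmorph1 mulN1r/=; lra.
Qed.

Lemma bessel x N : \sum_(n < N) normc (inner x (v n)) ^+ 2 <= hn x ^+ 2.
Proof. by rewrite -subr_ge0 -sqr_hnorm_sub_fourier sqr_ge0. Qed.

End Bessel.

Section Coordinates.
Variables (R : realType) (I : choiceType).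
Local Notation H := (ell2 R I).
Implicit Types x y z : H.

Lemma ell2_sumE (J : Type) (r : seq J) (P : pred J) (F : J -> H) i :
  (\sum_(j <- r | P j) F j : H) i = \sum_(j <- r | P j) F j i.
Proof. by elim/big_ind2 : _ => // x a y b <- <-. Qed.

Definition section x (A : {fset I}) : H :=
  \sum_(j <- A) (x j : R[i]) *: basis_vec R j.

Lemma sectionE x A i : section x A i = if i \in A then x i else 0.
Proof.
have E j : ((x j : R[i]) *: basis_vec R j) i = x j * (i == j)%:R by [].
rewrite ell2_sumE; case: ifPn => iA.
  rewrite (big_fsetD1 i)// E eqxx mulr1 big_seq big1; first exact: addr0.
  move=> j.
  by rewrite in_fsetD1 E eq_sym => /andP[/negbTE ->]; rewrite mulr0.
rewrite big_seq big1// => j jA; rewrite E; case: eqP => [ij|]; last by rewrite mulr0.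
by rewrite ij jA in iA.
Qed.

Lemma section_dense x (e : R) : 0 < e -> exists A, hn (x - section x A) < e.
Proof.
move=> e0; have /cvgrPdist_lt/(_ (e ^+ 2)) := @sqr_hnorm_cvg _ _ x.
rewrite exprn_gt0// => /(_ isT) [A _ /(_ A)]; rewrite /= fsubset_refl => /(_ isT) hA.
exists A; rewrite -(@ltr_pXn2r _ 2) ?nnegrE ?hn_ge0 ?ltW//.
apply: le_lt_trans (le_lt_trans (ler_norm _) hA).
apply: (@sqr_hnorm_le _ _ (x - section x A)) => B; rewrite lerBrDr.
(* The remainder vanishes on [A], so its squares over [B] and the squares of [x] over [A] together
   fit into one partial sum of [x] over the union. *)
apply: le_trans (sum_sqr_le_hnorm x (B `|` A)%fset).
have {2}-> : A = ((B `|` A) `&` A)%fset.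
  by apply/esym/fsetIidPr; exact: fsubsetUr.
have E i : normc ((x - section x A) i) ^+ 2 =
    if i \in A then 0 else normc (x i) ^+ 2.
  have -> : (x - section x A) i = x i - section x A i by [].
  rewrite sectionE; case: ifP => _; last by rewrite subr0.
  by rewrite subrr normc0 expr0n.
rewrite (eq_bigr _ (fun i _ => E i)).
rewrite [leLHS]addrC [leRHS](big_fsetID _ [pred i | i \in A])/=.
apply: lerD.
  rewrite le_eqVlt; apply/orP; left; apply/eqP; apply: eq_fbigl => i.
  by rewrite !inE.
rewrite (big_fsetID _ [pred i | i \in A])/= [X in X + _]big_seq big1 ?add0r; last first.
  by move=> i; rewrite !inE => /andP[_ ->].
rewrite -lee_fin -!sumEFin.
apply: (@le_trans _ _ (\sum_(i <- [fset i in B | i \notin A]%fset) (normc (x i) ^+ 2)%:E)%E).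
  rewrite big_seq [leRHS]big_seq; apply: lee_sum => i.
  by rewrite !inE => /andP[_ /negbTE ->].
apply: lee_sum_nneg_subfset => [i|i _ _]; last by rewrite lee_fin sqr_ge0.
by rewrite !inE => /andP[-> ->].
Qed.

Lemma inner_basis x (i : I) : inner x (basis_vec R i) = x i.
Proof.
apply: inner_unique; apply: cvg_near_cst.
apply: filterS (totally_ge [fset i]%fset) => A iA; rewrite partial_sumE.
have {}iA : i \in A by apply: (fsubsetP iA); rewrite inE.
rewrite (big_fsetD1 i)//= eqxx conjc1 mulr1 big_seq big1 ?addr0// => j.
by rewrite in_fsetD1 => /andP[/negbTE -> _]; rewrite conjc0 mulr0.
Qed.

Lemma hnorm_basis (i : I) : hn (basis_vec R i) = 1.
Proof.
have := innerxx (basis_vec R i); rewrite inner_basis/= eqxx => -[] /esym/eqP.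
by rewrite sqrp_eq1 ?hn_ge0// => /eqP.
Qed.

End Coordinates.

(** * Completeness of l_2 *)

Section Completeness.
Variables (R : realType) (I : choiceType).
Local Notation H := (ell2 R I).
Implicit Types x y z : H.

Lemma cvg_sum_real (T J : Type) (F : set_system T) (FF : Filter F) (r : seq J)
    (f : J -> T -> R) (l : J -> R) :
  (forall j, f j t @[t --> F] --> l j) ->
  \sum_(j <- r) f j t @[t --> F] --> \sum_(j <- r) l j.
Proof.
move=> h; elim: r => [|j r IH].
  by rewrite big_nil; under eq_fun do rewrite big_nil; exact: cvg_cst.
by rewrite big_cons; under eq_fun do rewrite big_cons; exact: cvgD.
Qed.

(** Lipschitz functionals form a class that covers both the real and the imaginary part of each
    coordinate. *)
Lemma cauchy_coordinate (F : set_system H) (FF : ProperFilter F) (f : H -> R) :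
  (forall x y, `|f x - f y| <= hn (x - y)) ->
  (forall e : R, 0 < e -> exists c, F [set x | hn (x - c) < e]) ->
  exists a : R, f @ F --> a.
Proof.
move=> hf hF; apply/cvg_ex; apply: cauchy_cvg; apply: cauchy_exP => e e0.
have [c hc] := hF e e0; exists (f c); apply: (@filterS _ F _ [set x | hn (x - c) < e]) => // x /= hx.
by rewrite -ball_normE /=; apply: le_lt_trans (hf _ _) _; rewrite hdistC.
Qed.

(** Coordinatewise limits exist, and bounds on finite partial sums survive the limit. Filters, not
    just sequences, are treated because the compactness criterion applies this to ultrafilters. *)
Lemma ell2_complete (F : set_system H) (FF : ProperFilter F) :
  (forall e : R, 0 < e -> exists c, F [set x | hn (x - c) < e]) ->
  exists l : H, forall e : R, 0 < e -> F [set x | hn (x - l) < e].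
Proof.
move=> hF.
have /choice[a ha] : forall i, exists a : R, (fun x : H => complex.Re (x i)) @ F --> a.
  move=> i; apply: cauchy_coordinate hF => x y.
  have -> : complex.Re (x i) - complex.Re (y i) = complex.Re ((x - y) i).
    by have -> : (x - y) i = x i - y i by []; case: (x i) (y i) => ? ? [].
  exact: le_trans (norm_Re_le _) (normc_le_hnorm _ _).
have /choice[b hb] : forall i, exists b : R, (fun x : H => complex.Im (x i)) @ F --> b.
  move=> i; apply: cauchy_coordinate hF => x y.
  have -> : complex.Im (x i) - complex.Im (y i) = complex.Im ((x - y) i).
    by have -> : (x - y) i = x i - y i by []; case: (x i) (y i) => ? ? [].
  exact: le_trans (norm_Im_le _) (normc_le_hnorm _ _).
pose l : I -> C R := fun i => (a i +i* b i).
(* The limit [l] is not yet known to be square summable, so the estimate concerns the bare function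
   [l - c]; with e = 1 it then yields the membership of [l]. *)
have key c (e : R) : 0 < e -> F [set x | hn (x - c) < e] ->
    (fun i => l i - c i) \in @square_summable R I /\ hnorm (fun i => l i - c i) <= e.
  move=> e0 Fc; apply: hnorm_le => [|A]; first exact: ltW.
  rewrite -[leRHS]gtr0_norm// -sqrtr_sqr ler_wsqrtr//.
  have sqE (z : R[i]) : normc z ^+ 2 = complex.Re z ^+ 2 + complex.Im z ^+ 2.
    by case: z => ? ? /=; rewrite sqr_sqrtr ?addr_ge0 ?sqr_ge0.
  apply: (@ler_cvg_to _ F _ R (fun x : H => \sum_(i <- A)
    ((complex.Re (x i) - complex.Re (c i)) ^+ 2 +
     (complex.Im (x i) - complex.Im (c i)) ^+ 2)) (fun=> e ^+ 2)); last first.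
  - apply: filterS Fc => x /= xc.
    apply: (@le_trans _ _ (hn (x - c) ^+ 2)); last first.
      by rewrite lerXn2r ?nnegrE ?hn_ge0 ?ltW.
    apply: le_trans (sum_sqr_le_hnorm (x - c) A); apply: ler_sum => i _.
    rewrite sqE; have -> : (x - c) i = x i - c i by [].
    by case: (x i) (c i) => ? ? [].
  - exact: cvg_cst.
  - under eq_bigr do rewrite sqE.
    apply: cvg_sum_real => i.
    by case: (c i) => c1 c2 /=; apply: cvgD; apply: cvgM;
      apply: cvgB; [exact: ha|exact: cvg_cst|exact: ha|exact: cvg_cst|
      exact: hb|exact: cvg_cst|exact: hb|exact: cvg_cst].
have [c0 hc0] := hF 1 ltr01.
have l2 : l \in @square_summable R I.
  have -> : l = (fun i => l i - c0 i) + ell2_fun c0.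
    by apply/funext => i; rewrite addrfctE subrK.
  by rewrite rpredD ?ell2_funP//; exact: (key _ _ ltr01 hc0).1.
exists (Ell2 l2) => e e0.
have e2 : 0 < e / 2 by rewrite divr_gt0.
have [c hc] := hF _ e2; have [_ lc] := key _ _ e2 hc.
apply: (@filterS _ F _ [set x | hn (x - c) < e / 2]) => // x /= hx.
have {}lc : hn (Ell2 l2 - c) <= e / 2 by [].
have D := ler_hdistD c x (Ell2 l2); rewrite (hdistC c (Ell2 l2)) in D.
by apply: le_lt_trans D _; rewrite [ltRHS]splitr; exact: ltr_leD.
Qed.

End Completeness.

Section Neighbourhoods.
Variables (R : realType) (I : choiceType).
Local Notation H := (ell2 R I).
Lemma nbhs_ell2 (x : H) (P : set H) : nbhs x P <-> exists2 r : R, 0 < r & forall y, hn (x - y) < r -> P y.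
Proof.
have E : nbhs x P <-> exists2 e : R[i], 0 < e & ball_ Num.norm x e `<=` P.
  exact: (@nbhs_normP _ (H : pseudoMetricNormedZmodType R[i]) x P).
rewrite E; split=> [[e /= /gt0C[r r0 ->] h]|[r r0 h]].
  exists r => // y xy; apply: h => /=.
  by rewrite -[ `|x - y|]/((hn (x - y))%:C) ltcR.
exists (r%:C); first by rewrite /= ltcR.
move=> y /=.
rewrite -[ `|x - y|]/((hn (x - y))%:C) ltcR; exact: h.
Qed.

End Neighbourhoods.

(** * Bounded and compact operators *)

Section Operators.
Variables (R : realType) (I : choiceType).
Local Notation H := (ell2 R I).
Implicit Types (x y z : H) (T S : H -> H) (c d e : R).

Lemma ler_eps_eq0 (a k : R) : 0 <= a -> 0 <= k ->
  (forall e, 0 < e -> a <= k * e) -> a = 0.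
Proof.
move=> a0 k0 h; apply/eqP; rewrite eq_le a0 andbT leNgt; apply/negP => a_gt0.
have k1 : 0 < k + 1 by rewrite ltr_wpDl.
have := h (a / (2 * (k + 1))); rewrite divr_gt0// ?mulr_gt0// => /(_ isT).
rewrite mulrA ler_pdivlMr ?mulr_gt0//; nra.
Qed.

Definition lin_of T (hT : linear T) : {linear H -> H} :=
  HB.pack T (GRing.isLinear.Build _ _ _ _ T hT).

Section Linear.
Variables (T : H -> H) (hT : linear T).
Lemma op0 : T 0 = 0. Proof. exact: (raddf0 (lin_of hT)). Qed.
Lemma opB x y : T (x - y) = T x - T y. Proof. exact: (raddfB (lin_of hT)). Qed.
Lemma opZ (a : R[i]) x : T (a *: x) = a *: T x.
Proof. exact: (linearZ_LR (lin_of hT)). Qed.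
Lemma op_sum (J : Type) (r : seq J) (P : pred J) (F : J -> H) :
  T (\sum_(j <- r | P j) F j) = \sum_(j <- r | P j) T (F j).
Proof. exact: (raddf_sum (lin_of hT)). Qed.
End Linear.

Definition opb T c := linear T /\ forall x, hn (T x) <= c * hn x.

Lemma opb_le T c d : c <= d -> opb T c -> opb T d.
Proof.
by move=> cd [lT bT]; split=> // x; apply: le_trans (bT x) _; rewrite ler_wpM2r ?hn_ge0.
Qed.

(** The constant in [opb] carries no sign: on the zero space it may be negative. Arguments that
    multiply an inequality by it pass to the maximum with 0 first. *)
Lemma opb_max T c : opb T c -> opb T (Num.max c 0).
Proof. by apply: opb_le; rewrite le_max lexx. Qed.

Lemma opbD T S c d : opb T c -> opb S d -> opb (fun x => T x + S x) (c + d).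
Proof.
move=> [lT bT] [lS bS]; split=> [a x y|x].
  by rewrite lT lS scalerDr addrACA.
by apply: le_trans (ler_hnormD _ _) _; rewrite mulrDl lerD.
Qed.

Lemma opbZ T c (a : R[i]) : opb T c -> opb (fun x => a *: T x) (normc a * c).
Proof.
move=> [lT bT]; split=> [b x y|x].
  by rewrite lT scalerDr !scalerA mulrC.
by rewrite ell2_hnormZ -mulrA ler_wpM2l ?normc_ge0.
Qed.

Lemma opbN T c : opb T c -> opb (fun x => - T x) c.
Proof.
move=> /(opbZ (-1)); rewrite normcN normc1 mul1r => -[lT bT]; split.
  by move=> a x y; have := lT a x y; rewrite !scaleN1r.
by move=> x; have := bT x; rewrite scaleN1r.
Qed.

Lemma opbB T S c d : opb T c -> opb S d -> opb (fun x => T x - S x) (c + d).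
Proof. by move=> hT /opbN; exact: opbD. Qed.

Lemma opb_rank1 x y : opb (fun z => (inner z x : R[i]) *: y) (hn x * hn y).
Proof.
split=> [a z w|z].
  by rewrite innerDl innerZl scalerDl scalerA.
by rewrite ell2_hnormZ mulrAC [hn x * _]mulrC ler_wpM2r ?hn_ge0 ?normc_inner.
Qed.

Lemma bounded_operatorP T : bounded_operator T <-> exists2 c, 0 <= c & opb T c.
Proof.
split=> [[lT cT]|[c c0 [lT bT]]]; last first.
  split=> // x P /nbhs_ell2[r r0 hr]; apply/nbhs_ell2.
  have c1 : 0 < c + 1 by rewrite ltr_wpDl.
  exists (r / (c + 1)) => [|y xy]; first by rewrite divr_gt0.
  apply: hr; rewrite -(opB lT); apply: le_lt_trans (bT (x - y)) _.
  move: xy; rewrite ltr_pdivlMr//; have := hn_ge0 (x - y); nra.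
have T0 : nbhs (T 0) [set y | hn (T 0 - y) < 1] by apply/nbhs_ell2; exists 1.
have /nbhs_ell2[d d0 hd] : nbhs (0 : H) (T @^-1` [set y | hn (T 0 - y) < 1]).
  exact: cT T0.
exists (2 / d); first by rewrite divr_ge0// ltW.
split=> // x; have [x0|x0] := eqVneq (hn x) 0.
  by rewrite (ell2_hnorm_eq0 x0) (op0 lT) ell2_hnorm0 mulr0.
have x_gt0 : 0 < hn x by rewrite lt_neqAle eq_sym x0 hn_ge0.
(* The factor [k] brings [x] to norm d / 2, strictly inside the ball on which [T] is bounded by
   1. *)
pose k := d / (2 * hn x); have kx : k * hn x = d / 2 by rewrite /k; field.
have k0 : 0 < k by rewrite divr_gt0 ?mulr_gt0.
have : hn (0 - k%:C *: x) < d -> hn (T 0 - T (k%:C *: x)) < 1 := hd _.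
rewrite (op0 lT) !sub0r (opZ lT).
rewrite !ell2_hnormN !ell2_hnormZ normc_real gtr0_norm// kx.
have -> : d / 2 < d by lra.
move=> /(_ isT) kT; rewrite mulrAC ler_pdivlMr//.
rewrite -(ler_pM2l k0).
have -> : k * (2 * hn x) = d by rewrite mulrCA kx; field.
nra.
Qed.

(** Linearity extends the agreement to truncations, and these are dense. *)
Lemma opb_ext T S c d : opb T c -> opb S d ->
  (forall i, T (basis_vec R i) = S (basis_vec R i)) -> T = S.
Proof.
move=> hT hS TS; have [lD bD] := opb_max (opbB hT hS).
apply/funext => x; apply/eqP; rewrite -subr_eq0; apply/eqP/ell2_hnorm_eq0.
set k := Num.max _ _ in bD; have k0 : 0 <= k by rewrite le_max lexx orbT.
apply: (ler_eps_eq0 (hn_ge0 _) k0) => e e0.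
have [A hA] := section_dense x e0.
have E : T (section x A) = S (section x A).
  rewrite (op_sum hT.1) (op_sum hS.1); apply: eq_bigr => j _.
  by rewrite (opZ hT.1) (opZ hS.1) TS.
have -> : T x - S x = T (x - section x A) - S (x - section x A).
  by rewrite (opB hT.1) (opB hS.1) E opprB addrA subrK.
by apply: le_trans (bD _) _; rewrite ler_wpM2l// ltW.
Qed.

Lemma matrix_of_inj T S c d : opb T c -> opb S d ->
  matrix_of T = matrix_of S -> T = S.
Proof.
move=> hT hS TS; apply: (opb_ext hT hS) => j; apply/val_inj/funext => i.
exact: (congr1 (fun m => m i j) TS).
Qed.

(** [operator_of] picks some bounded operator with the given matrix; injectivity of [matrix_of]
    identifies the choice. *)
Lemma operator_of_matrix T c : opb T c -> operator_of (matrix_of T) = T.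
Proof.
move=> hT.
have [bS SE] : bounded_operator (operator_of (matrix_of T)) /\
    matrix_of (operator_of (matrix_of T)) = matrix_of T.
  apply: (@getPex _ [set S | bounded_operator S /\ matrix_of S = matrix_of T]).
  exists T; split=> //; apply/bounded_operatorP; exists (Num.max c 0).
    by rewrite le_max lexx orbT.
  exact: opb_max.
by move: bS => /bounded_operatorP[d _ hS]; exact: matrix_of_inj hS hT SE.
Qed.

End Operators.

(** * Existence and uniqueness of adjoints *)

Section Adjoint.
Variables (R : realType) (I : choiceType).
Local Notation H := (ell2 R I).
Implicit Types (x y z : H) (T S : H -> H) (c d e : R).

Definition adjoint_pair T S := forall x y, inner (T x) y = inner x (S y) :> C R.

Lemma inner_extr x y : (forall z, inner z x = inner z y :> C R) -> x = y.
Proof.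
move=> h; apply/val_inj/funext => i.
by rewrite /= -!inner_basis ![inner _ (basis_vec _ _)]innerC h.
Qed.

Lemma adjoint_pair_unique T S S' :
  adjoint_pair T S -> adjoint_pair T S' -> S = S'.
Proof.
by move=> TS TS'; apply/funext => y; apply: inner_extr => x; rewrite -TS TS'.
Qed.

Lemma adjoint_pair_sym T S : adjoint_pair T S -> adjoint_pair S T.
Proof. by move=> TS x y; rewrite innerC -TS -innerC. Qed.

Lemma adjoint_pair_linear T S : adjoint_pair T S -> linear S.
Proof.
move=> TS a x y; apply: inner_extr => z.
by rewrite -TS !innerDr !innerZr !TS.
Qed.

(** |S y|^2 = <T S y, y> is at most c |S y| |y|, and |S y| cancels. *)
Lemma adjoint_opb T S c : opb T c -> adjoint_pair T S -> opb S c.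
Proof.
move=> [lT bT] TS; split; first exact: adjoint_pair_linear TS.
move=> y; have [y0|y0] := eqVneq (hn (S y)) 0.
  (* With [c] of unknown sign, 0 <= c |y| is read off from the bound on |T y|. *)
  rewrite y0; have [->|hy] := eqVneq (hn y) 0; first by rewrite mulr0.
  have := bT y => /(le_trans (hn_ge0 _)).
  by [].
have S_gt0 : 0 < hn (S y) by rewrite lt_neqAle eq_sym y0 hn_ge0.
rewrite -(ler_pM2l S_gt0) -expr2.
have -> : hn (S y) ^+ 2 = normc (inner (T (S y)) y).
  by rewrite TS innerxx normc_real ger0_norm ?sqr_ge0.
apply: le_trans (normc_inner _ _) _.
rewrite mulrA [hn (S y) * c]mulrC ler_wpM2r ?hn_ge0//.
Qed.

(** The j-th coordinate of S y has to be <y, T e_j>. For square summability, test against z, the sum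
    over j in A of <y, T e_j> e_j: the partial sum s equals <y, T z> and |z|^2 <= s, so s <= c |y|
    sqrt(s). The adjoint relation holds on truncations and extends by density. *)
Lemma adjoint_exists T c : 0 <= c -> opb T c ->
  exists2 S, opb S c & adjoint_pair T S.
Proof.
move=> c0 [lT bT].
have bound y (A : {fset I}) :
    \sum_(j <- A) normc (inner y (T (basis_vec R j))) ^+ 2 <= (c * hn y) ^+ 2.
  set s := \sum_(j <- A) _.
  have s0 : 0 <= s by apply: sumr_ge0 => j _; rewrite sqr_ge0.
  pose f j : C R := if j \in A then inner y (T (basis_vec R j)) else 0.
  have fB (B : {fset I}) : \sum_(j <- B) normc (f j) ^+ 2 <= s.
    rewrite (big_fsetID _ [pred j | j \in A])/= [X in _ + X]big_seq [X in _ + X]big1; last first.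
      by move=> j; rewrite !inE => /andP[_ /negbTE jA]; rewrite /f jA normc0 expr0n.
    rewrite addr0 -lee_fin -!sumEFin.
    apply: (@le_trans _ _ (\sum_(j <- [fset j in B | j \in A]%fset)
       (normc (inner y (T (basis_vec R j))) ^+ 2)%:E)%E).
      rewrite big_seq [leRHS]big_seq; apply: lee_sum => j.
      by rewrite !inE /f => /andP[_ ->].
    apply: lee_sum_nneg_subfset => [i|i _ _]; last by rewrite lee_fin sqr_ge0.
    by rewrite !inE => /andP[].
  pose z := Ell2 (square_summableP fB).
  have zs : hn z ^+ 2 <= s by apply: sqr_hnorm_le => B; exact: fB.
  have zE : z = \sum_(j <- A) (inner y (T (basis_vec R j)) : R[i]) *: basis_vec R j.
    have -> : \sum_(j <- A) (inner y (T (basis_vec R j)) : R[i]) *: basis_vec R j =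
        section z A.
      rewrite /section big_seq [RHS]big_seq; apply: eq_bigr => j jA.
      by rewrite /z /= /f jA.
    apply/val_inj/funext => j; rewrite [RHS]sectionE /=.
    by case: ifPn => // /negbTE jA; rewrite /f jA.
  have : normc (inner y (T z)) = s.
    rewrite zE (op_sum lT) inner_sumr.
    have -> : \sum_(j <- A) inner y (T ((inner y (T (basis_vec R j)) : R[i]) *: basis_vec R j))
        = (s%:C : C R).
      rewrite rmorph_sum/=; apply: eq_bigr => j _.
      by rewrite (opZ lT) innerZr mulrC -sqr_normcE.
    by rewrite normc_real ger0_norm.
  have := normc_inner y (T z); have := bT z => h1 h2 h3; rewrite h3 in h2.
  have h4 : s <= hn y * (c * hn z) by apply: le_trans h2 _; rewrite ler_wpM2l ?hn_ge0.
  have k0 : 0 <= c * hn y by rewrite mulr_ge0 ?hn_ge0.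
  have h5 : s ^+ 2 <= (c * hn y) ^+ 2 * s.
    apply: (@le_trans _ _ ((c * hn y) ^+ 2 * hn z ^+ 2)); last by rewrite ler_wpM2l ?sqr_ge0.
    rewrite -exprMn lerXn2r ?nnegrE ?mulr_ge0 ?hn_ge0//.
    by have -> : c * hn y * hn z = hn y * (c * hn z) by ring.
  have [->|s_neq0] := eqVneq s 0; first by rewrite sqr_ge0.
  have s_gt0 : 0 < s by rewrite lt_neqAle eq_sym s_neq0.
  by rewrite -(ler_pM2r s_gt0) -expr2.
have sq y : (fun j => inner y (T (basis_vec R j)) : C R) \in @square_summable R I.
  by apply: (square_summableP (c := (c * hn y) ^+ 2)) => A; exact: bound.
pose S y : H := Ell2 (sq y).
have SbT : adjoint_pair T S.
  move=> x y; apply/eqP; rewrite -subr_eq0; apply/eqP/eq0_normc.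
  apply: (@ler_eps_eq0 _ _ (c * hn y + hn (S y))) => [||e e0].
  - exact: normc_ge0.
  - by rewrite addr_ge0 ?mulr_ge0 ?hn_ge0.
  have [A hA] := section_dense x e0.
  have E : inner (T (section x A)) y = inner (section x A) (S y).
    rewrite (op_sum lT) !inner_suml; apply: eq_bigr => j _.
    rewrite (opZ lT) !innerZl; congr (_ * _).
    by rewrite [RHS]innerC inner_basis /= -innerC.
  have -> : inner (T x) y - inner x (S y) =
      inner (T (x - section x A)) y - inner (x - section x A) (S y).
    by rewrite (opB lT) !innerBl E opprB addrA subrK.
  apply: le_trans (normcD _ _) _; rewrite normcN mulrDl; apply: lerD.
    apply: le_trans (normc_inner _ _) _; rewrite mulrAC ler_wpM2r ?hn_ge0//.
    by apply: le_trans (bT _) _; rewrite ler_wpM2l// ltW.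
  apply: le_trans (normc_inner _ _) _; rewrite mulrC ler_wpM2l ?hn_ge0//.
  exact: ltW.
by exists S => //; exact: (adjoint_opb (conj lT bT)).
Qed.

Lemma adjointE T S c : opb T c -> adjoint_pair T S -> adjoint T = S.
Proof.
move=> hT TS; have [_ adj] : bounded_operator (adjoint T) /\ adjoint_pair T (adjoint T).
  apply: (@getPex _ [set S | bounded_operator S /\
               forall x y, inner (T x) y = inner x (S y)]).
  exists S; split=> //; apply/bounded_operatorP; exists (Num.max c 0).
    by rewrite le_max lexx orbT.
  exact: adjoint_opb (opb_max hT) TS.
exact: adjoint_pair_unique adj TS.
Qed.

End Adjoint.

(** * Singular value decomposition by successive removal of singular vectors *)

Section SVD.
Variables (R : realType) (I : choiceType).
Local Notation H := (ell2 R I).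
Implicit Types (x y z : H) (T S : H -> H) (c d e : R).

Lemma compact_cluster_seq (K : set H) (x : nat -> H) : compact K ->
  (forall n, K (x n)) ->
  exists y, forall e (N : nat), 0 < e -> exists2 n, (N <= n)%N & hn (x n - y) < e.
Proof.
move=> cK Kx.
have xK : (x @ \oo) K by exists 0%N => // n _; exact: Kx.
have [y [_ cy]] := cK (x @ \oo) _ xK.
exists y => e N e0.
have A : (x @ \oo) (x @` [set n | (N <= n)%N]) by exists N => // n Nn; exists n.
have B : nbhs y [set z | hn (y - z) < e] by apply/nbhs_ell2; exists e.
have [_ [[n Nn <-] yn]] := cy _ _ A B.
by exists n => //; rewrite hdistC.
Qed.

Definition unit_image T : set H := T @` [set x : H | hn x <= 1].

(** In the nondegenerate case [opb T s] is attained at [v], so [s] is the norm of [T]. The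
    degenerate case keeps the removal process running once the operator is exhausted. *)
Definition singular_triple T S (s : R) u v :=
  [/\ 0 <= s, opb T s, T v = s%:C *: u, S u = s%:C *: v &
    (s = 0 /\ u = 0 /\ v = 0) \/ (0 < s /\ hn u = 1 /\ hn v = 1)].

(* If y is a cluster point of T x_n for a maximizing sequence x_n in the unit ball,
   then x_n comes close to v := S y / s^2, because |x_n - v|^2 <= 2 - 2 Re <T x_n, y> / s^2;
   hence T v = y. *)
Lemma singular_triple_exists T S c (K : set H) :
  opb T c -> adjoint_pair T S -> compact K -> unit_image T `<=` K ->
  exists s u v, singular_triple T S s u v.
Proof.
move=> hT TS cK TK; have [lT _] := hT; have lS := adjoint_pair_linear TS.
pose A := [set hn (T x) | x in [set x : H | hn x <= 1]].
have A0 : A 0 by exists 0 => /=; rewrite ?(op0 lT) ell2_hnorm0.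
have hA : has_sup A.
  split; first by exists 0.
  exists (Num.max c 0) => _ [x /= x1 <-].
  apply: le_trans ((opb_max hT).2 x) _.
  by rewrite ler_piMr// le_max lexx orbT.
pose s := sup A.
have s0 : 0 <= s by apply: (ub_le_sup hA.2 A0).
have Ts : opb T s.
  split=> // x; have [x0|x0] := eqVneq (hn x) 0.
    by rewrite (ell2_hnorm_eq0 x0) (op0 lT) ell2_hnorm0 mulr0.
  have x_gt0 : 0 < hn x by rewrite lt_neqAle eq_sym x0 hn_ge0.
  have : A (hn (T ((hn x)^-1%:C *: x))).
    exists ((hn x)^-1%:C *: x) => //=.
    by rewrite ell2_hnormZ normc_real gtr0_norm ?invr_gt0// mulVf.
  move=> /(ub_le_sup hA.2); rewrite (opZ lT) ell2_hnormZ normc_real.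
  by rewrite gtr0_norm ?invr_gt0// ler_pdivrMl// mulrC.
have [s_eq0|s_neq0] := eqVneq s 0.
  exists 0, 0, 0; split=> //; rewrite ?scaler0 ?(op0 lT) ?(op0 lS)//.
  - by rewrite -s_eq0.
  - by left.
have s_gt0 : 0 < s by rewrite lt_neqAle eq_sym s_neq0.
have /choice[x hx] : forall n : nat, exists x, hn x <= 1 /\ s - n.+1%:R^-1 < hn (T x).
  move=> n; have n0 : 0 < n.+1%:R^-1 :> R by rewrite invr_gt0.
  have [_ [x /= x1 <-] xs] := sup_adherent n0 hA.
  by exists x.
have [y hy] := compact_cluster_seq cK (fun n => TK _ (imageP T (hx n).1)).
have near_y e : 0 < e -> exists n, [/\ hn (x n) <= 1, s - e < hn (T (x n)) &
    hn (T (x n) - y) < e].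
  move=> e0; have [N hN] : exists N : nat, forall n, (N <= n)%N -> n.+1%:R^-1 < e.
    by have [N _ hN] := near_infty_natSinv_lt (PosNum e0); exists N => n; exact: hN.
  have [n Nn yn] := hy e N e0; exists n; split=> //; first exact: (hx n).1.
  by apply: le_lt_trans (hx n).2; rewrite lerD2l lerN2 ltW// hN.
have hTx n : hn (T (x n)) <= s.
  by apply: le_trans (Ts.2 _) _; rewrite ler_piMr// (hx n).1.
have ys : hn y = s.
  apply/eqP; rewrite -subr_eq0 -normr_eq0; apply/eqP.
  apply: (@ler_eps_eq0 _ _ 2) => // e e0; have [n [_ h1 h2]] := near_y e e0.
  have := ler_hnormD (T (x n) - y) y; rewrite subrK.
  have := ler_hnormD (y - T (x n)) (T (x n)); rewrite subrK hdistC.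
  have := hTx n; rewrite ler_norml; lra.
pose z := S y; have Ss : opb S s := adjoint_opb Ts TS.
have zs : hn z <= s * s by apply: le_trans (Ss.2 _) _; rewrite ys.
pose v := (s ^- 2)%:C *: z; pose u := s^-1%:C *: y.
have v1 : hn v <= 1.
  rewrite ell2_hnormZ normc_real gtr0_norm ?invr_gt0 ?exprn_gt0//.
  by rewrite ler_pdivrMl ?exprn_gt0// mulr1 expr2.
have close e : 0 < e -> forall n, hn (x n) <= 1 -> hn (T (x n) - y) < e ->
    hn (x n - v) ^+ 2 <= 2 * e / s.
  move=> e0 n x1 xy.
  have Re_lb : s ^+ 2 - e * s <= complex.Re (inner (x n) z).
    have -> : inner (x n) z = inner (T (x n) - y) y + (s ^+ 2)%:C.
      by rewrite -TS innerBl innerxx ys subrK.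
    have N1 : normc (inner (T (x n) - y) y) <= e * s.
      apply: le_trans (normc_inner _ _) _; rewrite ys ler_wpM2r//.
      exact: ltW.
    have N2 := norm_Re_le (inner (T (x n) - y) y).
    rewrite raddfD/=; move: N1 N2; rewrite ler_norml; lra.
  have -> : x n - v = x n + (-1) *: v by rewrite scaleN1r.
  rewrite sqr_hnormD ell2_hnormZ normcN normc1 mul1r innerZr innerZr.
  have -> : complex.Re (conjc (-1) * (conjc (s ^- 2)%:C * inner (x n) z)) =
      - (s ^- 2 * complex.Re (inner (x n) z)).
    by case: (inner (x n) z) => a b /=; ring.
  have v2 : hn v ^+ 2 <= 1 by rewrite expr_le1 ?hn_ge0.
  have x2 : hn (x n) ^+ 2 <= 1 by rewrite expr_le1 ?hn_ge0.
  have : s ^- 2 * (s ^+ 2 - e * s) <= s ^- 2 * complex.Re (inner (x n) z).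
    by rewrite ler_wpM2l// invr_ge0 sqr_ge0.
  have -> : s ^- 2 * (s ^+ 2 - e * s) = 1 - e / s by field.
  lra.
have Tv : T v = y.
  apply/eqP; rewrite -subr_eq0; apply/eqP/ell2_hnorm_eq0.
  apply: (@ler_eps_eq0 _ _ (s + 1)) => [||e e0]; rewrite ?hn_ge0 ?addr_ge0//.
  (* [close] gives |x_n - v|^2 <= 2 d / s, which the second argument of the minimum makes at most
     e^2; the first keeps T x_n within e of y. *)
  pose d := Num.min e (s * e ^+ 2 / 2).
  have d0 : 0 < d by rewrite lt_min e0 divr_gt0 ?mulr_gt0 ?exprn_gt0.
  have [n [x1 _ xy]] := near_y d d0.
  have xv : hn (x n - v) <= e.
    rewrite -(@ler_pXn2r _ 2) ?nnegrE ?hn_ge0 ?(ltW e0)//.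
    apply: le_trans (close d d0 n x1 xy) _; rewrite ler_pdivrMr//.
    have : d <= s * e ^+ 2 / 2 by rewrite ge_min lexx orbT.
    lra.
  have dist : hn (T v - y) <= hn (T v - T (x n)) + hn (T (x n) - y) := ler_hdistD _ _ _.
  apply: le_trans dist _; rewrite mulrDl mul1r; apply: lerD.
    rewrite -(opB lT); apply: le_trans (Ts.2 _) _.
    by rewrite ler_wpM2l// hdistC.
  by apply: ltW; apply: lt_le_trans xy _; rewrite ge_min lexx.
exists s, u, v; split=> //.
- by rewrite Tv scalerA -rmorphM/= divff// scale1r.
- rewrite (opZ lS) -/z scalerA -rmorphM; congr (_%:C *: _).
  by rewrite /=; field.
- right; split=> //; split.
    by rewrite ell2_hnormZ normc_real gtr0_norm ?invr_gt0// ys mulVf.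
  apply/eqP; rewrite eq_le v1/= -(ler_pM2l s_gt0) mulr1.
  by apply: le_trans (Ts.2 v); rewrite Tv ys.
Qed.

End SVD.

Lemma conjcMr (R : realType) (a : R) (z : R[i]) : conjc (a%:C * z) = a%:C * conjc z.
Proof. by rewrite rmorphM/= oppr0. Qed.

Section SVDExists.
Variables (R : realType) (I : choiceType).
Local Notation H := (ell2 R I).
Implicit Types (x y z : H) (T S : H -> H) (c d e : R).

Definition spectral_sum (s : nat -> R) (u v : nat -> H) N x : H :=
  \sum_(n < N) ((s n)%:C * inner x (v n)) *: u n.

(** [svd_inner] says T* u_n = s_n v_n without mentioning the adjoint. [svd_rem] together with
    [svd_to0] gives convergence of the partial sums in operator norm. *)
Record svd T (s : nat -> R) (u v : nat -> H) : Prop := Svd {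
  svd_ge0 : forall n, 0 <= s n;
  svd_nonincr : forall m n, (m <= n)%N -> s n <= s m;
  svd_to0 : forall e, 0 < e -> exists N, s N < e;
  svd_orthl : suborthonormal u;
  svd_orthr : suborthonormal v;
  svd_cases : forall n, (s n = 0 /\ u n = 0 /\ v n = 0) \/
                        (0 < s n /\ hn (u n) = 1 /\ hn (v n) = 1);
  svd_vec : forall n, T (v n) = (s n)%:C *: u n;
  svd_inner : forall x n, inner (T x) (u n) = (s n)%:C * inner x (v n);
  svd_rem : forall N, opb (fun x => T x - spectral_sum s u v N x) (s N) }.

Lemma hn_sub_proj x v : v = 0 \/ hn v = 1 -> hn (x - (inner x v : R[i]) *: v) <= hn x.
Proof.
move=> hv; rewrite -(@ler_pXn2r _ 2) ?nnegrE ?hn_ge0//.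
have -> : x - (inner x v : R[i]) *: v = x + (-1) *: ((inner x v : R[i]) *: v).
  by rewrite scaleN1r.
rewrite sqr_hnormD !ell2_hnormZ normcN normc1 mul1r innerZr innerZr.
have -> : complex.Re (conjc (-1) * (conjc (inner x v) * inner x v)) =
    - normc (inner x v) ^+ 2.
  by case: (inner x v) => a b /=; rewrite sqr_sqrtr ?addr_ge0 ?sqr_ge0//; ring.
case: hv => [->|->]; last by rewrite mulr1; have := sqr_ge0 (normc (inner x v)); lra.
by rewrite inner0r normc0 mul0r; lra.
Qed.

Variables (T S : H -> H) (c0 : R) (K : set H).
Hypotheses (hT : opb T c0) (TS : adjoint_pair T S) (cK : compact K)
  (TK : unit_image T `<=` K).

Let pick (w : (H -> H) * (H -> H)) : R * H * H :=
  xget (0, 0, 0) [set t | singular_triple w.1 w.2 t.1.1 t.1.2 t.2].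

Let next (w : (H -> H) * (H -> H)) : (H -> H) * (H -> H) :=
  let: (s, u, v) := pick w in
  ((fun x => w.1 x - (s%:C * inner x v) *: u),
   (fun x => w.2 x - (s%:C * inner x u) *: v)).

Let st n := iter n next (T, S).
Let s n := (pick (st n)).1.1.
Let u n := (pick (st n)).1.2.
Let v n := (pick (st n)).2.

(** The invariant of the removal process. The new operator is the old one composed with the
    contraction x - <x, v_n> v_n, so its unit image stays in the same compact set [K], and
    [singular_triple_exists] applies again. *)
Let admissible (w : (H -> H) * (H -> H)) :=
  [/\ exists c, opb w.1 c, adjoint_pair w.1 w.2 & unit_image w.1 `<=` K].

Let pickP w : admissible w ->
  singular_triple w.1 w.2 (pick w).1.1 (pick w).1.2 (pick w).2.
Proof.
move=> [[c hc] adj sub].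
have [a [x [y axy]]] := singular_triple_exists hc adj cK sub.
exact: (@xgetPex _ (0, 0, 0)
  [set t | singular_triple w.1 w.2 t.1.1 t.1.2 t.2] (ex_intro _ (a, x, y) axy)).
Qed.

Let stS n : st n.+1 = ((fun x => (st n).1 x - ((s n)%:C * inner x (v n)) *: u n),
  (fun x => (st n).2 x - ((s n)%:C * inner x (u n)) *: v n)).
Proof.
rewrite /st iterS -/(st n) /next /s /u /v.
by case: (pick (st n)) => [[]].
Qed.

Let triple_cases w a x y : singular_triple w.1 w.2 a x y ->
  (x = 0 \/ hn x = 1) /\ (y = 0 \/ hn y = 1).
Proof.
by case=> _ _ _ _ [[_ [-> ->]]|[_ [-> ->]]]; split; [left|left|right|right].
Qed.

Let nextE n : admissible (st n) -> forall x,
  (st n.+1).1 x = (st n).1 (x - (inner x (v n) : R[i]) *: v n).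
Proof.
move=> an x; rewrite stS/=; have [[c [lw _]] _ _] := an.
have [_ _ wv _ _] := pickP an.
by rewrite (opB lw) (opZ lw) wv scalerA mulrC.
Qed.

Let st_opb n c : admissible (st n) -> opb (st n).1 c -> opb (st n.+1).1 c.
Proof.
move=> an hc; have [_ hv] := triple_cases (pickP an).
have c0' : opb (st n).1 (Num.max c 0) := opb_max hc.
split=> [a x y|x].
  rewrite !nextE// innerDl innerZl scalerDl -scalerA.
  by rewrite opprD addrACA -scalerBr hc.1.
rewrite nextE//; have h := hc.2 (x - (inner x (v n) : R[i]) *: v n).
apply: le_trans h _.
have [c_ge0|c_lt0] := leP 0 c; first by rewrite ler_wpM2l// hn_sub_proj.
have hz z : hn z = 0.
  by have := hn_ge0 z; have := hc.2 z; have := hn_ge0 ((st n).1 z); nra.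
by rewrite !hz.
Qed.

Let st_admissible n : admissible (st n).
Proof.
elim: n => [|n an]; first by split=> //; exists c0.
have [_ hv] := triple_cases (pickP an).
have [[c hc] adj sub] := an; split.
- by exists c; exact: st_opb.
- move=> x y; rewrite stS/= innerBl innerBr innerZl innerZr adj conjcMr -innerC.
  by congr (_ - _); rewrite -!mulrA [inner _ (v n) * _]mulrC.
- apply: subset_trans sub => _ [x /= x1 <-]; rewrite nextE//.
  exists (x - (inner x (v n) : R[i]) *: v n) => //=.
  by apply: le_trans x1; exact: hn_sub_proj.
Qed.

Let tripleP n : singular_triple (st n).1 (st n).2 (s n) (u n) (v n).
Proof. exact: pickP. Qed.

(** Each remainder and its adjoint vanish on the vectors already removed. Since s_n v_n is the image
    of u_n under the adjoint of the n-th remainder, and symmetrically for u_n, this forces the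
    orthogonality in [orth]. *)
Let kernel n : forall j, (j < n)%N -> (st n).1 (v j) = 0 /\ (st n).2 (u j) = 0.
Proof.
elim: n => // n IH j; rewrite ltnS leq_eqVlt => /predU1P[->|jn].
  rewrite stS/=; have [_ _ -> -> [[-> [-> ->]]|[sn [un vn]]]] := tripleP n.
    by rewrite !scaler0 subrr.
  by rewrite !innerxx un vn expr1n rmorph1 !mulr1 !subrr.
have [Tj Sj] := IH _ jn; rewrite stS/= Tj Sj.
have [_ _ Tn Sn [[-> [-> ->]]|[sn [un vn]]]] := tripleP n.
  by rewrite !scaler0 subrr.
have adj : adjoint_pair (st n).1 (st n).2 by have [] := st_admissible n.
have E1 : (s n)%:C * inner (v j) (v n) = 0.
  by rewrite -conjc_real -innerZr -Sn -adj Tj inner0l.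
have E2 : (s n)%:C * inner (u j) (u n) = 0.
  by rewrite -conjc_real -innerZr -Tn -(adjoint_pair_sym adj) Sj inner0l.
by rewrite E1 E2 !scale0r subrr.
Qed.

Let orth j n : (j < n)%N -> inner (v n) (v j) = 0 /\ inner (u n) (u j) = 0.
Proof.
move=> jn; have [Tj Sj] := kernel jn.
have [_ _ Tn Sn [[_ [-> ->]]|[sn [un vn]]]] := tripleP n.
  by rewrite !inner0l.
have adj : adjoint_pair (st n).1 (st n).2 by have [] := st_admissible n.
have s0 : (s n)%:C != 0 :> R[i] by rewrite (inj_eq (@complexI R)) gt_eqF.
split; apply: (mulfI s0); rewrite mulr0 -innerZl.
  by rewrite -Sn (adjoint_pair_sym adj) Tj inner0r.
by rewrite -Tn adj Sj inner0r.
Qed.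

Let st1E n x : (st n).1 x = T x - spectral_sum s u v n x.
Proof.
elim: n => [|n IH]; first by rewrite /spectral_sum big_ord0 subr0.
by rewrite stS/= IH /spectral_sum big_ord_recr/= opprD addrA.
Qed.

Let st2E n x : (st n).2 x = S x - spectral_sum s v u n x.
Proof.
elim: n => [|n IH]; first by rewrite /spectral_sum big_ord0 subr0.
by rewrite stS/= IH /spectral_sum big_ord_recr/= opprD addrA.
Qed.

Let Tv n : T (v n) = (s n)%:C *: u n.
Proof.
have [_ _ <- _ _] := tripleP n; rewrite st1E /spectral_sum big1 ?subr0// => j _.
by rewrite (orth (ltn_ord j)).1 mulr0 scale0r.
Qed.

Let Su n : S (u n) = (s n)%:C *: v n.
Proof.
have [_ _ _ <- _] := tripleP n; rewrite st2E /spectral_sum big1 ?subr0// => j _.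
by rewrite (orth (ltn_ord j)).2 mulr0 scale0r.
Qed.

(** Removing a pair does not increase the norm, and s_{j+1} is the norm of the next remainder at the
    unit vector v_{j+1}. *)
Let s_nonincr m n : (m <= n)%N -> s n <= s m.
Proof.
move=> /subnKC <-; elim: (n - m)%N => [|k IH]; first by rewrite addn0.
rewrite addnS; apply: le_trans IH; set j := (m + k)%N.
have [j0 hj _ _ _] := tripleP j; have [_ _ Tj _ [[-> _]//|[sj [uj vj]]]] := tripleP j.+1.
have := (st_opb (st_admissible j) hj).2 (v j.+1).
by rewrite Tj ell2_hnormZ normc_real gtr0_norm// uj vj !mulr1.
Qed.

Let s_ge0 n : 0 <= s n. Proof. by have [] := tripleP n. Qed.

Let sub_v : suborthonormal v.
Proof.
split=> [m n mn|n]; last exact: (triple_cases (tripleP n)).2.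
have [lmn|lnm|//] := ltngtP m n; last exact: (orth lnm).1.
by rewrite innerC (orth lmn).1 conjc0.
Qed.

Let sub_u : suborthonormal u.
Proof.
split=> [m n mn|n]; last exact: (triple_cases (tripleP n)).1.
have [lmn|lnm|//] := ltngtP m n; last exact: (orth lnm).2.
by rewrite innerC (orth lmn).2 conjc0.
Qed.

(** If all s_n were at least e, the vectors T v_n would be orthogonal of norm at least e, hence
    pairwise at distance at least e, although they lie in the compact set [K]. *)
Let s_to0 e : 0 < e -> exists N, s N < e.
Proof.
move=> e0; apply: contrapT => /forallNP sge.
have {}sge n : e <= s n by rewrite leNgt; apply/negP.
have un n : hn (u n) = 1 /\ hn (v n) = 1.
  have [_ _ _ _ [[sn _]|[_ []]]//] := tripleP n.
  by have := sge n; rewrite sn => /(lt_le_trans e0); rewrite ltxx.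
have vK n : K (T (v n)) by apply: TK; exists (v n) => //=; rewrite (un n).2.
have [y hy] := compact_cluster_seq cK vK.
have e2 : 0 < e / 2 by rewrite divr_gt0.
have [n _ ny] := hy _ 0%N e2; have [m nm my] := hy _ n.+1 e2.
have : hn (T (v n) - T (v m)) < e.
  have h := ler_hdistD y (T (v n)) (T (v m)); rewrite (hdistC y (T (v m))) in h.
  by apply: le_lt_trans h _; rewrite [ltRHS]splitr; exact: ltrD ny my.
rewrite -(@ltr_pXn2r _ 2) ?nnegrE ?hn_ge0 ?(ltW e0)// => lt2.
have : hn (T (v n) - T (v m)) ^+ 2 = s n ^+ 2 + s m ^+ 2.
  have -> : T (v n) - T (v m) = (s n)%:C *: u n + (- s m)%:C *: u m.
    by rewrite !Tv rmorphN/= scaleNr.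
  have uu : inner (u n) (u m) = 0.
    by apply: sub_u.1 => E; rewrite E ltnn in nm.
  have -> : hn ((s n)%:C *: u n + (- s m)%:C *: u m) ^+ 2 =
      hn ((s n)%:C *: u n) ^+ 2 + hn ((- s m)%:C *: u m) ^+ 2.
    by rewrite sqr_hnormD innerZl innerZr uu mulr0 /= !mulr0 subrr mulr0 addr0.
  rewrite !ell2_hnormZ !normc_real normrN !ger0_norm//.
  by rewrite (un n).1 (un m).1 !mulr1.
move=> lt2E; move: lt2; rewrite lt2E ltNge => /negP; apply.
have sq k : e ^+ 2 <= s k ^+ 2 by rewrite lerXn2r ?nnegrE ?(ltW e0).
by apply: le_trans (sq n) _; rewrite lerDl sqr_ge0.
Qed.

Lemma svd_exists : exists s u v, svd T s u v.
Proof.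
exists s, u, v; split=> //.
- by move=> n; have [_ _ _ _] := tripleP n.
- by move=> x n; rewrite TS Su innerZr conjc_real.
- move=> N; have [_ h _ _ _] := tripleP N.
  have <- : (st N).1 = (fun x => T x - spectral_sum s u v N x).
    by apply/funext => x; exact: st1E.
  by [].
Qed.

End SVDExists.

Section CompactSVD.
Variables (R : realType) (I : choiceType).
Local Notation H := (ell2 R I).

Lemma compact_svd (T : H -> H) : compact_operator T -> exists s u v, svd T s u v.
Proof.
move=> [/bounded_operatorP[c c0 hT] cT]; have [S _ TS] := adjoint_exists c0 hT.
by apply: (svd_exists hT TS cT); exact: subset_closure.
Qed.

End CompactSVD.

(** * Norm limits of vectors and of operators *)

Section Limits.
Variables (R : realType) (I : choiceType).
Local Notation H := (ell2 R I).
Implicit Types (x y z : H) (T S : H -> H) (c d e : R).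

Definition hcvg (x : nat -> H) (l : H) :=
  forall e, 0 < e -> exists N : nat, forall n, (N <= n)%N -> hn (x n - l) < e.

Lemma ell2_cauchy_seq (x : nat -> H) :
  (forall e, 0 < e -> exists N : nat, forall n, (N <= n)%N -> hn (x n - x N) < e) ->
  exists l, hcvg x l.
Proof.
move=> cx; have [e e0|l hl] := @ell2_complete R I (x @ \oo) _.
  by have [N hN] := cx e e0; exists (x N); exists N => // n /=; exact: hN.
by exists l => e e0; have [N _ hN] := hl e e0; exists N => n; exact: hN.
Qed.

Lemma hcvg_unique (x : nat -> H) l l' : hcvg x l -> hcvg x l' -> l = l'.
Proof.
move=> xl xl'; apply/eqP; rewrite -subr_eq0; apply/eqP/ell2_hnorm_eq0.
apply: (@ler_eps_eq0 _ _ 2) => [||e e0]; rewrite ?hn_ge0//.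
have [N hN] := xl e e0; have [M hM] := xl' e e0.
have h1 := hN (maxn N M) (leq_maxl _ _); have h2 := hM (maxn N M) (leq_maxr _ _).
have h := ler_hdistD (x (maxn N M)) l l'; rewrite (hdistC l (x _)) in h.
by apply: le_trans h _; rewrite mulr2n mulrDl mul1r; apply: lerD; exact: ltW.
Qed.

Lemma hcvg_op T c (x : nat -> H) l : opb T c -> hcvg x l -> hcvg (fun n => T (x n)) (T l).
Proof.
move=> /opb_max hT xl e e0; set k := Num.max c 0 in hT.
have k1 : 0 < k + 1 by rewrite ltr_wpDl// le_max lexx orbT.
have [N hN] := xl (e / (k + 1)) (divr_gt0 e0 k1); exists N => n Nn.
rewrite -(opB hT.1); apply: le_lt_trans (hT.2 _) _.
have := hN n Nn; rewrite ltr_pdivlMr// => h; apply: le_lt_trans h.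
by rewrite mulrDr mulr1 mulrC lerDl hn_ge0.
Qed.

Lemma hn_le_hcvg (x : nat -> H) l c : hcvg x l -> (exists N : nat, forall n, (N <= n)%N -> hn (x n) <= c) ->
  hn l <= c.
Proof.
move=> xl [N hN]; rewrite leNgt; apply/negP => cl.
have [M hM] := xl (hn l - c) ltac:(by rewrite subr_gt0).
have h1 := hN (maxn N M) (leq_maxl _ _); have h2 := hM (maxn N M) (leq_maxr _ _).
have := ler_hnormD (l - x (maxn N M)) (x (maxn N M)); rewrite subrK hdistC.
by move=> h3; move: h1 h2 h3; lra.
Qed.

Lemma hcvgD (x y : nat -> H) l m : hcvg x l -> hcvg y m -> hcvg (fun n => x n + y n) (l + m).
Proof.
move=> xl ym e e0; have e2 : 0 < e / 2 by rewrite divr_gt0.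
have [N hN] := xl _ e2; have [M hM] := ym _ e2; exists (maxn N M) => n.
rewrite geq_max => /andP[Nn Mn]; rewrite opprD addrACA.
apply: le_lt_trans (ler_hnormD _ _) _; rewrite [ltRHS]splitr.
by apply: ltrD; [exact: hN|exact: hM].
Qed.

Lemma hcvgZ (a : R[i]) (x : nat -> H) l : hcvg x l -> hcvg (fun n => a *: x n) (a *: l).
Proof.
have hid : opb (@id H) 1 by split=> // z; rewrite mul1r.
by move=> xl; exact: (hcvg_op (opbZ a hid) xl).
Qed.

Lemma hcvg_cst l : hcvg (fun=> l) l.
Proof. by move=> e e0; exists 0%N => n _; rewrite subrr ell2_hnorm0. Qed.

(** The pointwise limit is the candidate; letting m grow in a uniform bound on |X_m x - X_n x| turns
    pointwise convergence into convergence in operator norm. *)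
Lemma op_cauchy (X : nat -> H -> H) : (forall n, exists c, opb (X n) c) ->
  (forall e, 0 < e -> exists N : nat, forall n, (N <= n)%N ->
     opb (fun x => X n x - X N x) e) ->
  exists T, [/\ exists c, opb T c,
    forall e, 0 < e -> exists N : nat, forall n, (N <= n)%N -> opb (fun x => T x - X n x) e
    & forall x, hcvg (fun n => X n x) (T x)].
Proof.
move=> bX cX.
have /choice[T hT] : forall x, exists l, hcvg (fun n => X n x) l.
  move=> x; apply: ell2_cauchy_seq => e e0.
  have k0 : 0 < hn x + 1 by rewrite ltr_wpDl ?hn_ge0.
  have [N hN] := cX (e / (hn x + 1)) (divr_gt0 e0 k0); exists N => n Nn.
  apply: le_lt_trans ((hN n Nn).2 x) _.
  by rewrite mulrAC ltr_pdivrMr// ltr_pM2l// ltrDl.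
have lT : linear T.
  move=> a x y; apply: (hcvg_unique (hT _)).
  have := hcvgD (hcvgZ a (hT x)) (hT y).
  by under [X in hcvg X]eq_fun => n do [have [c [<- _]] := bX n].
have close e : 0 < e -> exists N : nat, forall n, (N <= n)%N -> opb (fun x => T x - X n x) e.
  move=> e0; have e2 : 0 < e / 2 by rewrite divr_gt0.
  have [N hN] := cX (e / 2) e2; exists N => n Nn; split.
    have [c [lX _]] := bX n => a x y.
    by rewrite lT lX opprD addrACA -scalerBr.
  move=> x; apply: (@hn_le_hcvg (fun m => X m x - X n x)).
    exact: hcvgD (hT x) (hcvg_cst _).
  exists N => m Nm.
  have h := ler_hdistD (X N x) (X m x) (X n x); apply: le_trans h _.
  rewrite [e]splitr mulrDl; apply: lerD; first exact: (hN m Nm).2.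
  by rewrite hdistC; exact: (hN n Nn).2.
exists T; split=> //.
have [N hN] := close 1 ltr01; have [c hc] := bX N; exists (1 + c).
have := opbD (hN N (leqnn N)) hc.
by under eq_fun do rewrite subrK.
Qed.

End Limits.

(** * Compactness by finite rank approximation *)

Section Compactness.
Variables (R : realType) (I : choiceType).
Local Notation H := (ell2 R I).
Implicit Types (x y z : H) (T S : H -> H) (c d e : R).

Definition finite_rank (r : seq (H * H)) x : H :=
  \sum_(z <- r) (inner x z.1 : R[i]) *: z.2.

Lemma finite_rank_opb r : exists c, opb (finite_rank r) c.
Proof.
elim: r => [|[y z] r [c hc]].
  exists 0; split=> [a x y|x]; rewrite /finite_rank !big_nil ?scaler0 ?addr0//.
  by rewrite ell2_hnorm0 mul0r.
exists (hn y * hn z + c).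
have := opbD (opb_rank1 y z) hc; congr (opb _ _).
by apply/funext => x; rewrite /finite_rank big_cons.
Qed.

Lemma ultra_fmap (D E : Type) (G : set_system D) (f : D -> E) :
  UltraFilter G -> UltraFilter (f @ G).
Proof.
move=> UG; split; first exact: fmap_proper_filter.
move=> F FF GF; apply/seteqP; split=> [A FA|A]; last exact: GF.
have [//|GnA] := in_ultra_setVsetC (f @^-1` A) UG.
have FnA : F (~` A) by apply: GF.
by have [y []] := filter_ex (filterI FA FnA).
Qed.

Lemma ultra_bounded_real (D : Type) (G : set_system D) (f : D -> R) c :
  UltraFilter G -> G [set y | `|f y| <= c] -> exists a : R, f @ G --> a.
Proof.
move=> UG Gc; have := @segment_compact R (- c) c.
rewrite compact_ultra => /(_ (f @ G)) h.
have GA : (f @ G) `[- c, c]%classic.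
  apply: (@filterS _ G _ [set y | `|f y| <= c]) => // y /=.
  by rewrite in_itv/= ler_norml.
by have [a [_ fa]] := h (ultra_fmap f UG) GA; exists a.
Qed.

Lemma ultra_bounded_complex (D : Type) (G : set_system D) (f : D -> R[i]) c :
  UltraFilter G -> G [set y : D | normc (f y) <= c] ->
  exists a : R[i], forall e, 0 < e -> G [set y : D | normc (f y - a) < e].
Proof.
move=> UG Gc.
have [a ha] : exists a : R, (fun y : D => complex.Re (f y)) @ G --> a.
  by apply: (@ultra_bounded_real _ _ _ c); apply: filterS Gc => y /=; apply: le_trans (norm_Re_le _).
have [b hb] : exists b : R, (fun y : D => complex.Im (f y)) @ G --> b.
  by apply: (@ultra_bounded_real _ _ _ c); apply: filterS Gc => y /=; apply: le_trans (norm_Im_le _).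
exists (a +i* b) => e e0; have e2 : 0 < e / 2 by rewrite divr_gt0.
move/cvgrPdist_lt/(_ _ e2) : ha; move/cvgrPdist_lt/(_ _ e2) : hb.
apply: filterS2 => y; rewrite distrC => h1; rewrite distrC => h2 /=.
apply: le_lt_trans (normc_le_ReIm _) _; rewrite [ltRHS]splitr.
by case: (f y) h1 h2 => p q /= h1 h2; exact: ltrD.
Qed.

(* Along an ultrafilter, the bounded coefficients of a finite rank operator
   converge, so the images of the unit ball are relatively compact. *)
Lemma ultra_finite_rank (G : set_system H) (p : H -> H) (A : set H) r :
  UltraFilter G -> G A -> (forall y, A y -> hn (p y) <= 1) ->
  exists l, forall e, 0 < e -> G [set y | hn (finite_rank r (p y) - l) < e].
Proof.
move=> UG GA hp; elim: r => [|[z w] r [l hl]].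
  exists 0 => e e0; apply: filterS GA => y _ /=.
  by rewrite /finite_rank big_nil subrr ell2_hnorm0.
have [a ha] : exists a : R[i], forall e, 0 < e -> G [set y | normc (inner (p y) z - a) < e].
  apply: (@ultra_bounded_complex _ _ _ (hn z)).
  apply: filterS GA => y /hp y1 /=; apply: le_trans (normc_inner _ _) _.
  by rewrite ler_piMl ?hn_ge0.
exists (a *: w + l) => e e0; have e2 : 0 < e / 2 by rewrite divr_gt0.
have k0 : 0 < hn w + 1 by rewrite ltr_wpDl ?hn_ge0.
have := hl _ e2; have := ha _ (divr_gt0 e2 k0); apply: filterS2 => y /= h1 h2.
rewrite /finite_rank big_cons/= -/(finite_rank r (p y)) opprD addrACA -scalerBl.
apply: le_lt_trans (ler_hnormD _ _) _; rewrite [ltRHS]splitr; apply: ler_ltD => //.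
rewrite ell2_hnormZ.
move: h1; rewrite ltr_pdivlMr// => h1; apply: le_trans (ltW h1).
by rewrite ler_wpM2l ?normc_ge0// lerDl.
Qed.

(** Given an ultrafilter on the closed unit image, replace each point y by the finite rank image of
    a near preimage. These images converge along the ultrafilter, so the ultrafilter is Cauchy and
    completeness provides its limit. This criterion also makes compact operators stable under sums,
    multiples and norm limits. *)
Lemma compact_finite_rank_approx T : linear T ->
  (forall e, 0 < e -> exists r, opb (fun x => T x - finite_rank r x) e) ->
  compact_operator T.
Proof.
move=> lT hT; split.
  apply/bounded_operatorP; have [r hr] := hT 1 ltr01.
  have [c hc] := finite_rank_opb r; exists (Num.max (1 + c) 0).
    by rewrite le_max lexx orbT.
  by apply: opb_max; have := opbD hr hc; under eq_fun do rewrite subrK.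
rewrite -/(unit_image T); set K := closure (unit_image T).
rewrite compact_ultra => G UG GK.
have approx e : 0 < e -> exists l, G [set y | hn (y - l) < e].
  move=> e0; have e3 : 0 < e / 3 by rewrite divr_gt0.
  (* [p y] is a point of the unit ball whose image is e / 3 close to y; off [K] its value is
     irrelevant. *)
  have /choice[p hp] : forall y, exists x, K y -> hn x <= 1 /\ hn (y - T x) < e / 3.
    move=> y; have [Ky|nKy] := pselect (K y); last by exists 0.
    have [_ [[x /= x1 <-] /= yx]] : (unit_image T `&` [set w | hn (y - w) < e / 3]) !=set0.
      by apply: Ky; apply/nbhs_ell2; exists (e / 3).
    by exists x.
  have [r hr] := hT _ e3.
  have [l hl] := @ultra_finite_rank G p K r UG GK (fun y Ky => (hp y Ky).1).
  exists l; have := hl _ e3; apply: filterS2 GK => y /hp[p1 yp] /= fl.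
  have h1 := ler_hdistD (T (p y)) y l.
  have h2 := ler_hdistD (finite_rank r (p y)) (T (p y)) l.
  have h3 : hn (T (p y) - finite_rank r (p y)) <= e / 3.
    by apply: le_trans (hr.2 (p y)) _; rewrite ler_piMr// ltW.
  apply: le_lt_trans h1 _; apply: le_lt_trans (lerD (lexx _) h2) _.
  have -> : e = e / 3 + (e / 3 + e / 3) by field.
  by apply: ltrD yp _; exact: ler_ltD.
have [l hl] := @ell2_complete R I G _ approx.
have Gl : G --> l.
  move=> P /nbhs_ell2[d d0 hd]; apply: filterS (hl d d0) => y /= yl.
  by apply: hd; rewrite hdistC.
exists l; split=> //.
have -> : K = closure K by apply/closure_id; exact: closed_closure.
by move=> P lP; have [y yKP] := filter_ex (filterI GK (Gl _ lP)); exists y.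
Qed.

End Compactness.

(** * Schatten norms from singular values *)

Section SpectralSeries.
Variables (R : realType) (I : choiceType).
Local Notation H := (ell2 R I).
Implicit Types (x y z : H) (T S : H -> H) (e : R).

(** The tail keeps the full range with zeros inserted, so that formulas for combinations of v_0,
    ..., v_{M-1} still apply to it. *)
Lemma sum_ord_tail (V : zmodType) (f : nat -> V) (N M : nat) : (N <= M)%N ->
  \sum_(n < M) f n - \sum_(n < N) f n = \sum_(n < M) if (n < N)%N then 0 else f n.
Proof.
move=> NM; rewrite (big_ord_widen M f NM) (bigID (fun n : 'I_M => (n < N)%N))/=.
rewrite addrAC subrr add0r big_mkcond/=.
by apply: eq_bigr => n _; case: (_ < _)%N.
Qed.

Lemma sqr_hnorm_tail (v : nat -> H) (c : nat -> R[i]) (N M : nat) :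
  suborthonormal v -> (N <= M)%N ->
  hn (\sum_(n < M) c n *: v n - \sum_(n < N) c n *: v n) ^+ 2 =
  \sum_(n < M) if (n < N)%N then 0 else normc (c n) ^+ 2 * hn (v n) ^+ 2.
Proof.
move=> ov NM; rewrite (sum_ord_tail (fun n => c n *: v n))//.
have -> : \sum_(n < M) (if (n < N)%N then 0 else c n *: v n) =
    \sum_(n < M) (if (n < N)%N then 0 else c n) *: v n.
  by apply: eq_bigr => n _; case: ifP => _; rewrite ?scale0r.
rewrite (sqr_hnorm_comb ov (fun n => if (n < N)%N then 0 else c n)).
by apply: eq_bigr => n _; case: ifP => // _; rewrite normc0 expr0n mul0r.
Qed.

Lemma sqr_hn_suborthonormal_le1 (v : nat -> H) n : suborthonormal v -> hn (v n) ^+ 2 <= 1.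
Proof. by move=> [_ /(_ n)[->|->]]; rewrite ?ell2_hnorm0 ?expr0n ?expr1n. Qed.

Lemma hn_spectral_tail (s : nat -> R) (v : nat -> H) (N M : nat) x :
  (forall n, 0 <= s n) -> (forall m n, (m <= n)%N -> s n <= s m) ->
  suborthonormal v -> (N <= M)%N ->
  hn (spectral_sum s v v M x - spectral_sum s v v N x) <= s N * hn x.
Proof.
move=> s0 smono ov NM.
rewrite -(@ler_pXn2r _ 2) ?nnegrE ?mulr_ge0 ?hn_ge0//.
rewrite /spectral_sum (sqr_hnorm_tail (fun n => (s n)%:C * inner x (v n)))//.
apply: (@le_trans _ _ (\sum_(n < M) s N ^+ 2 * normc (inner x (v n)) ^+ 2)); last first.
  by rewrite -mulr_sumr exprMn ler_wpM2l ?sqr_ge0// bessel.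
apply: ler_sum => n _; case: ifPn => [_|]; first by rewrite mulr_ge0 ?sqr_ge0.
rewrite -leqNgt => Nn; apply: (@le_trans _ _ (normc ((s n)%:C * inner x (v n)) ^+ 2)).
  by rewrite ler_piMr ?sqr_ge0// sqr_hn_suborthonormal_le1.
rewrite normcM normc_real ger0_norm// exprMn ler_wpM2r ?sqr_ge0//.
by rewrite lerXn2r ?nnegrE ?smono.
Qed.

Lemma spectral_sum_opb (s : nat -> R) (u v : nat -> H) N :
  exists c, opb (spectral_sum s u v N) c.
Proof.
elim: N => [|N [c hc]].
  exists 0; split=> [a x y|x]; rewrite /spectral_sum !big_ord0 ?scaler0 ?addr0//.
  by rewrite ell2_hnorm0 mul0r.
exists (c + normc (s N)%:C * (hn (v N) * hn (u N))).
have := opbD hc (opbZ (s N)%:C (opb_rank1 (v N) (u N))); congr (opb _ _).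
by apply/funext => x; rewrite /spectral_sum big_ord_recr/= scalerA.
Qed.

(** With the powers s_n^r in place of s_n, the limit is the candidate for the power r / 2 of T*
    T. *)
Lemma spectral_series (s : nat -> R) (v : nat -> H) :
  (forall n, 0 <= s n) -> (forall m n, (m <= n)%N -> s n <= s m) ->
  (forall e, 0 < e -> exists N, s N < e) -> suborthonormal v ->
  exists2 P, (exists c, opb P c) & forall x, hcvg (fun n => spectral_sum s v v n x) (P x).
Proof.
move=> s0 smono sto0 ov.
have [|e e0|P [bP _ PE]] := @op_cauchy R I (spectral_sum s v v).
- by move=> n; exact: spectral_sum_opb.
- have [N sN] := sto0 e e0; exists N => n Nn; split.
    have [c [lM _]] := spectral_sum_opb s v v n.
    have [d [lN _]] := spectral_sum_opb s v v N.
    by move=> a x y; rewrite lM lN opprD addrACA -scalerBr.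
  move=> x; apply: le_trans (hn_spectral_tail x s0 smono ov Nn) _.
  by rewrite ler_wpM2r ?hn_ge0// ltW.
- by exists P.
Qed.

(** By Bessel the squared coefficients have bounded partial sums, and their tails are the squared
    distances between partial Fourier sums. *)
Lemma fourier_cvg (v : nat -> H) x : suborthonormal v ->
  exists y, hcvg (fun n => fourier v n x) y.
Proof.
move=> ov; apply: ell2_cauchy_seq => e e0.
pose q (N : nat) := \sum_(n < N) normc (inner x (v n)) ^+ 2.
have q_nd : nondecreasing_seq q.
  apply/nondecreasing_seqP => n; rewrite /q big_ord_recr/= lerDl sqr_ge0//.
have q_ub : has_ubound (range q).
  by exists (hn x ^+ 2) => _ [n _ <-]; exact: bessel.
have := nondecreasing_cvgn q_nd q_ub; set L := sup _ => qL.
have e2 : 0 < e ^+ 2 by rewrite exprn_gt0.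
have qle n : q n <= L by apply: (ub_le_sup q_ub); exists n.
move/cvgrPdist_lt/(_ _ e2) : qL => [N _ hN]; exists N => n Nn.
rewrite -(@ltr_pXn2r _ 2) ?nnegrE ?hn_ge0 ?(ltW e0)//.
rewrite /fourier (sqr_hnorm_tail (fun n => inner x (v n)))//.
have := hN N (leqnn N); rewrite /= ger0_norm ?subr_ge0// => h.
apply: le_lt_trans h; apply: (@le_trans _ _ (q n - q N)); last by rewrite lerD2r.
rewrite /q (sum_ord_tail (fun n => normc (inner x (v n)) ^+ 2))//.
apply: ler_sum => k _; case: ifP => // _.
by rewrite ler_piMr ?sqr_ge0// sqr_hn_suborthonormal_le1.
Qed.

End SpectralSeries.

(** * Identification of the powers of T* T *)

Section OperatorPower.
Variables (R : realType) (I : choiceType).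
Local Notation H := (ell2 R I).
Variables (T S : H -> H) (s : nat -> R) (u v : nat -> H) (c : R).
Hypotheses (hsvd : svd T s u v) (hT : opb T c) (TS : adjoint_pair T S).
Implicit Types (x y z : H) (e r : R).

Let s0 n : 0 <= s n. Proof. exact: svd_ge0 hsvd n. Qed.

Lemma svd_adjoint_vec n : S (u n) = (s n)%:C *: v n.
Proof.
apply: inner_extr => x; rewrite -TS (svd_inner hsvd) innerZr.
by rewrite conjc_real.
Qed.

Lemma svd_square_vec n : S (T (v n)) = (s n ^+ 2)%:C *: v n.
Proof.
have lS := adjoint_pair_linear TS.
by rewrite (svd_vec hsvd) (opZ lS) svd_adjoint_vec scalerA -rmorphM.
Qed.

(** Hence an eigenvector of T* T for l has nonzero coefficients only on those v_n with s_n^2 = l. *)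
Lemma svd_square_coeff (l : R) x n : S (T x) = l%:C *: x ->
  (s n ^+ 2)%:C * inner x (v n) = l%:C * inner x (v n).
Proof.
move=> STx; rewrite -[RHS]innerZl -STx.
rewrite (adjoint_pair_sym TS) (svd_vec hsvd) innerZr (svd_inner hsvd) conjc_real.
by rewrite expr2 rmorphM mulrA.
Qed.

Lemma svd_fourier N x : T (fourier v N x) = spectral_sum s u v N x.
Proof.
rewrite /fourier (op_sum hT.1); apply: eq_bigr => n _.
by rewrite (opZ hT.1) (svd_vec hsvd) scalerA mulrC.
Qed.

Lemma powR_half r l n : 0 <= l -> s n ^+ 2 = l -> l `^ (r / 2) = s n `^ r.
Proof.
move=> _ <-; rewrite -powR_mulrn// -powRrM; congr (_ `^ _).
by rewrite mulrC divfK.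
Qed.

Variable r : R.
Hypothesis r0 : 0 < r.

Lemma powR_nonincr m n : (m <= n)%N -> s n `^ r <= s m `^ r.
Proof.
by move=> mn; apply: ge0_ler_powR; rewrite ?nnegrE ?(ltW r0) ?(svd_nonincr hsvd).
Qed.

Lemma powR_to0 e : 0 < e -> exists N, s N `^ r < e.
Proof.
move=> e0; have [N sN] := svd_to0 hsvd (powR_gt0 r^-1 e0); exists N.
have : s N `^ r < (e `^ r^-1) `^ r by apply: gt0_ltr_powR; rewrite ?nnegrE ?powR_ge0.
by rewrite -powRrM mulVf ?gt_eqF// powRr1 ?ltW.
Qed.

(** The candidate P meets the specification of [operator_pow]. Any Q that meets it agrees with P on
    each v_n, hence on the closed span of the v_n; what is left of a vector lies in the kernel of T,
    where both vanish because 0^(r/2) = 0. *)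
Lemma operator_powE (P : H -> H) (cP : R) : opb P cP ->
  (forall x, hcvg (fun n => spectral_sum (fun n => s n `^ r) v v n x) (P x)) ->
  operator_pow (S \o T) (r / 2) = P.
Proof.
move=> bP PE.
have lS := adjoint_pair_linear TS; have bS := adjoint_opb hT TS.
have Peig (l : R) x : 0 <= l -> S (T x) = l%:C *: x -> P x = (l `^ (r / 2))%:C *: x.
  move=> l0 STx; apply: (hcvg_unique (PE x)).
  have E n : spectral_sum (fun n => s n `^ r) v v n x = (l `^ (r / 2))%:C *: fourier v n x.
    rewrite /spectral_sum /fourier scaler_sumr; apply: eq_bigr => k _.
    rewrite scalerA; have [->|xv] := eqVneq (inner x (v k)) 0; first by rewrite !mulr0.
    have /(mulIf xv)/(@complexI R) sl := svd_square_coeff k STx.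
    by rewrite (powR_half _ l0 sl).
  under [X in hcvg X]eq_fun do rewrite E.
  have [l_eq0|l_neq0] := eqVneq l 0.
    rewrite l_eq0 powR0 ?mulf_neq0 ?invr_eq0 ?gt_eqF// scale0r.
    by move=> e e0; exists 0%N => n _; rewrite scale0r subrr ell2_hnorm0.
  (* For l > 0 an eigenvector is the limit of its Fourier sums: l times the error is S applied to
     the remainder of the decomposition at x, which tends to 0. *)
  apply: hcvgZ; have l_gt0 : 0 < l by rewrite lt_neqAle eq_sym l_neq0.
  move=> e e0; pose k := (Num.max c 0) * hn x.
  have k0 : 0 <= k by rewrite mulr_ge0 ?hn_ge0// le_max lexx orbT.
  have k1 : 0 < k + 1 by rewrite ltr_wpDl.
  have [N sN] := svd_to0 hsvd (divr_gt0 (mulr_gt0 e0 l_gt0) k1).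
  exists N => n Nn; rewrite hdistC.
  have : hn (l%:C *: (x - fourier v n x)) <= k * s N.
    have -> : l%:C *: (x - fourier v n x) = S (T x - spectral_sum s u v n x).
      rewrite (opB lS) STx -svd_fourier scalerBr; congr (_ - _).
      rewrite /fourier (op_sum hT.1) (op_sum lS) scaler_sumr.
      apply: eq_bigr => j _; rewrite (opZ hT.1) (opZ lS) svd_square_vec !scalerA.
      by rewrite [in RHS]mulrC (svd_square_coeff j STx).
    apply: le_trans ((opb_max bS).2 _) _.
    rewrite /k -mulrA; apply: ler_wpM2l; first by rewrite le_max lexx orbT.
    apply: le_trans ((svd_rem hsvd n).2 x) _; rewrite mulrC ler_wpM2l ?hn_ge0//.
    exact: (svd_nonincr hsvd Nn).
  rewrite ell2_hnormZ normc_real gtr0_norm// => h.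
  rewrite -(ltr_pM2l l_gt0); apply: le_lt_trans h _.
  move: sN; rewrite ltr_pdivlMr// => h; rewrite mulrC [ltRHS]mulrC.
  apply: le_lt_trans h; rewrite mulrDr mulr1 lerDl; exact: s0.
have [bQ Qeig] : bounded_operator (operator_pow (S \o T) (r / 2)) /\
   forall (l : R) x, 0 <= l -> (S \o T) x = l%:C *: x ->
     operator_pow (S \o T) (r / 2) x = (l `^ (r / 2))%:C *: x.
  apply: (@getPex _ [set Q | bounded_operator Q /\
    forall (l : R) x, 0 <= l -> (S \o T) x = l%:C *: x ->
     Q x = (l `^ (r / 2))%:C *: x]).
  exists P; split=> //; apply/bounded_operatorP; exists (Num.max cP 0).
    by rewrite le_max lexx orbT.
  exact: opb_max.
move: bQ Qeig; set Q := operator_pow _ _ => /bounded_operatorP[cQ cQ0 bQ] Qeig.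
(* Split x as y + (x - y), with y the limit of the Fourier sums. P and Q agree at y by continuity,
   and T x = T y makes x - y an eigenvector for 0. *)
apply/funext => x; have [y hy] := fourier_cvg x (svd_orthr hsvd).
have QPy : Q y = P y.
  apply: (hcvg_unique (hcvg_op bQ hy)).
  have E n : Q (fourier v n x) = P (fourier v n x).
    rewrite /fourier (op_sum bQ.1) (op_sum bP.1); apply: eq_bigr => k _.
    rewrite (opZ bQ.1) (opZ bP.1); congr (_ *: _).
    rewrite (Qeig (s k ^+ 2)) ?sqr_ge0//=; last exact: svd_square_vec.
    by rewrite (Peig (s k ^+ 2)) ?sqr_ge0//; exact: svd_square_vec.
  by under [X in hcvg X]eq_fun do rewrite E; exact: hcvg_op bP hy.
have Txy : T x = T y.
  apply: (hcvg_unique (x := fun n => T (fourier v n x))); last exact: hcvg_op hT hy.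
  move=> e e0; have k1 : 0 < hn x + 1 by rewrite ltr_wpDl ?hn_ge0.
  have [N sN] := svd_to0 hsvd (divr_gt0 e0 k1); exists N => n Nn.
  rewrite svd_fourier hdistC; apply: le_lt_trans ((svd_rem hsvd n).2 x) _.
  have := svd_nonincr hsvd Nn; move: sN; rewrite ltr_pdivlMr// => sN sn.
  have := hn_ge0 x; have := s0 N; have := s0 n; nra.
have STxy : S (T (x - y)) = 0%:C *: (x - y).
  by rewrite (opB hT.1) Txy subrr (op0 lS) scale0r.
have := Qeig 0 (x - y) (lexx 0) STxy; have := Peig 0 (x - y) (lexx 0) STxy.
rewrite (opB bP.1) (opB bQ.1) QPy => <- /eqP.
by rewrite -subr_eq0 opprB addrA subrK subr_eq0 => /eqP.
Qed.

End OperatorPower.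

Lemma cvg_le_cst (R : realType) (D : Type) (F : set_system D) (FF : ProperFilter F)
    (f : D -> R) (l t : R) : f @ F --> l -> (forall y, f y <= t) -> l <= t.
Proof.
move=> /cvgrPdist_lt fl ft; rewrite leNgt; apply/negP => tl.
have tl0 : 0 < l - t by rewrite subr_gt0.
have [y] := filter_ex (fl _ tl0).
by have := ft y; rewrite ltr_norml => h /andP[_]; lra.
Qed.

(** * The trace as the sum of the powers of the singular values *)

Section SchattenNorm.
Variables (R : realType) (I : choiceType).
Local Notation H := (ell2 R I).
Local Notation totally := (@summability.totally I).
Implicit Types (x y z : H) (T S : H -> H) (e r : R).

Section Trace.
Variables (P : H -> H) (s : nat -> R) (v : nat -> H).
Hypotheses (s0 : forall n, 0 <= s n) (ov : suborthonormal v)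
  (sv : forall n, s n = 0 \/ hn (v n) = 1)
  (PE : forall x, hcvg (fun n => spectral_sum s v v n x) (P x)).

Let diag i := complex.Re (matrix_of P i i).

Lemma diag_cvg i :
  (fun N => \sum_(n < N) s n * normc (v n i) ^+ 2) @ \oo --> diag i.
Proof.
apply/cvgrPdist_lt => e e0; have [N hN] := PE (basis_vec R i) e0.
exists N => // n /= Nn; apply: le_lt_trans (hN n Nn).
have -> : \sum_(k < n) s k * normc (v k i) ^+ 2 =
    complex.Re (spectral_sum s v v n (basis_vec R i) i).
  rewrite -inner_basis /spectral_sum inner_suml raddf_sum/=.
  apply: eq_bigr => k _; rewrite innerZl innerC inner_basis.
  by rewrite -mulrA [conjc _ * _]mulrC -sqr_normcE -rmorphM.
have -> : diag i - complex.Re (spectral_sum s v v n (basis_vec R i) i) =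
   - complex.Re ((spectral_sum s v v n (basis_vec R i) - P (basis_vec R i)) i).
  by rewrite /diag /matrix_of raddfB/= opprB.
by rewrite normrN; apply: le_trans (norm_Re_le _) (normc_le_hnorm _ _).
Qed.

Lemma diag_partial_le i N : \sum_(n < N) s n * normc (v n i) ^+ 2 <= diag i.
Proof.
have nd : nondecreasing_seq (fun N => \sum_(n < N) s n * normc (v n i) ^+ 2).
  apply/nondecreasing_seqP => n; rewrite big_ord_recr/= lerDl.
  by rewrite mulr_ge0 ?sqr_ge0.
rewrite -(cvg_lim (@Rhausdorff R) (@diag_cvg i)); apply: nondecreasing_cvgn_le => //.
by apply/cvg_ex; exists (diag i); exact: diag_cvg.
Qed.

Lemma diag_ge0 i : 0 <= diag i.
Proof. by have := diag_partial_le i 0; rewrite big_ord0. Qed.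

Lemma trace_ge0 : (0 <= trace P)%E.
Proof. by apply: esum_ge0 => i _; rewrite lee_fin diag_ge0. Qed.

(** For fixed N, the finite set of coordinates grows: the sum of |v_n(i)|^2 over i tends to 1
    whenever s_n is nonzero. *)
Lemma trace_ge N : ((\sum_(n < N) s n)%:E <= trace P)%E.
Proof.
case E : (trace P) => [t||]; last 2 first.
- by rewrite leey.
- by have := trace_ge0; rewrite E.
rewrite lee_fin.
have -> : \sum_(n < N) s n = \sum_(n < N) s n * hn (v n) ^+ 2.
  apply: eq_bigr => n _; case: (sv n) => ->; first by rewrite mul0r.
  by rewrite expr1n mulr1.
apply: (@cvg_le_cst R _ totally _
  (fun A : {fset I} => \sum_(n < N) s n * \sum_(i <- A) normc (v n i) ^+ 2)).
- apply: cvg_sum_real => n; apply: cvgM; [exact: cvg_cst|exact: sqr_hnorm_cvg].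
- move=> A.
  have -> : \sum_(n < N) s n * \sum_(i <- A) normc (v n i) ^+ 2 =
      \sum_(i <- A) \sum_(n < N) s n * normc (v n i) ^+ 2.
    by under eq_bigr do rewrite mulr_sumr; rewrite exchange_big.
  apply: (@le_trans _ _ (\sum_(i <- A) diag i)).
    by apply: ler_sum => i _; exact: diag_partial_le.
  rewrite -lee_fin -E -sumEFin; apply: ereal_sup_ubound; exists [set` A] => //.
  by rewrite fsbig_finite//= set_fsetK.
Qed.

(** Dually, the finite set of coordinates is fixed and N grows; on such a set each v_n has squared
    mass at most 1. *)
Lemma trace_le C : (forall N, \sum_(n < N) s n <= C) -> (trace P <= C%:E)%E.
Proof.
move=> hC; apply: ge_ereal_sup => _ [A [finA _] <-].
rewrite fsbig_finite//= sumEFin lee_fin.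
apply: (@cvg_le_cst R _ \oo _ (fun N => \sum_(i <- fset_set A)
   \sum_(n < N) s n * normc (v n i) ^+ 2)).
- by apply: cvg_sum_real => i; exact: diag_cvg.
- move=> N; rewrite exchange_big/=.
  apply: le_trans (hC N); apply: ler_sum => n _; rewrite -mulr_sumr.
  rewrite ler_piMr//; apply: le_trans (sum_sqr_le_hnorm _ _) _.
  exact: sqr_hn_suborthonormal_le1.
Qed.

End Trace.

Section Svd.
Variables (T : H -> H) (s : nat -> R) (u v : nat -> H).
Hypothesis hsvd : svd T s u v.

Lemma svd_opb : opb T (s 0%N).
Proof.
have := svd_rem hsvd 0; congr (opb _ _).
by apply/funext => x; rewrite /spectral_sum big_ord0 subr0.
Qed.

Lemma svd_operator_norm : operator_norm T = (s 0%N)%:E.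
Proof.
apply/eqP; rewrite eq_le; apply/andP; split.
  apply: ge_ereal_sup => _ [x /= x1 <-]; rewrite lee_fin.
  apply: le_trans (svd_opb.2 x) _.
  by rewrite ler_piMr// (svd_ge0 hsvd).
apply: ereal_sup_ubound.
case: (svd_cases hsvd 0) => [[-> _]|[s0 [u1 v1]]].
  exists 0; first by rewrite /= -[hnorm _]/(hn (0 : H)) ell2_hnorm0.
  by rewrite (op0 svd_opb.1) -[hnorm _]/(hn (0 : H)) ell2_hnorm0.
exists (v 0%N); first by rewrite /= -/(hn _) v1.
rewrite -/(hn _) (svd_vec hsvd) ell2_hnormZ normc_real gtr0_norm//.
by rewrite u1 mulr1.
Qed.

(** The last two properties characterise t as the supremum of the partial sums, +oo included, so
    that nothing later has to mention powers of operators. *)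
Lemma svd_schatten_trace r : 0 < r -> exists t : \bar R,
  [/\ operator_schatten_norm r%:E T = poweR t r^-1, (0 <= t)%E,
   forall N, ((\sum_(n < N) s n `^ r)%:E <= t)%E &
   forall C, (forall N, \sum_(n < N) s n `^ r <= C) -> (t <= C%:E)%E].
Proof.
move=> r0.
have [S _ TS] := adjoint_exists (svd_ge0 hsvd 0) svd_opb.
have ov := svd_orthr hsvd.
have sr0 n : 0 <= s n `^ r by rewrite powR_ge0.
have [P [cP bP] PE] := @spectral_series R I (fun n => s n `^ r) v sr0
  (powR_nonincr hsvd r0) (powR_to0 hsvd r0) ov.
have sv n : s n `^ r = 0 \/ hn (v n) = 1.
  case: (svd_cases hsvd n) => [[-> _]|[_ [_ ->]]]; last by right.
  by left; rewrite powR0 ?gt_eqF.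
exists (trace P); split.
- by rewrite /= (adjointE svd_opb TS) (operator_powE hsvd svd_opb TS r0 bP PE).
- exact: trace_ge0 sr0 PE.
- by move=> N; exact: (trace_ge sr0 sv PE).
- by move=> C hC; exact: (trace_le sr0 ov PE).
Qed.

Lemma svd_schatten_lb r : 0 < r -> (operator_schatten_norm r%:E T < +oo)%E ->
  forall N, \sum_(n < N) s n `^ r <= fine (operator_schatten_norm r%:E T) `^ r.
Proof.
move=> r0; have [t [-> t0 tge _]] := svd_schatten_trace r0.
case: t t0 tge => [t||]//; last by rewrite poweRyr ?invr_eq0 ?gt_eqF// ltxx.
move=> t0 tge _ N; rewrite poweR_EFin/= -powRrM mulVf ?gt_eqF// powRr1//.
by have := tge N; rewrite lee_fin.
Qed.

Lemma svd_schatten_ub r c : 0 < r -> 0 <= c ->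
  (forall N, \sum_(n < N) s n `^ r <= c `^ r) ->
  (operator_schatten_norm r%:E T < +oo)%E /\
  fine (operator_schatten_norm r%:E T) <= c.
Proof.
move=> r0 c0 hc; have [t [-> t0 _ /(_ _ hc)]] := svd_schatten_trace r0.
case: t t0 => [t||]// t0; rewrite lee_fin => tc; rewrite poweR_EFin ltry; split=> //=.
have -> : c = (c `^ r) `^ r^-1 by rewrite -powRrM mulfV ?gt_eqF// powRr1.
by apply: ge0_ler_powR; rewrite ?nnegrE ?invr_ge0 ?powR_ge0 ?(ltW r0).
Qed.

Lemma schatten_fine_ge0 r : 0 < r -> 0 <= fine (operator_schatten_norm r%:E T).
Proof.
move=> r0; have [t [-> t0 _ _]] := svd_schatten_trace r0.
by apply: fine_ge0; exact: poweR_ge0.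
Qed.

End Svd.

End SchattenNorm.

(** * Schur products *)

Section PointwiseProduct.
Variables (R : realType) (I : choiceType).
Local Notation H := (ell2 R I).
Local Notation totally := (@summability.totally I).
Implicit Types (x y z : H) (T S : H -> H) (c d e : R).

Lemma pmul_partial x y (A : {fset I}) :
  \sum_(i <- A) normc (x i * y i) ^+ 2 <= (hn x * hn y) ^+ 2.
Proof.
apply: (@le_trans _ _ (\sum_(i <- A) normc (x i) ^+ 2 * hn y ^+ 2)).
  apply: ler_sum => i _; rewrite normcM exprMn ler_wpM2l ?sqr_ge0//.
  by rewrite lerXn2r ?nnegrE ?normc_ge0 ?hn_ge0// normc_le_hnorm.
by rewrite -mulr_suml exprMn ler_wpM2r ?sqr_ge0// sum_sqr_le_hnorm.
Qed.

Definition pmul x y : H :=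
  Ell2 (square_summableP (x := fun i => x i * y i : C R) (pmul_partial x y)).

Lemma conj_partial x (A : {fset I}) :
  \sum_(i <- A) normc (conjc (x i)) ^+ 2 <= hn x ^+ 2.
Proof.
by under eq_bigr do rewrite normc_conj; exact: sum_sqr_le_hnorm.
Qed.

Definition pconj x : H :=
  Ell2 (square_summableP (x := fun i => conjc (x i) : C R) (conj_partial x)).

Lemma hn_pmul_le x y : hn (pmul x y) <= hn x * hn y.
Proof.
rewrite -(@ler_pXn2r _ 2) ?nnegrE ?mulr_ge0 ?hn_ge0//.
by apply: sqr_hnorm_le => A; exact: pmul_partial.
Qed.

Lemma pmulC x y : pmul x y = pmul y x.
Proof. by apply/val_inj/funext => i; exact: mulrC. Qed.

Lemma inner_pmul x y z : inner x (pmul y z) = inner (pmul x (pconj y)) z.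
Proof.
apply: inner_unique; have := @inner_cvg R I (pmul x (pconj y)) z.
suff -> : (fun i => pmul x (pconj y) i * conjc (z i) : C R) =
  (fun i => x i * conjc (pmul y z i) : C R) by [].
by apply/funext => i; rewrite /= rmorphM mulrA.
Qed.

Lemma sum_sqr_hn_le (J : Type) (r : seq J) (y : J -> H) c :
  (forall A : {fset I}, \sum_(j <- r) \sum_(i <- A) normc (y j i) ^+ 2 <= c) ->
  \sum_(j <- r) hn (y j) ^+ 2 <= c.
Proof.
move=> h; apply: (@cvg_le_cst R _ totally _
  (fun A : {fset I} => \sum_(j <- r) \sum_(i <- A) normc (y j i) ^+ 2)) => //.
by apply: cvg_sum_real => j; exact: sqr_hnorm_cvg.
Qed.

Lemma normc_innerC x y : normc (inner x y) = normc (inner y x).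
Proof. by rewrite innerC normc_conj. Qed.

Lemma bessel_coordinate (v : nat -> H) i N : suborthonormal v ->
  \sum_(n < N) normc (v n i) ^+ 2 <= 1.
Proof.
move=> ov; have := bessel ov (basis_vec R i) N; rewrite hnorm_basis expr1n.
by under eq_bigr do rewrite normc_innerC inner_basis.
Qed.

(* At each coordinate i, the sum of |v_n(i)|^2 is at most 1. *)
Lemma bessel_pmul (v : nat -> H) x N : suborthonormal v ->
  \sum_(n < N) hn (pmul x (v n)) ^+ 2 <= hn x ^+ 2.
Proof.
move=> ov; apply: sum_sqr_hn_le => A; rewrite exchange_big/=.
apply: le_trans (sum_sqr_le_hnorm x A); apply: ler_sum => i _.
under eq_bigr do rewrite normcM exprMn.
by rewrite -mulr_sumr ler_piMr ?sqr_ge0// bessel_coordinate.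
Qed.

Lemma hn_pmul_pconj x y : hn (pmul x (pconj y)) = hn (pmul x y).
Proof.
suff h a b : hn (pmul a (pconj b)) <= hn (pmul a b).
  apply/eqP; rewrite eq_le h/=; have := h x (pconj y).
  suff -> : pconj (pconj y) = y by [].
  by apply/val_inj/funext => i; exact: conjcK.
rewrite -(@ler_pXn2r _ 2) ?nnegrE ?hn_ge0//.
apply: sqr_hnorm_le => A; apply: le_trans (sum_sqr_le_hnorm (pmul a b) A).
by apply: ler_sum => i _; rewrite /= !normcM normc_conj.
Qed.

(** The products v_n w_m need not be orthogonal. Still, <x, v_n w_m> is the coefficient of x
    conj(v_n) on w_m: Bessel's inequality for w disposes of m, and the coordinatewise one for v
    disposes of n. *)
Lemma bessel_product (v w : nat -> H) x N M : suborthonormal v -> suborthonormal w ->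
  \sum_(n < N) \sum_(m < M) normc (inner x (pmul (v n) (w m))) ^+ 2 <= hn x ^+ 2.
Proof.
move=> ov ow; apply: le_trans (bessel_pmul x N ov); apply: ler_sum => n _.
rewrite -hn_pmul_pconj; apply: le_trans (bessel ow (pmul x (pconj (v n))) M).
by apply: ler_sum => m _; rewrite inner_pmul.
Qed.

(** The i-th coordinate of X x is the pairing of x with the pointwise product of T* e_i and S* e_i.
    Cauchy-Schwarz takes out |S* e_i| <= d; what remains, summed over i, is controlled by the
    columns of T, each of norm at most c. *)
Lemma schur_exists T S c d : 0 <= c -> 0 <= d -> opb T c -> opb S d ->
  exists2 X, opb X (c * d) & matrix_of X = schur (matrix_of T) (matrix_of S).
Proof.
move=> c0 d0 hT hS.
have [T' hT' TT'] := adjoint_exists c0 hT; have [S' hS' SS'] := adjoint_exists d0 hS.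
have coord (X X' : H -> H) (i j : I) : adjoint_pair X X' ->
    X' (basis_vec R i) j = conjc (X (basis_vec R j) i).
  by move=> XX'; rewrite -inner_basis (adjoint_pair_sym XX') innerC inner_basis.
pose row i := pmul (T' (basis_vec R i)) (S' (basis_vec R i)).
have bound x (A : {fset I}) : \sum_(i <- A) normc (inner x (row i)) ^+ 2 <=
    (c * d * hn x) ^+ 2.
  apply: (@le_trans _ _ (\sum_(i <- A) d ^+ 2 * hn (pmul x (T' (basis_vec R i))) ^+ 2)).
    apply: ler_sum => i _; rewrite /row inner_pmul -exprMn.
    rewrite lerXn2r ?nnegrE ?normc_ge0 ?mulr_ge0 ?hn_ge0//.
    apply: le_trans (normc_inner _ _) _.
    rewrite hn_pmul_pconj mulrC ler_wpM2r ?hn_ge0//.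
    by apply: le_trans (hS'.2 _) _; rewrite hnorm_basis mulr1.
  rewrite -mulr_sumr.
  have -> : (c * d * hn x) ^+ 2 = d ^+ 2 * (c ^+ 2 * hn x ^+ 2) by ring.
  rewrite ler_wpM2l ?sqr_ge0//; apply: sum_sqr_hn_le => B; rewrite exchange_big/=.
  apply: (@le_trans _ _ (\sum_(j <- B) c ^+ 2 * normc (x j) ^+ 2)); last first.
    by rewrite -mulr_sumr ler_wpM2l ?sqr_ge0// sum_sqr_le_hnorm.
  apply: ler_sum => j _.
  under eq_bigr do rewrite (coord _ _ _ _ TT') normcM normc_conj exprMn.
  rewrite -mulr_sumr mulrC ler_wpM2r ?sqr_ge0//.
  apply: le_trans (sum_sqr_le_hnorm _ _) _.
  rewrite lerXn2r ?nnegrE ?hn_ge0//.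
  by apply: le_trans (hT.2 _) _; rewrite hnorm_basis mulr1.
pose X x : H := Ell2 (square_summableP (x := fun i => inner x (row i)) (bound x)).
exists X.
  split=> [a x y|x].
    by apply/val_inj/funext => i /=; rewrite innerDl innerZl.
  rewrite -(@ler_pXn2r _ 2) ?nnegrE ?mulr_ge0 ?hn_ge0//.
  by apply: sqr_hnorm_le => A; exact: bound.
apply/funext => i; apply/funext => j; rewrite /matrix_of /schur/=.
by rewrite innerC inner_basis /= (coord _ _ _ _ TT') (coord _ _ _ _ SS') rmorphM/= !conjcK.
Qed.

End PointwiseProduct.

(** * Jensen and Hoelder inequalities for doubly substochastic weights *)

Section Substochastic.
Variable R : realType.
Implicit Types r x : R.

Lemma powR_mul_self r (m : R) : 1 <= r -> 0 <= m -> m `^ (r - 1) * m = m `^ r.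
Proof.
move=> r1; rewrite le_eqVlt => /predU1P[<-|m0].
  by rewrite mulr0 powR0// gt_eqF// (lt_le_trans ltr01).
rewrite -[X in _ * X](powRr1 (ltW m0)) -powRD ?subrK//.
by rewrite (gt_eqF m0) implybT.
Qed.

(** The power function lies above its tangent at m: this is Young's inequality for x and m^(r-1),
    with exponents r and r / (r - 1). *)
Lemma powR_tangent r x (m : R) : 1 <= r -> 0 <= x -> 0 <= m ->
  m `^ r + r * m `^ (r - 1) * (x - m) <= x `^ r.
Proof.
move=> r1 x0 m0; have [->|rn1] := eqVneq r 1.
  by rewrite subrr !powRr1// powRr0 !mul1r addrC subrK.
have r_gt1 : 1 < r by rewrite lt_neqAle eq_sym rn1.
have rm1 : 0 < r - 1 by rewrite subr_gt0.
have r0 : 0 < r := lt_trans ltr01 r_gt1.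
pose q := r / (r - 1); have q0 : 0 < q by rewrite divr_gt0.
have rq : r^-1 + q^-1 = 1.
  by rewrite /q; field; rewrite !gt_eqF.
have := conjugate_powR x0 (powR_ge0 m (r - 1)) r0 q0 rq.
have -> : (m `^ (r - 1)) `^ q = m `^ r.
  by rewrite -powRrM /q mulrCA divff ?mulr1 ?gt_eqF.
rewrite -(ler_pM2l r0).
have -> : r * (x `^ r / r + m `^ r / q) = x `^ r + (r - 1) * m `^ r.
  by rewrite /q; field; rewrite !gt_eqF.
have := powR_mul_self r1 m0; set a := m `^ (r - 1); set b := m `^ r => ab.
have -> : r * a * (x - m) = r * (x * a) - r * (a * m) by ring.
by rewrite ab; lra.
Qed.

Lemma jensen_substochastic (J : finType) (c s : J -> R) r : 1 <= r ->
  (forall j, 0 <= c j) -> (forall j, 0 <= s j) -> \sum_j c j <= 1 ->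
  (\sum_j c j * s j) `^ r <= \sum_j c j * s j `^ r.
Proof.
move=> r1 c0 s0 c1; set m := \sum_j _.
have m0 : 0 <= m by apply: sumr_ge0 => j _; rewrite mulr_ge0.
apply: (@le_trans _ _ (\sum_j c j * (m `^ r + r * m `^ (r - 1) * (s j - m)))); last first.
  by apply: ler_sum => j _; rewrite ler_wpM2l// powR_tangent.
have -> : \sum_j c j * (m `^ r + r * m `^ (r - 1) * (s j - m)) =
    (m `^ r - r * (m `^ (r - 1) * m)) * \sum_j c j + r * (m `^ (r - 1) * m).
  transitivity (\sum_j ((m `^ r - r * (m `^ (r - 1) * m)) * c j +
      r * m `^ (r - 1) * (c j * s j))).
    by apply: eq_bigr => j _; ring.
  by rewrite big_split/= -!mulr_sumr -/m; ring.
rewrite (powR_mul_self r1 m0); have := powR_ge0 m r; set b := m `^ r => b0.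
(* The weights may add up to less than 1; the missing mass contributes this nonnegative term in the
   right direction. *)
have : 0 <= b * (r - 1) * (1 - \sum_j c j) by rewrite !mulr_ge0 ?subr_ge0.
lra.
Qed.

(** Jensen along the rows, after which the column sums absorb the weights. *)
Lemma substochastic_powR (J : finType) (K : nat) (c : nat -> J -> R) (s : J -> R) r :
  1 <= r -> (forall k j, 0 <= c k j) -> (forall j, 0 <= s j) ->
  (forall k, \sum_j c k j <= 1) -> (forall j, \sum_(k < K) c k j <= 1) ->
  \sum_(k < K) (\sum_j c k j * s j) `^ r <= \sum_j s j `^ r.
Proof.
move=> r1 c0 s0 cr cc.
apply: (@le_trans _ _ (\sum_(k < K) \sum_j c k j * s j `^ r)).
  by apply: ler_sum => k _; exact: jensen_substochastic.
rewrite exchange_big/=; apply: ler_sum => j _; rewrite -mulr_suml.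
by rewrite ler_piMl ?powR_ge0.
Qed.

Lemma amgm (a b : R) : a * b <= (a ^+ 2 + b ^+ 2) / 2.
Proof. by have := sqr_ge0 (a - b); rewrite sqrrB; lra. Qed.

(** After normalising to A = B = 1, Young's inequality splits each s_n t_m; row sums absorb the
    weights in the p-th powers and column sums those in the q-th powers. *)
Lemma hoelder_substochastic (N M : nat) (d : nat -> nat -> R) (s t : nat -> R)
    (p q A B : R) : 0 < p -> 0 < q -> p^-1 + q^-1 = 1 ->
  (forall n m, 0 <= d n m) -> (forall n, 0 <= s n) -> (forall m, 0 <= t m) ->
  (forall n, \sum_(m < M) d n m <= 1) -> (forall m, \sum_(n < N) d n m <= 1) ->
  0 <= A -> 0 <= B ->
  \sum_(n < N) s n `^ p <= A `^ p -> \sum_(m < M) t m `^ q <= B `^ q ->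
  \sum_(n < N) \sum_(m < M) s n * t m * d n m <= A * B.
Proof.
move=> p0 q0 pq d0 s0 t0 dr dc.
(* Normalisation divides by A and B. When one of them is 0, the bound forces all terms of its
   sequence to vanish. *)
have nul (K : nat) (f : nat -> R) r : 0 < r -> (forall k, 0 <= f k) ->
    \sum_(k < K) f k `^ r <= 0 `^ r -> forall k : 'I_K, f k = 0.
  move=> r0 f0; rewrite powR0 ?gt_eqF// => h k.
  have : f k `^ r <= 0.
    apply: le_trans h; rewrite (bigD1 k)//= lerDl.
    by apply: sumr_ge0 => *; exact: powR_ge0.
  rewrite le_eqVlt ltNge powR_ge0 orbF powR_eq0 => /andP[/eqP ->]//.
rewrite le_eqVlt => /predU1P[<- _ hs _|A_gt0].
  rewrite mul0r big1// => n _; rewrite big1// => m _.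
  by rewrite (nul _ _ _ p0 s0 hs) !mul0r.
rewrite le_eqVlt => /predU1P[<- _ ht|B_gt0 hs ht].
  rewrite mulr0 big1// => n _; rewrite big1// => m _.
  by rewrite (nul _ _ _ q0 t0 ht) mulr0 mul0r.
have AB0 : 0 < A * B by rewrite mulr_gt0.
pose a n := s n / A; pose b m := t m / B.
have a0 n : 0 <= a n by rewrite divr_ge0 ?(ltW A_gt0).
have b0 m : 0 <= b m by rewrite divr_ge0 ?(ltW B_gt0).
have norm1 (K : nat) (f : nat -> R) (D r : R) : 0 < r -> 0 < D -> (forall k, 0 <= f k) ->
    \sum_(k < K) f k `^ r <= D `^ r -> \sum_(k < K) (f k / D) `^ r <= 1.
  move=> r0 D0 f0 h.
  have -> : \sum_(k < K) (f k / D) `^ r = (\sum_(k < K) f k `^ r) / D `^ r.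
    rewrite mulr_suml; apply: eq_bigr => k _.
    apply: (canRL (mulfK _)); first by rewrite gt_eqF// powR_gt0.
    by rewrite -powRM ?divr_ge0 ?(ltW D0)// divfK ?gt_eqF.
  by rewrite ler_pdivrMr ?powR_gt0// mul1r.
have ha := norm1 N s A p p0 A_gt0 s0 hs; have hb := norm1 M t B q q0 B_gt0 t0 ht.
have -> : \sum_(n < N) \sum_(m < M) s n * t m * d n m =
    A * B * \sum_(n < N) \sum_(m < M) a n * b m * d n m.
  rewrite mulr_sumr; apply: eq_bigr => n _; rewrite mulr_sumr; apply: eq_bigr => m _.
  by rewrite /a /b; field; rewrite !gt_eqF.
rewrite ler_piMr ?(ltW AB0)//.
apply: (@le_trans _ _ (\sum_(n < N) \sum_(m < M) (a n `^ p / p * d n m + b m `^ q / q * d n m))).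
  apply: ler_sum => n _; apply: ler_sum => m _; rewrite -mulrDl ler_wpM2r//.
  exact: conjugate_powR.
under eq_bigr do rewrite big_split/=.
rewrite big_split/= -pq; apply: lerD.
  apply: (@le_trans _ _ (\sum_(n < N) a n `^ p / p)).
    apply: ler_sum => n _; rewrite -mulr_sumr ler_piMr//.
    by rewrite divr_ge0 ?powR_ge0 ?(ltW p0).
  by rewrite -mulr_suml ler_piMl ?invr_ge0 ?(ltW p0).
rewrite exchange_big/=; apply: (@le_trans _ _ (\sum_(m < M) b m `^ q / q)).
  apply: ler_sum => m _; rewrite -mulr_sumr ler_piMr//.
  by rewrite divr_ge0 ?powR_ge0 ?(ltW q0).
by rewrite -mulr_suml ler_piMl ?invr_ge0 ?(ltW q0).
Qed.

End Substochastic.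

(** * Pairings against orthonormal families *)

Section Pairing.
Variables (R : realType) (I : choiceType).
Local Notation H := (ell2 R I).
Implicit Types (x y z : H) (T S X : H -> H) (e r : R) (f g : nat -> H).

Definition expansion (J : finType) (s : J -> R) (b d : J -> H) x : H :=
  \sum_j ((s j)%:C * inner x (b j)) *: d j.

(** An upper bound for |<x, b>| |<y, d>| that is a sum of two Bessel terms, so each of its row and
    column sums is bounded by two uses of Bessel's inequality. *)
Definition pairing_weight x y (b d : H) : R :=
  (normc (inner x b) ^+ 2 + normc (inner y d) ^+ 2) / 2.

Lemma pairing_weight_ge0 x y b d : 0 <= pairing_weight x y b d.
Proof. by rewrite divr_ge0 ?addr_ge0 ?sqr_ge0. Qed.

Lemma normc_expansion (J : finType) (s : J -> R) (b d : J -> H) x y :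
  (forall j, 0 <= s j) ->
  normc (inner (expansion s b d x) y) <=
  \sum_j pairing_weight x y (b j) (d j) * s j.
Proof.
move=> s0; rewrite inner_suml; apply: le_trans (normc_sum _ _ _) _.
apply: ler_sum => j _; rewrite innerZl !normcM normc_real ger0_norm//.
rewrite -mulrA mulrC ler_wpM2r//; apply: le_trans (amgm _ _) _.
by rewrite (normc_innerC (d j)).
Qed.

Lemma expansion_pairing (J : finType) (s : J -> R) (b d : J -> H) f g K r :
  1 <= r -> (forall j, 0 <= s j) ->
  (forall k, \sum_j pairing_weight (f k) (g k) (b j) (d j) <= 1) ->
  (forall j, \sum_(k < K) pairing_weight (f k) (g k) (b j) (d j) <= 1) ->
  \sum_(k < K) normc (inner (expansion s b d (f k)) (g k)) `^ r <= \sum_j s j `^ r.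
Proof.
move=> r1 s0 wr wc.
apply: le_trans (substochastic_powR r1
  (fun k j => pairing_weight_ge0 (f k) (g k) (b j) (d j)) s0 wr wc).
apply: ler_sum => k _; apply: ge0_ler_powR; rewrite ?nnegrE ?normc_ge0//.
- exact: le_trans ler01 r1.
- by apply: sumr_ge0 => j _; rewrite mulr_ge0 ?pairing_weight_ge0.
- exact: normc_expansion.
Qed.

Lemma pairing_weight_sum (J : Type) (q : seq J) (x y b d : J -> H) c :
  \sum_(j <- q) normc (inner (x j) (b j)) ^+ 2 <= c ->
  \sum_(j <- q) normc (inner (y j) (d j)) ^+ 2 <= c ->
  \sum_(j <- q) pairing_weight (x j) (y j) (b j) (d j) <= c.
Proof.
by move=> h1 h2; rewrite -mulr_suml big_split/= ler_pdivrMr//; lra.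
Qed.

Lemma inner_cvg_seq (a : nat -> H) x y : hcvg a x ->
  (fun n => normc (inner (a n) y)) @ \oo --> normc (inner x y).
Proof.
move=> ax; apply/cvgrPdist_lt => e e0.
have k1 : 0 < hn y + 1 by rewrite ltr_wpDl ?hn_ge0.
have [N hN] := ax _ (divr_gt0 e0 k1); exists N => // n /= Nn.
have h : normc (inner (a n - x) y) < e.
  apply: le_lt_trans (normc_inner _ _) _.
  have := hN n Nn; rewrite ltr_pdivlMr// => h; apply: le_lt_trans h.
  by rewrite ler_wpM2l ?hn_ge0// lerDl.
apply: le_lt_trans h; rewrite innerBl.
have := normcD (inner (a n) y - inner x y) (inner x y); rewrite subrK.
have := normcD (inner x y - inner (a n) y) (inner (a n) y); rewrite subrK distcC.
by rewrite ler_norml; lra.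
Qed.

(** The tangent inequality at the limit value bounds each r-th power from below by an affine
    function of the approximant. Only the convergence of the pairings is then used, not the
    continuity of the power function. *)
Lemma pairing_limit T (X : nat -> H -> H) f g K r M : 1 <= r ->
  (forall x, hcvg (fun n => X n x) (T x)) ->
  (forall N, \sum_(k < K) normc (inner (X N (f k)) (g k)) `^ r <= M) ->
  \sum_(k < K) normc (inner (T (f k)) (g k)) `^ r <= M.
Proof.
move=> r1 XT XM.
pose a k := normc (inner (T (f k)) (g k)).
pose aN N k := normc (inner (X N (f k)) (g k)).
apply: (@cvg_le_cst R _ \oo _ (fun N => \sum_(k < K)
   (a k `^ r + r * a k `^ (r - 1) * (aN N k - a k)))) => [|N]; last first.
  apply: le_trans (XM N); apply: ler_sum => k _.
  by apply: powR_tangent => //; exact: normc_ge0.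
apply: cvg_sum_real => k.
rewrite -[X in _ --> X]addr0; apply: cvgD; first exact: cvg_cst.
rewrite -(mulr0 (r * a k `^ (r - 1))); apply: cvgM; first exact: cvg_cst.
rewrite -(subrr (a k)); apply: cvgB; last exact: cvg_cst.
exact: inner_cvg_seq.
Qed.

Lemma svd_cvg T s u v x : svd T s u v -> hcvg (fun n => spectral_sum s u v n x) (T x).
Proof.
move=> hsvd e e0; have k1 : 0 < hn x + 1 by rewrite ltr_wpDl ?hn_ge0.
have [N sN] := svd_to0 hsvd (divr_gt0 e0 k1); exists N => n Nn.
rewrite hdistC; apply: le_lt_trans ((svd_rem hsvd n).2 x) _.
have := svd_nonincr hsvd Nn; move: sN; rewrite ltr_pdivlMr// => sN sn.
apply: le_lt_trans sN; apply: ler_pM; rewrite ?(svd_ge0 hsvd) ?hn_ge0//.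
by rewrite lerDl.
Qed.

Lemma svd_pairing T s u v f g K r M : svd T s u v -> 1 <= r ->
  (forall N, \sum_(n < N) s n `^ r <= M) ->
  suborthonormal f -> suborthonormal g ->
  \sum_(k < K) normc (inner (T (f k)) (g k)) `^ r <= M.
Proof.
move=> hsvd r1 sM of_ og.
apply: (pairing_limit r1 (fun x => svd_cvg x hsvd)) => N.
apply: le_trans (sM N).
apply: (@expansion_pairing _ (fun n : 'I_N => s n) (fun n => v n) (fun n => u n)) => //.
- by move=> j; exact: svd_ge0 hsvd j.
- move=> k; apply: pairing_weight_sum.
    by apply: le_trans (bessel (svd_orthr hsvd) _ _) (sqr_hn_suborthonormal_le1 _ _).
  by apply: le_trans (bessel (svd_orthl hsvd) _ _) (sqr_hn_suborthonormal_le1 _ _).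
- move=> j; apply: pairing_weight_sum.
    under eq_bigr do rewrite normc_innerC.
    apply: le_trans (bessel of_ _ _) (sqr_hn_suborthonormal_le1 _ _).
    exact: svd_orthr hsvd.
  under eq_bigr do rewrite normc_innerC.
  apply: le_trans (bessel og _ _) (sqr_hn_suborthonormal_le1 _ _).
  exact: svd_orthl hsvd.
Qed.

End Pairing.

(** * Expansion of a Schur product in pointwise products of singular vectors *)

Section SchurExpansion.
Variables (R : realType) (I : choiceType).
Local Notation H := (ell2 R I).
Variables (s t : nat -> R) (u v u' v' : nat -> H).

Definition schur_expansion N : H -> H :=
  expansion (fun j : 'I_N * 'I_N => s j.1 * t j.2)
    (fun j => pmul (v j.1) (v' j.2)) (fun j => pmul (u j.1) (u' j.2)).

Lemma expansion_finite_rank (J : finType) (a : J -> R) (b d : J -> H) :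
  exists q, expansion a b d = finite_rank q.
Proof.
exists [seq (b j, (a j)%:C *: d j) | j <- index_enum J]; apply/funext => x.
rewrite /finite_rank big_map; apply: eq_bigr => j _.
by rewrite scalerA mulrC.
Qed.

Lemma spectral_sum_matrix N i j : matrix_of (spectral_sum s u v N) i j =
  \sum_(n < N) (s n)%:C * conjc (v n j) * u n i.
Proof.
rewrite /matrix_of /spectral_sum ell2_sumE; apply: eq_bigr => n _.
by rewrite innerC inner_basis.
Qed.

End SchurExpansion.

Section SchurExpansionLimit.
Variables (R : realType) (I : choiceType).
Local Notation H := (ell2 R I).
Variables (T T' : H -> H) (s t : nat -> R) (u v u' v' : nat -> H).
Hypotheses (hT : svd T s u v) (hT' : svd T' t u' v').
Implicit Types (x y z : H) (X : H -> H) (e r : R) (f g : nat -> H).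
Let SE := (schur_expansion s t u v u' v').

Lemma schur_expansion_matrix N : matrix_of (SE N) =
  schur (matrix_of (spectral_sum s u v N)) (matrix_of (spectral_sum t u' v' N)).
Proof.
apply/funext => i; apply/funext => j; rewrite /schur !spectral_sum_matrix.
rewrite big_distrlr/= pair_bigA/= /matrix_of /SE /schur_expansion /expansion ell2_sumE.
apply: eq_bigr => k _; rewrite innerC inner_basis /=.
rewrite rmorphM rmorphM /=.
have mulACA (a b c d e f : R[i]) : a * b * (c * d) * (e * f) = a * c * e * (b * d * f).
  by ring.
exact: mulACA.
Qed.

(** With truncations T_N and T'_N, the error is (T - T_N) * T' + T_N * (T' - T'_N) for the Schur
    product. The norm of T_N is bounded by s_0 + s_N through T_N = T - (T - T_N). *)
Lemma schur_expansion_rem X c N : opb X c ->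
  matrix_of X = schur (matrix_of T) (matrix_of T') ->
  opb (fun x => X x - SE N x) (s N * t 0%N + (s 0%N + s N) * t N).
Proof.
move=> hX mX.
have s0 := svd_ge0 hT; have t0 := svd_ge0 hT'.
have bTN : opb (spectral_sum s u v N) (s 0%N + s N).
  have := opbB (svd_opb hT) (svd_rem hT N); congr (opb _ _).
  by apply/funext => x; rewrite opprB addrC subrK.
have [Y1 hY1 mY1] := schur_exists (s0 N) (t0 0%N) (svd_rem hT N) (svd_opb hT').
have [Y2 hY2 mY2] := schur_exists (addr_ge0 (s0 0%N) (s0 N)) (t0 N) bTN (svd_rem hT' N).
have [q qE] := expansion_finite_rank (fun j : 'I_N * 'I_N => s j.1 * t j.2)
    (fun j => pmul (v j.1) (v' j.2)) (fun j => pmul (u j.1) (u' j.2)).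
have [d hd] : exists d, opb (SE N) d.
  by rewrite /SE /schur_expansion qE; exact: finite_rank_opb.
suff -> : (fun x => X x - SE N x) = (fun x => Y1 x + Y2 x) by exact: opbD.
apply: (matrix_of_inj (opbB hX hd) (opbD hY1 hY2)).
have mB (A B : H -> H) : matrix_of (fun x => A x - B x) =
    (fun i j => matrix_of A i j - matrix_of B i j) by [].
have mD (A B : H -> H) : matrix_of (fun x => A x + B x) =
    (fun i j => matrix_of A i j + matrix_of B i j) by [].
rewrite mB mD mX mY1 mY2 schur_expansion_matrix !mB.
by apply/funext => i; apply/funext => j; rewrite /schur; ring.
Qed.

Lemma schur_expansion_rem_to0 e : 0 < e -> exists N : nat, forall n, (N <= n)%N ->
  s n * t 0%N + (s 0%N + s n) * t n < e.
Proof.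
move=> e0; have s0 := svd_ge0 hT; have t0 := svd_ge0 hT'.
(* Once s_n and t_n are below e / k, and as s_n <= s_0, the error is at most (e / k) (t_0 + 2 s_0);
   the extra 1 keeps [k] positive and the inequality strict. *)
pose k := t 0%N + 2 * s 0%N + 1.
have k0 : 0 < k by rewrite /k; have := s0 0%N; have := t0 0%N; lra.
have [N sN] := svd_to0 hT (divr_gt0 e0 k0); have [M tM] := svd_to0 hT' (divr_gt0 e0 k0).
exists (maxn N M) => n; rewrite geq_max => /andP[Nn Mn].
have sn : s n < e / k := le_lt_trans (svd_nonincr hT Nn) sN.
have tn : t n < e / k := le_lt_trans (svd_nonincr hT' Mn) tM.
have sn0 := svd_nonincr hT (leq0n n).
have ek : e / k * k = e by rewrite divfK ?gt_eqF.
have h1 : s n * t 0%N <= e / k * t 0%N by rewrite ler_wpM2r// ltW.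
have h2 : (s 0%N + s n) * t n <= 2 * s 0%N * (e / k).
  apply: ler_pM; rewrite ?addr_ge0 ?(ltW tn)//; have := s0 0%N; lra.
apply: le_lt_trans (lerD h1 h2) _.
have -> : e / k * t 0%N + 2 * s 0%N * (e / k) = e / k * (t 0%N + 2 * s 0%N) by ring.
by rewrite -[ltRHS]ek ltr_pM2l ?divr_gt0// /k ltrDl.
Qed.

Lemma schur_compact X c : opb X c ->
  matrix_of X = schur (matrix_of T) (matrix_of T') -> compact_operator X.
Proof.
move=> hX mX; apply: compact_finite_rank_approx hX.1 _ => e e0.
have [N hN] := schur_expansion_rem_to0 e0.
have [q qE] := expansion_finite_rank (fun j : 'I_N * 'I_N => s j.1 * t j.2)
    (fun j => pmul (v j.1) (v' j.2)) (fun j => pmul (u j.1) (u' j.2)).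
exists q; rewrite -qE; apply: opb_le (schur_expansion_rem N hX mX).
exact: ltW (hN N (leqnn N)).
Qed.

Lemma schur_expansion_cvg X c x : opb X c ->
  matrix_of X = schur (matrix_of T) (matrix_of T') ->
  hcvg (fun n => SE n x) (X x).
Proof.
move=> hX mX e e0; have k1 : 0 < hn x + 1 by rewrite ltr_wpDl ?hn_ge0.
have [N hN] := schur_expansion_rem_to0 (divr_gt0 e0 k1); exists N => n Nn.
rewrite hdistC; apply: le_lt_trans ((schur_expansion_rem n hX mX).2 x) _.
have := hN n Nn; rewrite ltr_pdivlMr// => h; apply: le_lt_trans h.
apply: ler_wpM2l; last by rewrite lerDl.
by rewrite addr_ge0 ?mulr_ge0 ?addr_ge0 ?(svd_ge0 hT) ?(svd_ge0 hT').
Qed.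

Let hn_pmul1 (a b : nat -> H) n m : suborthonormal a -> suborthonormal b ->
  hn (pmul (a n) (b m)) ^+ 2 <= 1.
Proof.
move=> oa ob; apply: (@le_trans _ _ ((hn (a n) * hn (b m)) ^+ 2)).
  by rewrite lerXn2r ?nnegrE ?mulr_ge0 ?hn_ge0 ?hn_pmul_le.
by rewrite exprMn mulr_ile1 ?sqr_ge0 ?sqr_hn_suborthonormal_le1.
Qed.

(** Rows of weights are bounded by [bessel_product], columns by |v_n v'_m| <= 1 and |u_n u'_m| <= 1.
    The sum of (s_n t_m)^r over pairs factors. *)
Lemma schur_pairing X c f g K r A B : opb X c ->
  matrix_of X = schur (matrix_of T) (matrix_of T') -> 1 <= r ->
  (forall N, \sum_(n < N) s n `^ r <= A) -> (forall N, \sum_(n < N) t n `^ r <= B) ->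
  suborthonormal f -> suborthonormal g ->
  \sum_(k < K) normc (inner (X (f k)) (g k)) `^ r <= A * B.
Proof.
move=> hX mX r1 sA tB of_ og.
have ou := svd_orthl hT; have ov := svd_orthr hT.
have ou' := svd_orthl hT'; have ov' := svd_orthr hT'.
have s0 := svd_ge0 hT; have t0 := svd_ge0 hT'.
apply: (pairing_limit r1 (fun x => schur_expansion_cvg x hX mX)) => N.
apply: (@le_trans _ _ (\sum_(j : 'I_N * 'I_N) (s j.1 * t j.2) `^ r)); last first.
  rewrite -(pair_bigA _ (fun n m : 'I_N => (s n * t m) `^ r))/=.
  apply: (@le_trans _ _ ((\sum_(n < N) s n `^ r) * (\sum_(n < N) t n `^ r))).
    rewrite big_distrlr/= le_eqVlt; apply/orP; left; apply/eqP.
    by apply: eq_bigr => n _; apply: eq_bigr => m _; rewrite powRM.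
  by apply: ler_pM => //; apply: sumr_ge0 => *; exact: powR_ge0.
apply: expansion_pairing => //.
- by move=> j; rewrite mulr_ge0.
- move=> k; apply: pairing_weight_sum.
    rewrite -(pair_bigA _ (fun n m : 'I_N => normc (inner (f k) (pmul (v n) (v' m))) ^+ 2))/=.
    by apply: le_trans (bessel_product _ _ _ ov ov') (sqr_hn_suborthonormal_le1 _ _).
  rewrite -(pair_bigA _ (fun n m : 'I_N => normc (inner (g k) (pmul (u n) (u' m))) ^+ 2))/=.
  by apply: le_trans (bessel_product _ _ _ ou ou') (sqr_hn_suborthonormal_le1 _ _).
- move=> j; apply: pairing_weight_sum.
    under eq_bigr do rewrite normc_innerC.
    by apply: le_trans (bessel of_ _ _) (hn_pmul1 _ _ ov ov').
  under eq_bigr do rewrite normc_innerC.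
  by apply: le_trans (bessel og _ _) (hn_pmul1 _ _ ou ou').
Qed.

(* The weights of a pairing of an elementary Schur product against orthonormal
   families, summed over these families, are doubly substochastic. *)
Let trace_weight f g K n m :=
  \sum_(k < K) pairing_weight (f k) (g k) (pmul (v n) (v' m)) (pmul (u n) (u' m)).

Let bessel_pmul_sum (a : nat -> H) f z N K : suborthonormal a -> suborthonormal f ->
  \sum_(k < K) \sum_(n < N) normc (inner (f k) (pmul z (a n))) ^+ 2 <= hn z ^+ 2.
Proof.
move=> oa of_; apply: le_trans (bessel_pmul z K of_); apply: ler_sum => k _.
rewrite pmulC -hn_pmul_pconj; apply: le_trans (bessel oa (pmul (f k) (pconj z)) N).
by apply: ler_sum => n _; rewrite inner_pmul.
Qed.

(** The weights are first summed over k, which leaves a bilinear form in s and t with doubly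
    substochastic coefficients. The bound on such forms is a parameter because p = 1 and p > 1
    obtain it differently. *)
Lemma schur_pairing1 X c f g K M : opb X c ->
  matrix_of X = schur (matrix_of T) (matrix_of T') ->
  suborthonormal f -> suborthonormal g ->
  (forall N (d : nat -> nat -> R), (forall n m, 0 <= d n m) ->
    (forall n, \sum_(m < N) d n m <= 1) -> (forall m, \sum_(n < N) d n m <= 1) ->
    \sum_(n < N) \sum_(m < N) s n * t m * d n m <= M) ->
  \sum_(k < K) normc (inner (X (f k)) (g k)) `^ 1 <= M.
Proof.
move=> hX mX of_ og hM.
have ou := svd_orthl hT; have ov := svd_orthr hT.
have ou' := svd_orthl hT'; have ov' := svd_orthr hT'.
have s0 := svd_ge0 hT; have t0 := svd_ge0 hT'.
apply: (pairing_limit (lexx 1) (fun x => schur_expansion_cvg x hX mX)) => N.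
have w0 n m : 0 <= trace_weight f g K n m.
  by apply: sumr_ge0 => k _; exact: pairing_weight_ge0.
apply: le_trans (hM N (trace_weight f g K) w0 _ _).
- apply: (@le_trans _ _ (\sum_(k < K) \sum_(j : 'I_N * 'I_N)
    pairing_weight (f k) (g k) (pmul (v j.1) (v' j.2)) (pmul (u j.1) (u' j.2))
      * (s j.1 * t j.2))).
    apply: ler_sum => k _; rewrite powRr1 ?normc_ge0//.
    by apply: normc_expansion => j; rewrite mulr_ge0.
  rewrite exchange_big/= le_eqVlt; apply/orP; left; apply/eqP.
  rewrite [RHS]pair_bigA/=; apply: eq_bigr => j _.
  by rewrite -mulr_suml mulrC.
- move=> n; rewrite exchange_big/=.
  under eq_bigr do rewrite -mulr_suml big_split/=.
  rewrite -mulr_suml big_split/= ler_pdivrMr// mul1r.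
  have -> : 2 = 1 + 1 :> R by [].
  apply: lerD.
    by apply: le_trans (bessel_pmul_sum _ _ _ ov' of_) (sqr_hn_suborthonormal_le1 _ _).
  by apply: le_trans (bessel_pmul_sum _ _ _ ou' og) (sqr_hn_suborthonormal_le1 _ _).
- move=> m; rewrite exchange_big/=.
  under eq_bigr do rewrite -mulr_suml big_split/=.
  rewrite -mulr_suml big_split/= ler_pdivrMr// mul1r.
  have -> : 2 = 1 + 1 :> R by [].
  apply: lerD.
    under eq_bigr do under eq_bigr do rewrite pmulC.
    by apply: le_trans (bessel_pmul_sum _ _ _ ov of_) (sqr_hn_suborthonormal_le1 _ _).
  under eq_bigr do under eq_bigr do rewrite pmulC.
  by apply: le_trans (bessel_pmul_sum _ _ _ ou og) (sqr_hn_suborthonormal_le1 _ _).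
Qed.

End SchurExpansionLimit.

(** * Schatten classes of matrices and the inequalities for their Schur products *)

Section SchattenClass.
Variables (R : realType) (I : choiceType).
Local Notation H := (ell2 R I).
Local Notation mx := (I -> I -> C R).
Implicit Types (T S X : H -> H) (a b : mx) (p r c e : R).

Lemma compact_opb T : compact_operator T -> exists2 c, 0 <= c & opb T c.
Proof. by move=> [/bounded_operatorP]. Qed.

Lemma compact_approx T e : compact_operator T -> 0 < e ->
  exists q, opb (fun x => T x - finite_rank q x) e.
Proof.
move=> cT e0; have [s [u [v h]]] := compact_svd cT.
have [N sN] := svd_to0 h e0.
exists [seq (v n, (s n)%:C *: u n) | n : 'I_N <- index_enum 'I_N].
have := opb_le (ltW sN) (svd_rem h N); congr (opb _ _); apply/funext => x.
rewrite /finite_rank big_map /spectral_sum; congr (_ - _).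
by apply: eq_bigr => n _; rewrite scalerA mulrC.
Qed.

Lemma compact_operator_closed T : linear T ->
  (forall e, 0 < e -> exists2 S, compact_operator S & opb (fun x => T x - S x) e) ->
  compact_operator T.
Proof.
move=> lT hT; apply: compact_finite_rank_approx => // e e0.
have e2 : 0 < e / 2 by rewrite divr_gt0.
have [S cS TS] := hT _ e2; have [q Sq] := compact_approx cS e2; exists q.
have := opbD TS Sq; rewrite -splitr; congr (opb _ _); apply/funext => x.
by rewrite addrA subrK.
Qed.

Lemma compactD T S : compact_operator T -> compact_operator S ->
  compact_operator (fun x => T x + S x).
Proof.
move=> cT cS; have [c _ hT] := compact_opb cT; have [d _ hS] := compact_opb cS.
apply: compact_finite_rank_approx => [|e e0]; first exact: (opbD hT hS).1.
have e2 : 0 < e / 2 by rewrite divr_gt0.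
have [q hq] := compact_approx cT e2; have [w hw] := compact_approx cS e2.
exists (q ++ w); have := opbD hq hw; rewrite -splitr; congr (opb _ _).
by apply/funext => x; rewrite /finite_rank big_cat/= addrACA opprD.
Qed.

Lemma compactZ (l : R[i]) T : compact_operator T -> compact_operator (fun x => l *: T x).
Proof.
move=> cT; have [c _ hT] := compact_opb cT.
apply: compact_finite_rank_approx => [|e e0]; first exact: (opbZ l hT).1.
have k1 : 0 < normc l + 1 by rewrite ltr_wpDl ?normc_ge0.
have [q hq] := compact_approx cT (divr_gt0 e0 k1).
exists [seq (z.1, l *: z.2) | z <- q].
apply: (@opb_le _ _ _ (normc l * (e / (normc l + 1)))).
  by rewrite mulrA ler_pdivrMr// mulrC ler_wpM2l ?(ltW e0)// lerDl.
have := opbZ l hq; congr (opb _ _); apply/funext => x.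
rewrite scalerBr /finite_rank big_map scaler_sumr; congr (_ - _).
by apply: eq_bigr => z _; rewrite !scalerA mulrC.
Qed.

Lemma schatten_svd (q : \bar R) a : schatten_carrier q a ->
  exists T s u v, [/\ svd T s u v, compact_operator T, matrix_of T = a,
    schatten_norm q a = fine (operator_schatten_norm q T) &
    (operator_schatten_norm q T < +oo)%E].
Proof.
move=> [T [cT <- fT]]; have [s [u [v h]]] := compact_svd cT.
exists T, s, u, v; split=> //; have [c _ hT] := compact_opb cT.
by rewrite /schatten_norm (operator_of_matrix hT).
Qed.

Lemma schatten_carrier_matrix (q : \bar R) T : compact_operator T ->
  (operator_schatten_norm q T < +oo)%E ->
  schatten_carrier q (matrix_of T) /\
  schatten_norm q (matrix_of T) = fine (operator_schatten_norm q T).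
Proof.
move=> cT fT; split; first by exists T.
by have [c _ hT] := compact_opb cT; rewrite /schatten_norm (operator_of_matrix hT).
Qed.

Lemma schatten_norm_ge0 r a : 0 < r -> schatten_carrier r%:E a -> 0 <= schatten_norm r%:E a.
Proof.
move=> r0 /schatten_svd[T [s [u [v [h _ _ -> _]]]]].
exact: (schatten_fine_ge0 h).
Qed.

Lemma schatten_pairing T a r f g K : 1 <= r -> schatten_carrier r%:E a ->
  matrix_of T = a -> (exists c, opb T c) -> suborthonormal f -> suborthonormal g ->
  \sum_(k < K) normc (inner (T (f k)) (g k)) `^ r <= schatten_norm r%:E a `^ r.
Proof.
move=> r1 /schatten_svd[S [s [u [v [h cS <- -> fS]]]]] mT [c hT] of_ og.
have [d _ hS] := compact_opb cS; rewrite (matrix_of_inj hT hS mT).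
apply: (svd_pairing _ h) => //; apply: (svd_schatten_lb h (lt_le_trans ltr01 r1) fS).
Qed.

(** The singular vectors themselves are admissible families, and against them the pairings are
    exactly the singular values. *)
Lemma schatten_intro T r c : 1 <= r -> 0 <= c -> compact_operator T ->
  (forall K f g, suborthonormal f -> suborthonormal g ->
    \sum_(k < K) normc (inner (T (f k)) (g k)) `^ r <= c `^ r) ->
  schatten_carrier r%:E (matrix_of T) /\ schatten_norm r%:E (matrix_of T) <= c.
Proof.
move=> r1 c0 cT hT; have [s [u [v h]]] := compact_svd cT.
have r0 : 0 < r := lt_le_trans ltr01 r1.
have [|fT Tc] := svd_schatten_ub h r0 c0.
  move=> N; apply: le_trans (hT N v u (svd_orthr h) (svd_orthl h)).
  apply: ler_sum => k _; rewrite le_eqVlt; apply/orP; left; apply/eqP; congr (_ `^ _).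
  rewrite (svd_vec h) innerZl innerxx normcM !normc_real ger0_norm ?(svd_ge0 h)//.
  rewrite ger0_norm ?sqr_ge0//.
  by case: (svd_cases h k) => [[-> _]|[_ [-> _]]]; rewrite ?mul0r// expr1n mulr1.
by have [? ->] := schatten_carrier_matrix cT fT.
Qed.

Lemma schattenZ r (l : R[i]) a : 1 <= r -> schatten_carrier r%:E a ->
  schatten_carrier r%:E (l *: a) /\
  schatten_norm r%:E (l *: a) <= normc l * schatten_norm r%:E a.
Proof.
move=> r1 ha; have r0 : 0 < r := lt_le_trans ltr01 r1.
have [T [s [u [v [h cT mT _ _]]]]] := schatten_svd ha.
have [c _ hT] := compact_opb cT.
have -> : l *: a = matrix_of (fun x => l *: T x).
  by rewrite -mT; apply/funext => i; apply/funext => j.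
apply: schatten_intro => //.
- by rewrite mulr_ge0 ?normc_ge0 ?schatten_norm_ge0.
- exact: compactZ.
- move=> K f g of_ og.
  rewrite powRM ?normc_ge0 ?schatten_norm_ge0//.
  apply: (@le_trans _ _ (normc l `^ r * \sum_(k < K) normc (inner (T (f k)) (g k)) `^ r)).
    rewrite mulr_sumr; apply: ler_sum => k _.
    by rewrite innerZl normcM powRM ?normc_ge0.
  rewrite ler_wpM2l ?powR_ge0//.
  by apply: (schatten_pairing K r1 ha mT _ of_ og); exists c.
Qed.

Lemma schatten_schur r a b : 1 <= r -> schatten_carrier r%:E a ->
  schatten_carrier r%:E b -> schatten_carrier r%:E (schur a b) /\
  schatten_norm r%:E (schur a b) <= schatten_norm r%:E a * schatten_norm r%:E b.
Proof.
move=> r1 ha hb; have r0 : 0 < r := lt_le_trans ltr01 r1.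
have [T [s [u [v [hT cT <- nT fT]]]]] := schatten_svd ha.
have [S [t [u' [v' [hS cS <- nS fS]]]]] := schatten_svd hb.
have [X hX mX] := schur_exists (svd_ge0 hT 0) (svd_ge0 hS 0) (svd_opb hT) (svd_opb hS).
have T0 : 0 <= schatten_norm r%:E (matrix_of T) by rewrite nT (schatten_fine_ge0 hT).
have S0 : 0 <= schatten_norm r%:E (matrix_of S) by rewrite nS (schatten_fine_ge0 hS).
rewrite -mX; apply: schatten_intro => //.
- by rewrite mulr_ge0.
- exact: (schur_compact hT hS hX).
- move=> K f g of_ og; rewrite powRM//.
  have sT := svd_schatten_lb hT r0 fT; have sS := svd_schatten_lb hS r0 fS.
  by rewrite nT nS; exact: (schur_pairing hT hS K hX mX r1 sT sS of_ og).
Qed.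

Lemma schattenoo_svd a : schatten_carrier +oo%E a -> exists T s u v,
  [/\ svd T s u v, compact_operator T, matrix_of T = a & schatten_norm +oo%E a = s 0%N].
Proof.
move=> /schatten_svd[T [s [u [v [h cT mT -> _]]]]]; exists T, s, u, v; split=> //.
by rewrite /= (svd_operator_norm h).
Qed.

Lemma schattenoo_schur a b : schatten_carrier +oo%E a ->
  schatten_carrier +oo%E b -> schatten_carrier +oo%E (schur a b) /\
  schatten_norm +oo%E (schur a b) <= schatten_norm +oo%E a * schatten_norm +oo%E b.
Proof.
move=> /schattenoo_svd[T [s [u [v [hT cT <- ->]]]]].
move=> /schattenoo_svd[S [t [u' [v' [hS cS <- ->]]]]].
have [X hX mX] := schur_exists (svd_ge0 hT 0) (svd_ge0 hS 0) (svd_opb hT) (svd_opb hS).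
have cX := schur_compact hT hS hX mX.
have [w [f [g h]]] := compact_svd cX.
have nX := svd_operator_norm h.
have [|XS XE] := @schatten_carrier_matrix +oo%E X cX; first by rewrite /= nX ltry.
rewrite -mX; split=> //; rewrite XE /= nX /=.
case: (svd_cases h 0) => [[-> _]|[_ [f1 g1]]]; first by rewrite mulr_ge0 ?(svd_ge0 hT) ?(svd_ge0 hS).
have := hX.2 (g 0%N); rewrite (svd_vec h) ell2_hnormZ normc_real f1 g1 !mulr1.
by apply: le_trans; exact: ler_norm.
Qed.

Lemma schattenoo_norm_ge0 a : schatten_carrier +oo%E a -> 0 <= schatten_norm +oo%E a.
Proof. by move=> /schattenoo_svd[T [s [u [v [h _ _ ->]]]]]; exact: svd_ge0 h 0. Qed.

Lemma schatten_schur_hoelder p a b : 1 <= p -> schatten_carrier p%:E a ->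
  schatten_carrier (hoelder_conjugate p%:E) b ->
  schatten_carrier 1%:E (schur a b) /\
  schatten_norm 1%:E (schur a b) <=
    schatten_norm p%:E a * schatten_norm (hoelder_conjugate p%:E) b.
Proof.
(* For p = 1 the conjugate exponent is +oo, with norm t_0: bounding each t_m by t_0 leaves only row
   sums of the weights. *)
rewrite le_eqVlt => /predU1P[<-|p1].
  rewrite hoelder_conjugate1 => ha /schattenoo_svd[S [t [u' [v' [hS cS <- ->]]]]].
  have [T [s [u [v [hT cT <- nT fT]]]]] := schatten_svd ha.
  have [X hX mX] := schur_exists (svd_ge0 hT 0) (svd_ge0 hS 0) (svd_opb hT) (svd_opb hS).
  have T0 : 0 <= schatten_norm 1%:E (matrix_of T) by rewrite nT (schatten_fine_ge0 hT).
  have t0 := svd_ge0 hS 0; have s0 := svd_ge0 hT.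
  rewrite -mX; apply: schatten_intro => //.
  - by rewrite mulr_ge0.
  - exact: (schur_compact hT hS hX).
  move=> K f g of_ og; apply: (schur_pairing1 hT hS K hX mX of_ og) => N d d0 dr dc.
  rewrite powRr1 ?mulr_ge0//.
  have := svd_schatten_lb hT ltr01 fT N; rewrite -nT powRr1// => sN.
  apply: (@le_trans _ _ (\sum_(n < N) s n `^ 1 * t 0%N)); last first.
    by rewrite -mulr_suml ler_wpM2r.
  apply: ler_sum => n _; rewrite powRr1//.
  apply: (@le_trans _ _ (\sum_(m < N) s n * t 0%N * d n m)).
    apply: ler_sum => m _; rewrite ler_wpM2r// ler_wpM2l//.
    exact: (svd_nonincr hS).
  by rewrite -mulr_sumr ler_piMr// mulr_ge0.
have p0 : 0 < p := lt_trans ltr01 p1.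
pose q := p / (p - 1); have q0 : 0 < q by rewrite divr_gt0 ?subr_gt0.
have -> : hoelder_conjugate p%:E = q%:E.
  by rewrite /hoelder_conjugate/= eqe gt_eqF// inver subr_eq0 gt_eqF.
have pq : p^-1 + q^-1 = 1.
  by rewrite /q; field; rewrite !gt_eqF ?subr_gt0.
move=> ha hb.
have [T [s [u [v [hT cT <- nT fT]]]]] := schatten_svd ha.
have [S [t [u' [v' [hS cS <- nS fS]]]]] := schatten_svd hb.
have [X hX mX] := schur_exists (svd_ge0 hT 0) (svd_ge0 hS 0) (svd_opb hT) (svd_opb hS).
have T0 : 0 <= schatten_norm p%:E (matrix_of T) by rewrite nT (schatten_fine_ge0 hT).
have S0 : 0 <= schatten_norm q%:E (matrix_of S) by rewrite nS (schatten_fine_ge0 hS).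
rewrite -mX; apply: schatten_intro => //.
- by rewrite mulr_ge0.
- exact: (schur_compact hT hS hX).
move=> K f g of_ og; rewrite powRr1 ?mulr_ge0//.
apply: (schur_pairing1 hT hS K hX mX of_ og) => N d d0 dr dc.
have sT := svd_schatten_lb hT p0 fT N; have sS := svd_schatten_lb hS q0 fS N.
rewrite nT nS in T0 S0 *.
exact: (hoelder_substochastic p0 q0 pq d0 (svd_ge0 hT) (svd_ge0 hS) dr dc T0 S0 sT sS).
Qed.

End SchattenClass.

(** * The Banach space S_1 *)

Section TraceClass.
Variables (R : realType) (I : choiceType).
Local Notation H := (ell2 R I).
Local Notation mx := (I -> I -> C R).
Local Notation carrier1 := (@schatten_carrier R I 1%:E).
Local Notation norm1 := (@schatten_norm R I 1%:E).
Implicit Types (T S X : H -> H) (a b : mx) (c e : R).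

(** Each |<T f_k, g_k>| is subadditive in T, and the trace norm is recovered from sums of these. *)
Lemma schatten1D a b : carrier1 a -> carrier1 b ->
  carrier1 (a + b) /\ norm1 (a + b) <= norm1 a + norm1 b.
Proof.
move=> ha hb.
have [T [s [u [v [hT cT mT _ _]]]]] := schatten_svd ha.
have [S [t [u' [v' [hS cS mS _ _]]]]] := schatten_svd hb.
have -> : a + b = matrix_of (fun x => T x + S x).
  by rewrite -mT -mS; apply/funext => i; apply/funext => j.
have a0 := schatten_norm_ge0 ltr01 ha; have b0 := schatten_norm_ge0 ltr01 hb.
apply: schatten_intro => //; first exact: addr_ge0.
  exact: compactD.
move=> K f g of_ og; rewrite powRr1 ?addr_ge0//.
have [c _ bT] := compact_opb cT; have [d _ bS] := compact_opb cS.
have := schatten_pairing K (lexx 1) ha mT (ex_intro _ _ bT) of_ og.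
have := schatten_pairing K (lexx 1) hb mS (ex_intro _ _ bS) of_ og.
rewrite !powRr1// => h1 h2; apply: le_trans (lerD h2 h1).
rewrite -big_split/=; apply: ler_sum => k _.
by rewrite !powRr1 ?normc_ge0// innerDl normcD.
Qed.

Lemma schatten1N a : carrier1 a -> carrier1 (- a) /\ norm1 (- a) <= norm1 a.
Proof.
move=> ha; have := schattenZ (-1) (lexx 1) ha.
by rewrite scaleN1r normcN normc1 mul1r.
Qed.

Lemma schatten1B a b : carrier1 a -> carrier1 b ->
  carrier1 (a - b) /\ norm1 (a - b) <= norm1 a + norm1 b.
Proof.
move=> ha hb; have [nb nbl] := schatten1N hb; have [ab abl] := schatten1D ha nb.
by split=> //; apply: le_trans abl _; rewrite lerD2l.
Qed.

Lemma schatten1_distC a b : carrier1 a -> carrier1 b -> norm1 (a - b) = norm1 (b - a).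
Proof.
move=> ha hb; apply/eqP; rewrite eq_le; apply/andP; split.
  by rewrite -opprB; exact: (schatten1N (schatten1B hb ha).1).2.
by rewrite -[b - a]opprB; exact: (schatten1N (schatten1B ha hb).1).2.
Qed.

(** The operator norm is s_0, a single term of the sum that defines the trace norm. *)
Lemma schatten1_opb T a c : carrier1 a -> opb T c -> matrix_of T = a -> opb T (norm1 a).
Proof.
move=> ha hT mT; have [S [t [u [v [hS cS mS nS fS]]]]] := schatten_svd ha.
have [d _ bS] := compact_opb cS.
rewrite (matrix_of_inj hT bS); last by rewrite mT mS.
apply: opb_le (svd_opb hS).
have := svd_schatten_lb hS ltr01 fS 1%N; rewrite -nS big_ord1 powRr1 ?(svd_ge0 hS)//.
by rewrite powRr1// schatten_norm_ge0.
Qed.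

Lemma schatten1_eq0 a : carrier1 a -> norm1 a = 0 -> a = 0.
Proof.
move=> ha a0; have [S [t [u [v [hS cS mS nS fS]]]]] := schatten_svd ha.
have [d _ bS] := compact_opb cS; have := schatten1_opb ha bS mS; rewrite a0 => -[_ S0].
rewrite -mS; apply/funext => i; apply/funext => j; rewrite /matrix_of.
have -> : S (basis_vec R j) = 0; last by [].
apply: ell2_hnorm_eq0; apply/eqP; rewrite eq_le hn_ge0 andbT.
by have := S0 (basis_vec R j); rewrite mul0r.
Qed.

(** The trace norm dominates the operator norm, so a limit operator exists and is compact; the trace
    norm estimates reach it through the pairings, by [pairing_limit]. *)
Lemma schatten1_complete (x : nat -> mx) : (forall n, carrier1 (x n)) ->
  (forall e, 0 < e -> exists N : nat, forall m n, (N <= m)%N -> (N <= n)%N ->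
    norm1 (x m - x n) < e) ->
  exists2 l, carrier1 l & norm1 (x n - l) @[n --> \oo] --> (0 : R).
Proof.
move=> hx cx.
have /choice[T hT] : forall n, exists T, compact_operator T /\ matrix_of T = x n.
  by move=> n; have [T [s [u [v [h cT mT _ _]]]]] := schatten_svd (hx n); exists T.
have bT n : exists c, opb (T n) c by have [c _ h] := compact_opb (hT n).1; exists c.
have bTB m n : exists c, opb (fun z => T m z - T n z) c.
  by have [c h] := bT m; have [d h'] := bT n; exists (c + d); exact: opbB.
have mTB m n : matrix_of (fun z => T m z - T n z) = x m - x n.
  by rewrite -(hT m).2 -(hT n).2; apply/funext => i; apply/funext => j.
have dT m n : opb (fun z => T m z - T n z) (norm1 (x m - x n)).
  have [c h] := bTB m n; apply: schatten1_opb h (mTB m n).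
  exact: (schatten1B (hx m) (hx n)).1.
have [|S [[c bS] ST SE]] := op_cauchy bT.
  move=> e e0; have [N hN] := cx e e0; exists N => n Nn; apply: opb_le (dT n N).
  exact: ltW (hN n N Nn (leqnn N)).
have cS : compact_operator S.
  apply: compact_operator_closed bS.1 _ => e e0; have [N hN] := ST e e0.
  by exists (T N); [exact: (hT N).1|exact: hN].
pose l := matrix_of S.
have key e : 0 < e -> exists N : nat, forall n, (N <= n)%N ->
    carrier1 (l - x n) /\ norm1 (l - x n) <= e.
  move=> e0; have [N hN] := cx e e0; exists N => n Nn.
  have -> : l - x n = matrix_of (fun z => S z - T n z).
    by rewrite -(hT n).2; apply/funext => i; apply/funext => j.
  apply: schatten_intro => //; first exact: ltW.
    have -> : (fun z => S z - T n z) = (fun z => S z + (-1) *: T n z).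
      by apply/funext => z; rewrite scaleN1r.
    by apply: compactD => //; apply: compactZ; exact: (hT n).1.
  move=> K f g of_ og; rewrite powRr1 ?(ltW e0)//.
  (* [pairing_limit] asks for the bound at every index of the approximating sequence, hence the
     shift by [N]. *)
  apply: (@pairing_limit R I (fun z => S z - T n z)
    (fun m z => T (N + m)%N z - T n z) f g K 1 e (lexx 1)) => [z d d0|m].
    have [M hM] := SE z d d0; exists M => m Mm.
    rewrite opprB addrA subrK; apply: hM.
    exact: leq_trans Mm (leq_addl _ _).
  apply: le_trans (schatten_pairing K (lexx 1) (schatten1B (hx (N + m)%N) (hx n)).1
     (mTB _ _) (bTB _ _) of_ og) _.
  rewrite powRr1; last by rewrite schatten_norm_ge0//; exact: (schatten1B (hx _) (hx _)).1.
  by apply: ltW; apply: hN => //; exact: leq_addr.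
have hl : carrier1 l.
  have [N hN] := key 1 ltr01; rewrite -(subrK (x N) l).
  exact: (schatten1D (hN N (leqnn N)).1 (hx N)).1.
exists l => //; apply/cvgrPdist_lt => e e0.
have e2 : 0 < e / 2 by rewrite divr_gt0.
have [N hN] := key _ e2; exists N => // n /= Nn.
rewrite sub0r normrN ger0_norm; last first.
  by rewrite schatten_norm_ge0//; exact: (schatten1B (hx _) hl).1.
rewrite schatten1_distC//; apply: le_lt_trans (hN n Nn).2 _; lra.
Qed.

End TraceClass.

(** * Projective tensor products *)

Section ProjectiveNorm.
Variables (R : realType) (V W : lmodType R[i]).
Variables (E : normed_data V) (F : normed_data W).
Hypotheses (E0 : forall x, E x -> 0 <= nrm E x) (F0 : forall y, F y -> 0 <= nrm F y).
Hypothesis EZ : forall (l : R[i]) x, E x ->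
  E (l *: x) /\ nrm E (l *: x) <= normc l * nrm E x.
Implicit Types (u v w : seq (V * W)) (e : R).

Local Notation tensor := (tensor E F).
Local Notation "u ~~ v" := (tensor_eq E F u v) (at level 70).
Local Notation pn := (projective_norm E F).

Definition weight u := \sum_(z <- u) nrm E z.1 * nrm F z.2.

Definition tscale (l : R[i]) u := [seq (l *: z.1, z.2) | z <- u].

Lemma tensor_cat u v : tensor u -> tensor v -> tensor (u ++ v).
Proof. by move=> hu hv z; rewrite mem_cat => /orP[/hu|/hv]. Qed.

Lemma tensor_scale l u : tensor u -> tensor (tscale l u).
Proof. by move=> hu _ /mapP[z /hu[Ez Fz] ->]; split => //; exact: (EZ l Ez).1. Qed.

Lemma tensor_subE u v : tensor_sub u v = u ++ tscale (-1) v.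
Proof. by congr (_ ++ _); apply: eq_map => z; rewrite scaleN1r. Qed.

Lemma tensor_tsub u v : tensor u -> tensor v -> tensor (tensor_sub u v).
Proof. by rewrite tensor_subE => hu hv; apply: tensor_cat => //; exact: tensor_scale. Qed.

Lemma tensor_eq_sym u v : u ~~ v -> v ~~ u.
Proof. by move=> h Z f bf; rewrite (h Z f bf). Qed.

Lemma tensor_eq_trans v u w : u ~~ v -> v ~~ w -> u ~~ w.
Proof. by move=> h k Z f bf; rewrite (h Z f bf) (k Z f bf). Qed.

Lemma bilinear_scale (Z : lmodType R[i]) (f : V -> W -> Z) (l : R[i]) x y :
  bilinear_on E F f -> E x -> F y -> f (l *: x) y = l *: f x y.
Proof.
(* Writing l x as (l - 1) x + x extracts homogeneity from the combined axiom without evaluating f at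
   0. *)
move=> [fl _] Ex Fy; have := fl (l - 1) x x y Ex Ex Fy.
by rewrite -[X in _ *: _ + X]scale1r -scalerDl subrK => ->; rewrite -[X in _ + X]scale1r -scalerDl subrK.
Qed.

Lemma tsum_scale (Z : lmodType R[i]) (f : V -> W -> Z) (l : R[i]) u :
  bilinear_on E F f -> tensor u ->
  \sum_(z <- tscale l u) f z.1 z.2 = l *: \sum_(z <- u) f z.1 z.2.
Proof.
move=> bf hu; rewrite big_map scaler_sumr big_seq [RHS]big_seq.
by apply: eq_bigr => z /hu[Ez Fz]; rewrite /= (bilinear_scale _ bf).
Qed.

Lemma tsum_sub (Z : lmodType R[i]) (f : V -> W -> Z) u v :
  bilinear_on E F f -> tensor v ->
  \sum_(z <- tensor_sub u v) f z.1 z.2 =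
  \sum_(z <- u) f z.1 z.2 - \sum_(z <- v) f z.1 z.2.
Proof. by move=> bf hv; rewrite tensor_subE big_cat/= (tsum_scale _ bf)// scaleN1r. Qed.

Lemma weight_ge0 u : tensor u -> 0 <= weight u.
Proof.
move=> hu; rewrite /weight big_seq; apply: sumr_ge0 => z /hu[Ez Fz].
by rewrite mulr_ge0 ?E0 ?F0.
Qed.

Lemma weight_cat u v : weight (u ++ v) = weight u + weight v.
Proof. by rewrite /weight big_cat. Qed.

Lemma weight_scale l u : tensor u -> weight (tscale l u) <= normc l * weight u.
Proof.
move=> hu; rewrite /weight big_map mulr_sumr big_seq [leRHS]big_seq.
apply: ler_sum => z /hu[Ez Fz] /=; rewrite mulrA ler_wpM2r ?F0//.
exact: (EZ l Ez).2.
Qed.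

Let reprs u := [set weight v | v in [set v | tensor v /\ u ~~ v]].

Let reprs_lb u : lbound (reprs u) 0.
Proof. by move=> _ [v [hv _] <-]; exact: weight_ge0. Qed.

Let reprs_inf u : tensor u -> has_inf (reprs u).
Proof.
move=> hu; split; first by exists (weight u), u.
by exists 0; exact: reprs_lb.
Qed.

Lemma pn_ge0 u : 0 <= pn u.
Proof.
rewrite /projective_norm -/(reprs u).
(* If [u] is not itself a tensor over [E] and [F] there may be no representative; the infimum is
   then 0 by convention. *)
have [->|/set0P ne] := eqVneq (reprs u) set0; first by rewrite inf0.
by apply: lb_le_inf => //; exact: reprs_lb.
Qed.

Lemma pn_le_weight u v : tensor v -> u ~~ v -> pn u <= weight v.
Proof.
move=> hv uv; apply: ge_inf; first by exists 0; exact: reprs_lb.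
by exists v.
Qed.

Lemma pn_adherent u e : tensor u -> 0 < e ->
  exists v, [/\ tensor v, u ~~ v & weight v < pn u + e].
Proof.
move=> hu e0; have [_ [v [hv uv] <-] h] := inf_adherent e0 (reprs_inf hu).
by exists v.
Qed.

Lemma pn_eq u v : u ~~ v -> pn u = pn v.
Proof.
move=> uv; rewrite /projective_norm; congr inf; apply/seteqP.
by split=> _ [w [hw uw] <-]; exists w => //; split=> //;
  [apply: tensor_eq_trans uw; exact: tensor_eq_sym|exact: tensor_eq_trans uw].
Qed.

Lemma pn_cat u v : tensor u -> tensor v -> pn (u ++ v) <= pn u + pn v.
Proof.
move=> hu hv; apply/ler_addgt0Pr => e e0; have e2 : 0 < e / 2 by rewrite divr_gt0.
have [u' [hu' uu' wu]] := pn_adherent hu e2; have [v' [hv' vv' wv]] := pn_adherent hv e2.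
apply: (@le_trans _ _ (weight (u' ++ v'))); last first.
  by rewrite weight_cat [e]splitr addrACA; apply: lerD; exact: ltW.
apply: pn_le_weight; first exact: tensor_cat.
by move=> Z f bf; rewrite !big_cat/= (uu' _ _ bf) (vv' _ _ bf).
Qed.

Lemma tensor_eq_scale l u v : tensor u -> tensor v -> u ~~ v -> tscale l u ~~ tscale l v.
Proof. by move=> hu hv uv Z f bf; rewrite !(tsum_scale _ bf)// (uv _ _ bf). Qed.

Lemma pn_scale l u : tensor u -> pn (tscale l u) <= normc l * pn u.
Proof.
move=> hu; apply/ler_addgt0Pr => e e0.
have k1 : 0 < normc l + 1 by rewrite ltr_wpDl ?normc_ge0.
have [v [hv uv wv]] := pn_adherent hu (divr_gt0 e0 k1).
apply: (@le_trans _ _ (weight (tscale l v))).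
  by apply: pn_le_weight; [exact: tensor_scale|exact: tensor_eq_scale].
apply: le_trans (weight_scale l hv) _.
apply: (@le_trans _ _ (normc l * (pn u + e / (normc l + 1)))).
  by rewrite ler_wpM2l ?normc_ge0// ltW.
rewrite mulrDr lerD2l mulrA ler_pdivrMr// mulrC ler_wpM2l ?(ltW e0)//.
by rewrite lerDl.
Qed.

Lemma pn_sub_sym u v : tensor u -> tensor v ->
  pn (tensor_sub u v) = pn (tensor_sub v u).
Proof.
suff h x y : tensor x -> tensor y -> pn (tensor_sub x y) <= pn (tensor_sub y x).
  by move=> hu hv; apply/eqP; rewrite eq_le !h.
move=> hx hy; have := pn_scale (-1) (tensor_tsub hy hx).
rewrite normcN normc1 mul1r; apply: le_trans.
rewrite le_eqVlt; apply/orP; left; apply/eqP/pn_eq => Z f bf.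
by rewrite (tsum_scale _ bf)//; [rewrite !(tsum_sub _ bf)// scaleN1r opprB|exact: tensor_tsub].
Qed.

Lemma pn_le_sub u v : tensor u -> tensor v -> pn u <= pn (tensor_sub u v) + pn v.
Proof.
move=> hu hv; apply: le_trans (pn_cat (tensor_tsub hu hv) hv).
rewrite le_eqVlt; apply/orP; left; apply/eqP/pn_eq => Z f bf.
by rewrite [RHS]big_cat/= (tsum_sub _ bf)// subrK.
Qed.

Lemma pn_dist u v : tensor u -> tensor v -> `|pn u - pn v| <= pn (tensor_sub u v).
Proof.
move=> hu hv; have h1 := pn_le_sub hu hv; have h2 := pn_le_sub hv hu.
rewrite (pn_sub_sym hv hu) in h2; rewrite ler_norml.
by move: h1 h2; generalize (pn u) (pn v) (pn (tensor_sub u v)) => a b c; lra.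
Qed.

(** The projective norm is Lipschitz with respect to itself, so [ptensor_norm] is a genuine limit on
    Cauchy sequences. *)
Lemma ptensor_norm_cvg (w : nat -> seq (V * W)) : ptensor E F w ->
  pn (w n) @[n --> \oo] --> ptensor_norm E F w.
Proof.
move=> [hw cw]; apply: cauchy_cvg; apply: cauchy_exP => e e0.
have [N hN] := cw e e0; exists (pn (w N)); exists N => // n /= Nn.
rewrite -ball_normE /=; apply: le_lt_trans (pn_dist (hw N) (hw n)) _.
by apply: hN => //; exact: leqnn.
Qed.

Lemma ptensor_norm_ge0 (w : nat -> seq (V * W)) : ptensor E F w ->
  0 <= ptensor_norm E F w.
Proof.
move=> hw; have := ptensor_norm_cvg hw => cw.
rewrite -oppr_le0; apply: (@cvg_le_cst R _ \oo _ (fun n => - pn (w n))).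
  exact: cvgN.
by move=> n; rewrite oppr_le0 pn_ge0.
Qed.

Lemma ptensor_norm_le (w : nat -> seq (V * W)) c : ptensor E F w ->
  (forall n, pn (w n) <= c) -> ptensor_norm E F w <= c.
Proof. by move=> hw; exact: cvg_le_cst (ptensor_norm_cvg hw). Qed.

Lemma ptensor_bounded (w : nat -> seq (V * W)) : ptensor E F w ->
  exists2 c, 0 <= c & exists N : nat, forall n, (N <= n)%N -> pn (w n) <= c.
Proof.
move=> [hw cw]; have [N hN] := cw 1 ltr01; exists (1 + pn (w N)).
  by rewrite addr_ge0 ?pn_ge0.
exists N => n Nn; apply: le_trans (pn_le_sub (hw n) (hw N)) _.
by rewrite lerD2r ltW// hN.
Qed.

Definition tnull : nat -> seq (V * W) := fun=> [::].

Lemma ptensor_null : ptensor E F tnull.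
Proof.
split=> // e e0; exists 0%N => m n _ _; apply: le_lt_trans e0.
by apply: le_trans (@pn_le_weight _ [::] _ _) _ => //; rewrite /weight big_nil.
Qed.

Definition wadd (w w' : nat -> seq (V * W)) n := w n ++ w' n.

Lemma ptensor_add (w w' : nat -> seq (V * W)) : ptensor E F w -> ptensor E F w' -> ptensor E F (wadd w w').
Proof.
move=> [hw cw] [hw' cw']; split=> [n|e e0]; first exact: tensor_cat.
have e2 : 0 < e / 2 by rewrite divr_gt0.
have [N hN] := cw _ e2; have [M hM] := cw' _ e2; exists (maxn N M) => m n.
rewrite !geq_max => /andP[Nm Mm] /andP[Nn Mn].
apply: (@le_lt_trans _ _ (pn (tensor_sub (w m) (w n)) + pn (tensor_sub (w' m) (w' n)))).
  apply: le_trans (pn_cat (tensor_tsub (hw m) (hw n)) (tensor_tsub (hw' m) (hw' n))).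
  rewrite le_eqVlt; apply/orP; left; apply/eqP/pn_eq => Z f bf.
  rewrite [RHS]big_cat/= !(tsum_sub _ bf)// /wadd; last exact: tensor_cat.
  by rewrite !big_cat/= opprD addrACA.
by rewrite [ltRHS]splitr; apply: ltrD; [exact: hN|exact: hM].
Qed.

Lemma ptensor_norm_add (w w' : nat -> seq (V * W)) : ptensor E F w -> ptensor E F w' ->
  ptensor_norm E F (wadd w w') <= ptensor_norm E F w + ptensor_norm E F w'.
Proof.
move=> hw hw'; apply: (ler_cvg_to (ptensor_norm_cvg (ptensor_add hw hw'))
  (cvgD (ptensor_norm_cvg hw) (ptensor_norm_cvg hw'))).
by exists 0%N => // n _; exact: pn_cat (hw.1 n) (hw'.1 n).
Qed.

Definition wscale l (w : nat -> seq (V * W)) n := tscale l (w n).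

Lemma ptensor_scale l (w : nat -> seq (V * W)) : ptensor E F w -> ptensor E F (wscale l w).
Proof.
move=> [hw cw]; split=> [n|e e0]; first exact: tensor_scale.
have k1 : 0 < normc l + 1 by rewrite ltr_wpDl ?normc_ge0.
have [N hN] := cw _ (divr_gt0 e0 k1); exists N => m n Nm Nn.
have := pn_scale l (tensor_tsub (hw m) (hw n)).
have -> : pn (tscale l (tensor_sub (w m) (w n))) =
    pn (tensor_sub (wscale l w m) (wscale l w n)).
  apply: pn_eq => Z f bf; rewrite (tsum_scale _ bf)//; last exact: tensor_tsub.
  rewrite !(tsum_sub _ bf)//; last exact: tensor_scale.
  by rewrite !(tsum_scale _ bf)// scalerBr.
move=> h; apply: le_lt_trans h _; have := hN m n Nm Nn; rewrite ltr_pdivlMr// => h.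
apply: le_lt_trans h; rewrite mulrDr mulr1 mulrC lerDl; exact: pn_ge0.
Qed.

Lemma ptensor_norm_scale l (w : nat -> seq (V * W)) : ptensor E F w ->
  ptensor_norm E F (wscale l w) <= normc l * ptensor_norm E F w.
Proof.
move=> hw; apply: (ler_cvg_to (ptensor_norm_cvg (ptensor_scale l hw))
  (cvgM (cvg_cst (normc l)) (ptensor_norm_cvg hw))).
by exists 0%N => // n _; exact: pn_scale (hw.1 n).
Qed.

Lemma ptensor_subseq (h : nat -> nat) (w : nat -> seq (V * W)) : (forall n, (n <= h n)%N) ->
  ptensor E F w -> ptensor E F (w \o h).
Proof.
move=> hh [hw cw]; split=> [n|e e0]; first exact: hw.
have [N hN] := cw e e0; exists N => m n Nm Nn.
by apply: hN; [exact: leq_trans Nm (hh m)|exact: leq_trans Nn (hh n)].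
Qed.

End ProjectiveNorm.

Lemma ler_mul_addgt0 (R : realType) (z x y : R) : 0 <= x -> 0 <= y ->
  (forall d, 0 < d -> z <= (x + d) * (y + d)) -> z <= x * y.
Proof.
move=> x0 y0 h; apply/ler_addgt0Pr => e e0; pose k := x + y + 1.
have k0 : 0 < k by rewrite ltr_wpDl// addr_ge0.
(* For d <= 1 the product (x + d) (y + d) exceeds x y by at most d (x + y + 1). *)
pose d := Num.min 1 (e / k).
have d0 : 0 < d by rewrite lt_min ltr01 divr_gt0.
have d1 : d <= 1 by rewrite ge_min lexx.
have dk : d * k <= e by rewrite -ler_pdivlMr// ge_min lexx orbT.
apply: le_trans (h d d0) _.
apply: (@le_trans _ _ (x * y + d * k)); last by rewrite lerD2l.
by rewrite /k; nra.
Qed.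

(** * The product of tensors induced by the Schur product *)

Section SchurTensor.
Variables (R : realType) (I : choiceType).
Local Notation mx := (I -> I -> C R).
Implicit Types (a b x y : mx) (e : R).

Lemma schurC a b : schur a b = schur b a.
Proof. by apply/funext => i; apply/funext => j; exact: mulrC. Qed.

Lemma schurA a b c : schur a (schur b c) = schur (schur a b) c.
Proof. by apply/funext => i; apply/funext => j; exact: mulrA. Qed.

Lemma schur_linearl (l : R[i]) x y (z : mx) : schur (l *: x + y) z = l *: schur x z + schur y z.
Proof.
apply/funext => i; apply/funext => j.
apply: etrans (mulrDl (l * x i j) (y i j) (z i j)) _.
by congr (_ + _); exact: esym (mulrA l (x i j) (z i j)).
Qed.

Lemma schur_linearr (l : R[i]) x y (z : mx) : schur z (l *: x + y) = l *: schur z x + schur z y.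
Proof. by rewrite !(schurC z) schur_linearl. Qed.

Lemma schurDl x y (z : mx) : schur (x + y) z = schur x z + schur y z.
Proof. by have := schur_linearl 1 x y z; rewrite !scale1r. Qed.

Lemma schurBl x y (z : mx) : schur (x - y) z = schur x z - schur y z.
Proof. by have := schur_linearl (-1) y x z; rewrite !scaleN1r addrC => ->; rewrite addrC. Qed.

Lemma schur_suml (J : Type) (r : seq J) (f : J -> mx) (z : mx) :
  schur (\sum_(j <- r) f j) z = \sum_(j <- r) schur (f j) z.
Proof.
elim: r => [|j r IH]; last by rewrite !big_cons schurDl IH.
rewrite !big_nil; apply/funext => i; apply/funext => j; exact: mul0r.
Qed.

Variables (E F : normed_data mx).
Hypotheses (E0 : forall x, E x -> 0 <= nrm E x) (F0 : forall y, F y -> 0 <= nrm F y).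
Hypothesis EZ : forall (l : R[i]) x, E x ->
  E (l *: x) /\ nrm E (l *: x) <= normc l * nrm E x.
Hypothesis EM : forall x y, E x -> E y ->
  E (schur x y) /\ nrm E (schur x y) <= nrm E x * nrm E y.
Hypothesis FM : forall x y, F x -> F y ->
  F (schur x y) /\ nrm F (schur x y) <= nrm F x * nrm F y.
Implicit Types (u v : seq (mx * mx)) (w : nat -> seq (mx * mx)).

Local Notation tensor := (tensor E F).
Local Notation "u ~~ v" := (tensor_eq E F u v) (at level 70).
Local Notation pn := (projective_norm E F).

Definition tmul u v : seq (mx * mx) :=
  [seq (schur z.1 z'.1, schur z.2 z'.2) | z <- u, z' <- v].

Lemma tensor_mul u v : tensor u -> tensor v -> tensor (tmul u v).
Proof.
move=> hu hv _ /allpairsP[[z z'] /= [/hu[Ez Fz] /hv[Ez' Fz'] ->]] /=.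
by split; [exact: (EM Ez Ez').1|exact: (FM Fz Fz').1].
Qed.

Lemma tsum_mul (Z : lmodType R[i]) (f : mx -> mx -> Z) u v :
  \sum_(z <- tmul u v) f z.1 z.2 =
  \sum_(z <- u) \sum_(z' <- v) f (schur z.1 z'.1) (schur z.2 z'.2).
Proof. by rewrite big_allpairs_dep. Qed.

Lemma weight_mul u v : tensor u -> tensor v ->
  weight E F (tmul u v) <= weight E F u * weight E F v.
Proof.
move=> hu hv; rewrite /weight big_allpairs_dep mulr_suml big_seq [leRHS]big_seq.
apply: ler_sum => z /hu[Ez Fz]; rewrite mulr_sumr big_seq [leRHS]big_seq.
apply: ler_sum => z' /hv[Ez' Fz'] /=; rewrite mulrACA.
have [SE nE] := EM Ez Ez'; have [SF nF] := FM Fz Fz'.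
by apply: ler_pM => //; [exact: E0|exact: F0].
Qed.

(** Multiplication by a fixed elementary tensor turns a bilinear map into a bilinear map, so the
    universal property makes [tmul] compatible with [tensor_eq]. *)
Lemma bilinear_schur (Z : lmodType R[i]) (f : mx -> mx -> Z) a b :
  bilinear_on E F f -> E a -> F b ->
  bilinear_on E F (fun x y => f (schur x a) (schur y b)).
Proof.
move=> [fl fr] Ea Fb; split=> [l x x' y Ex Ex' Fy|l x y y' Ex Fy Fy'].
  by rewrite schur_linearl fl//; [exact: (EM Ex Ea).1|exact: (EM Ex' Ea).1|exact: (FM Fy Fb).1].
by rewrite schur_linearl fr//; [exact: (EM Ex Ea).1|exact: (FM Fy Fb).1|exact: (FM Fy' Fb).1].
Qed.

Lemma tensor_eq_mull u u' v : tensor v -> u ~~ u' -> tmul u v ~~ tmul u' v.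
Proof.
move=> hv uu' Z f bf; rewrite !tsum_mul exchange_big/= [RHS]exchange_big/=.
rewrite big_seq [RHS]big_seq; apply: eq_bigr => z' /hv[Ez Fz].
exact: (uu' Z _ (bilinear_schur bf Ez Fz)).
Qed.

Lemma tensor_eq_mulC u v : tmul u v ~~ tmul v u.
Proof.
move=> Z f bf; rewrite !tsum_mul exchange_big/=.
by apply: eq_bigr => z _; apply: eq_bigr => z' _; rewrite schurC [in X in f _ X]schurC.
Qed.

Lemma tensor_eq_mul u u' v v' : tensor u' -> tensor v -> u ~~ u' -> v ~~ v' ->
  tmul u v ~~ tmul u' v'.
Proof.
move=> hu' hv uu' vv'; apply: (tensor_eq_trans (tensor_eq_mull hv uu')).
apply: (tensor_eq_trans (@tensor_eq_mulC _ _)).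
by apply: (tensor_eq_trans (tensor_eq_mull hu' vv')); exact: tensor_eq_mulC.
Qed.

Lemma pn_mul u v : tensor u -> tensor v -> pn (tmul u v) <= pn u * pn v.
Proof.
move=> hu hv; have pu := pn_ge0 E0 F0 u; have pv := pn_ge0 E0 F0 v.
apply: ler_mul_addgt0 => // d d0.
have [u' [hu' uu' wu]] := pn_adherent E0 F0 hu d0.
have [v' [hv' vv' wv]] := pn_adherent E0 F0 hv d0.
apply: (@le_trans _ _ (weight E F (tmul u' v'))).
  apply: (pn_le_weight E0 F0); first exact: tensor_mul.
  exact: tensor_eq_mul.
apply: le_trans (weight_mul hu' hv') _.
by apply: ler_pM; rewrite ?(weight_ge0 E0 F0)// ltW.
Qed.

Definition wmul w w' n := tmul (w n) (w' n).

Lemma ptensor_mul w w' : ptensor E F w -> ptensor E F w' -> ptensor E F (wmul w w').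
Proof.
move=> pw pw'; have [hw cw] := pw; have [hw' cw'] := pw'.
split=> [n|e e0]; first exact: tensor_mul.
have [c c0 [P hP]] := ptensor_bounded E0 F0 EZ pw.
have [d d0 [Q hQ]] := ptensor_bounded E0 F0 EZ pw'.
have c1 : 0 < 2 * (c + 1) by rewrite mulr_gt0// ltr_wpDl.
have d1 : 0 < 2 * (d + 1) by rewrite mulr_gt0// ltr_wpDl.
have [N hN] := cw _ (divr_gt0 e0 d1); have [M hM] := cw' _ (divr_gt0 e0 c1).
exists (maxn (maxn N M) (maxn P Q)) => m n.
rewrite !geq_max => /andP[/andP[Nm Mm] /andP[Pm Qm]] /andP[/andP[Nn Mn] /andP[Pn Qn]].
have T1 := tensor_tsub EZ (hw m) (hw n); have T2 := tensor_tsub EZ (hw' m) (hw' n).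
(* The splitting x x' - y y' = (x - y) x' + y (x' - y'), with one factor bounded and the other
   Cauchy in each term. *)
have h : pn (tensor_sub (wmul w w' m) (wmul w w' n)) <=
    pn (tmul (tensor_sub (w m) (w n)) (w' m)) + pn (tmul (w n) (tensor_sub (w' m) (w' n))).
  apply: le_trans (pn_cat E0 F0 (tensor_mul T1 (hw' m)) (tensor_mul (hw n) T2)).
  rewrite le_eqVlt; apply/orP; left; apply/eqP/pn_eq => Z f bf.
  rewrite [RHS]big_cat/= (tsum_sub _ bf); last exact: tensor_mul.
  have -> : \sum_(z <- tmul (tensor_sub (w m) (w n)) (w' m)) f z.1 z.2 =
      \sum_(z <- tmul (w m) (w' m)) f z.1 z.2 - \sum_(z <- tmul (w n) (w' m)) f z.1 z.2.
    rewrite !tsum_mul exchange_big/= [X in X - _]exchange_big/= [X in _ - X]exchange_big/=.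
    rewrite -sumrB big_seq [RHS]big_seq; apply: eq_bigr => z' /(hw' m)[Ez Fz].
    exact: (tsum_sub _ (bilinear_schur bf Ez Fz) (hw n)).
  have -> : \sum_(z <- tmul (w n) (tensor_sub (w' m) (w' n))) f z.1 z.2 =
      \sum_(z <- tmul (w n) (w' m)) f z.1 z.2 - \sum_(z <- tmul (w n) (w' n)) f z.1 z.2.
    (* Commutativity moves the difference to the left factor, where the preceding argument
       applies. *)
    rewrite !(tensor_eq_mulC (w n) _ bf) !tsum_mul.
    rewrite exchange_big/= [X in X - _]exchange_big/= [X in _ - X]exchange_big/=.
    rewrite -sumrB big_seq [RHS]big_seq; apply: eq_bigr => z' /(hw n)[Ez Fz].
    exact: (tsum_sub _ (bilinear_schur bf Ez Fz) (hw' n)).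
  by rewrite addrA subrK.
apply: le_lt_trans h _.
have h1 : pn (tmul (tensor_sub (w m) (w n)) (w' m)) < e / 2.
  apply: le_lt_trans (pn_mul T1 (hw' m)) _.
  apply: (@le_lt_trans _ _ (pn (tensor_sub (w m) (w n)) * (d + 1))).
    rewrite ler_wpM2l ?(pn_ge0 E0 F0)//.
    by apply: le_trans (hQ m Qm) _; rewrite lerDl.
  rewrite -ltr_pdivlMr ?ltr_wpDl//; apply: lt_le_trans (hN m n Nm Nn) _.
  by rewrite le_eqVlt; apply/orP; left; apply/eqP; field; rewrite gt_eqF// ltr_wpDl.
have h2 : pn (tmul (w n) (tensor_sub (w' m) (w' n))) < e / 2.
  apply: le_lt_trans (pn_mul (hw n) T2) _.
  apply: (@le_lt_trans _ _ ((c + 1) * pn (tensor_sub (w' m) (w' n)))).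
    rewrite ler_wpM2r ?(pn_ge0 E0 F0)//.
    by apply: le_trans (hP n Pn) _; rewrite lerDl.
  rewrite mulrC -ltr_pdivlMr ?ltr_wpDl//; apply: lt_le_trans (hM m n Mm Mn) _.
  by rewrite le_eqVlt; apply/orP; left; apply/eqP; field; rewrite gt_eqF// ltr_wpDl.
by rewrite [ltRHS]splitr; exact: ltrD.
Qed.

Lemma ptensor_norm_mul w w' : ptensor E F w -> ptensor E F w' ->
  ptensor_norm E F (wmul w w') <= ptensor_norm E F w * ptensor_norm E F w'.
Proof.
move=> hw hw'.
apply: (ler_cvg_to (ptensor_norm_cvg E0 F0 EZ (ptensor_mul hw hw'))
  (cvgM (ptensor_norm_cvg E0 F0 EZ hw) (ptensor_norm_cvg E0 F0 EZ hw'))).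
by exists 0%N => // n _; exact: pn_mul (hw.1 n) (hw'.1 n).
Qed.

End SchurTensor.

(** * The algebra *)

Section FrakR.
Variables (R : realType) (I : choiceType) (p : R).
Hypothesis p1 : 1 <= p.
Local Notation mx := (I -> I -> C R).
Local Notation S := (@schatten R I).
Local Notation E := (S p%:E).
Local Notation F := (S (hoelder_conjugate p%:E)).
Local Notation carrier1 := (@schatten_carrier R I 1%:E).
Local Notation norm1 := (@schatten_norm R I 1%:E).
Local Notation tensor := (tensor E F).
Local Notation pn := (projective_norm E F).
Local Notation ptensor := (ptensor E F).
Local Notation tnorm := (ptensor_norm E F).
Implicit Types (a b x y : mx) (e c : R) (u v : seq (mx * mx)) (w : nat -> seq (mx * mx)).

Lemma hoelder_conjugate_cases : hoelder_conjugate p%:E = +oo%E \/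
  exists2 q : R, 1 <= q & hoelder_conjugate p%:E = q%:E.
Proof.
have : (1 <= hoelder_conjugate p%:E)%E by rewrite hoelder_conj_ge1// lee_fin.
case: (hoelder_conjugate p%:E) => [q| |]//; last by left.
by rewrite lee_fin => q1; right; exists q.
Qed.

Lemma E_ge0 x : E x -> 0 <= nrm E x.
Proof. exact: (schatten_norm_ge0 (lt_le_trans ltr01 p1)). Qed.

Lemma F_ge0 x : F x -> 0 <= nrm F x.
Proof.
rewrite /=; case: hoelder_conjugate_cases => [->|[q q1 ->]].
  exact: schattenoo_norm_ge0.
exact: (schatten_norm_ge0 (lt_le_trans ltr01 q1)).
Qed.

Lemma E_scale (l : R[i]) x : E x -> E (l *: x) /\ nrm E (l *: x) <= normc l * nrm E x.
Proof. exact: schattenZ. Qed.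

Lemma E_schur x y : E x -> E y -> E (schur x y) /\ nrm E (schur x y) <= nrm E x * nrm E y.
Proof. exact: schatten_schur. Qed.

Lemma F_schur x y : F x -> F y -> F (schur x y) /\ nrm F (schur x y) <= nrm F x * nrm F y.
Proof.
rewrite /=; case: hoelder_conjugate_cases => [->|[q q1 ->]].
  exact: schattenoo_schur.
exact: schatten_schur.
Qed.

Lemma schatten1_0 : carrier1 0 /\ norm1 0 = 0.
Proof.
have [||h1 h2] := @schatten_intro R I (finite_rank [::]) 1 0 (lexx 1) (lexx 0).
- apply: compact_finite_rank_approx => [|e e0].
    by have [c [lT _]] := finite_rank_opb (R := R) (I := I) [::].
  exists [::]; split=> [l x y|x]; rewrite ?subrr ?scaler0 ?addr0 ?ell2_hnorm0//.
  by rewrite mulr_ge0 ?hn_ge0// ltW.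
- move=> K f g _ _; rewrite powRr1// big1// => k _.
  by rewrite /finite_rank big_nil inner0l normc0 powRr1.
have E0 : matrix_of (finite_rank [::]) = 0 :> mx.
  apply/funext => i; apply/funext => j.
  by rewrite /matrix_of /finite_rank big_nil.
rewrite E0 in h1 h2; split=> //; apply/eqP; rewrite eq_le h2.
by rewrite schatten_norm_ge0.
Qed.

Lemma schur_sum_cat u v : schur_sum (u ++ v) = schur_sum u + schur_sum v.
Proof. by rewrite /schur_sum big_cat. Qed.

Lemma bilinear_schur_id : bilinear_on E F (@schur R I).
Proof.
by split=> *; [rewrite schur_linearl|rewrite schur_linearr].
Qed.

Lemma schur_sum_eq u v : tensor_eq E F u v -> schur_sum u = schur_sum v.
Proof. by move=> uv; exact: (uv _ _ bilinear_schur_id). Qed.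

Lemma schur_sum_sub u v : tensor v -> schur_sum (tensor_sub u v) = schur_sum u - schur_sum v.
Proof. by move=> hv; exact: (tsum_sub _ bilinear_schur_id hv). Qed.

Lemma schur_sum_scale l u : tensor u -> schur_sum (tscale l u) = l *: schur_sum u.
Proof. by move=> hu; exact: (tsum_scale _ bilinear_schur_id hu). Qed.

Lemma schur_sum_mul u v : schur_sum (tmul u v) = schur (schur_sum u) (schur_sum v).
Proof.
rewrite /schur_sum schur_suml tsum_mul; apply: eq_bigr => z _.
rewrite schurC schur_suml; apply: eq_bigr => z' _.
apply/funext => i; apply/funext => j.
have reorder (a b c d : R[i]) : b * d * (a * c) = a * b * (c * d) by ring.
exact: esym (reorder (z.1 i j) (z'.1 i j) (z.2 i j) (z'.2 i j)).
Qed.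

Lemma schur_sum_weight v : tensor v ->
  carrier1 (schur_sum v) /\ norm1 (schur_sum v) <= weight E F v.
Proof.
elim: v => [|z v IH] hv.
  by rewrite /schur_sum /weight !big_nil; have [? ->] := schatten1_0.
have [Ez Fz] := hv z (mem_head _ _).
have [|h1 h2] := IH; first by move=> z' z'v; apply: hv; rewrite in_cons z'v orbT.
have [k1 k2] := schatten_schur_hoelder p1 Ez Fz.
rewrite /schur_sum big_cons -/(schur_sum v) /weight big_cons.
have [m1 m2] := schatten1D k1 h1; split=> //.
by apply: le_trans m2 _; exact: lerD.
Qed.

Lemma schur_sum_le u : tensor u -> carrier1 (schur_sum u) /\ norm1 (schur_sum u) <= pn u.
Proof.
move=> hu; split; first exact: (schur_sum_weight hu).1.
apply/ler_addgt0Pr => e e0; have [v [hv uv wv]] := pn_adherent E_ge0 F_ge0 hu e0.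
rewrite (schur_sum_eq uv); apply: le_trans (schur_sum_weight hv).2 _.
exact: ltW.
Qed.

Lemma schur_sum_dist u v : tensor u -> tensor v ->
  norm1 (schur_sum u - schur_sum v) <= pn (tensor_sub u v).
Proof.
move=> hu hv; rewrite -schur_sum_sub//.
exact: (schur_sum_le (tensor_tsub E_scale hu hv)).2.
Qed.

Lemma cvg_norm1P (x : nat -> mx) a : (forall n, carrier1 (x n)) -> carrier1 a ->
  norm1 (x n - a) @[n --> \oo] --> (0 : R) <->
  forall e, 0 < e -> exists N : nat, forall n, (N <= n)%N -> norm1 (x n - a) < e.
Proof.
move=> hx ha.
have pos n : 0 <= norm1 (x n - a) by rewrite schatten_norm_ge0//; exact: (schatten1B (hx n) ha).1.
split=> [/cvgrPdist_lt h e e0|h].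
  have [N _ hN] := h e e0; exists N => n Nn; have := hN n Nn.
  by rewrite /= sub0r normrN ger0_norm.
apply/cvgrPdist_lt => e e0; have [N hN] := h e e0; exists N => // n /= Nn.
by rewrite sub0r normrN ger0_norm// hN.
Qed.

Lemma preimageP a w : preimage_varphi p a w <-> [/\ ptensor w, carrier1 a &
  forall e, 0 < e -> exists N : nat, forall n, (N <= n)%N ->
    norm1 (schur_sum (w n) - a) < e].
Proof.
split=> [[pw [ha wa]]|[pw ha wa]].
  split=> //; apply/cvg_norm1P => // n; exact: (schur_sum_le (pw.1 n)).1.
split=> //; split=> //; apply/cvg_norm1P => // n.
exact: (schur_sum_le (pw.1 n)).1.
Qed.

Lemma preimage_add a b w w' : preimage_varphi p a w -> preimage_varphi p b w' ->
  preimage_varphi p (a + b) (wadd w w').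
Proof.
move=> /preimageP[pw ha wa] /preimageP[pw' hb wb]; apply/preimageP; split.
- exact: (ptensor_add E_ge0 F_ge0 E_scale pw pw').
- exact: (schatten1D ha hb).1.
move=> e e0; have e2 : 0 < e / 2 by rewrite divr_gt0.
have [N hN] := wa _ e2; have [M hM] := wb _ e2; exists (maxn N M) => n.
rewrite geq_max => /andP[Nn Mn]; rewrite /wadd schur_sum_cat opprD addrACA.
have c1 := (schatten1B (schur_sum_le (pw.1 n)).1 ha).1.
have c2 := (schatten1B (schur_sum_le (pw'.1 n)).1 hb).1.
apply: le_lt_trans (schatten1D c1 c2).2 _.
by rewrite [ltRHS]splitr; apply: ltrD; [exact: hN|exact: hM].
Qed.

Lemma preimage_scale l a w : preimage_varphi p a w ->
  preimage_varphi p (l *: a) (wscale l w).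
Proof.
move=> /preimageP[pw ha wa]; apply/preimageP; split.
- exact: (ptensor_scale E_ge0 F_ge0 E_scale l pw).
- exact: (schattenZ l (lexx 1) ha).1.
move=> e e0; have k1 : 0 < normc l + 1 by rewrite ltr_wpDl ?normc_ge0.
have [N hN] := wa _ (divr_gt0 e0 k1); exists N => n Nn.
rewrite /wscale schur_sum_scale; last exact: pw.1.
rewrite -scalerBr.
have c1 := (schatten1B (schur_sum_le (pw.1 n)).1 ha).1.
apply: le_lt_trans (schattenZ l (lexx 1) c1).2 _.
have := hN n Nn; rewrite ltr_pdivlMr// => h; apply: le_lt_trans h.
by rewrite mulrDr mulr1 mulrC lerDl schatten_norm_ge0.
Qed.

Lemma preimage_mul a b w w' : preimage_varphi p a w -> preimage_varphi p b w' ->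
  preimage_varphi p (schur a b) (wmul w w').
Proof.
move=> /preimageP[pw ha wa] /preimageP[pw' hb wb]; apply/preimageP; split.
- exact: (ptensor_mul E_ge0 F_ge0 E_scale E_schur F_schur pw pw').
- exact: (schatten_schur (lexx 1) ha hb).1.
have na := schatten_norm_ge0 ltr01 ha; have nb := schatten_norm_ge0 ltr01 hb.
move=> e e0.
have ka : 0 < 2 * (norm1 a + 1) by rewrite mulr_gt0// ltr_wpDl.
have kb : 0 < 2 * (norm1 b + 1) by rewrite mulr_gt0// ltr_wpDl.
have [N hN] := wa _ (divr_gt0 e0 kb); have [M hM] := wb _ (divr_gt0 e0 ka).
have [L hL] := wb 1 ltr01; exists (maxn N (maxn M L)) => n.
rewrite !geq_max => /andP[Nn /andP[Mn Ln]]; rewrite /wmul schur_sum_mul.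
have cx := (schur_sum_le (pw.1 n)).1; have cy := (schur_sum_le (pw'.1 n)).1.
set x := schur_sum (w n) in cx *; set y := schur_sum (w' n) in cy *.
have cxa := (schatten1B cx ha).1; have cyb := (schatten1B cy hb).1.
(* The same splitting as for tensors, now inside S_1. *)
have -> : schur x y - schur a b = schur (x - a) y + schur a (y - b).
  by rewrite schurBl (schurC a (y - b)) schurBl (schurC y a) (schurC b a) addrA subrK.
have [s1 n1] := schatten_schur (lexx 1) cxa cy.
have [s2 n2] := schatten_schur (lexx 1) ha cyb.
apply: le_lt_trans (schatten1D s1 s2).2 _; rewrite [ltRHS]splitr.
have ny : norm1 y <= norm1 b + 1.
  rewrite -[y](subrK b) addrC; apply: le_trans (schatten1D hb cyb).2 _.
  by rewrite lerD2l ltW// /y hL.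
apply: ltrD.
  apply: le_lt_trans n1 _.
  apply: (@le_lt_trans _ _ (norm1 (x - a) * (norm1 b + 1))).
    by rewrite ler_wpM2l// schatten_norm_ge0.
  rewrite -ltr_pdivlMr ?ltr_wpDl//; apply: lt_le_trans (hN n Nn) _.
  by rewrite le_eqVlt; apply/orP; left; apply/eqP; field; rewrite gt_eqF// ltr_wpDl.
apply: le_lt_trans n2 _.
apply: (@le_lt_trans _ _ ((norm1 a + 1) * norm1 (y - b))).
  by rewrite ler_wpM2r ?lerDl// schatten_norm_ge0.
rewrite mulrC -ltr_pdivlMr ?ltr_wpDl//; apply: lt_le_trans (hM n Mn) _.
by rewrite le_eqVlt; apply/orP; left; apply/eqP; field; rewrite gt_eqF// ltr_wpDl.
Qed.

Lemma preimage_subseq a w (h : nat -> nat) : (forall n, (n <= h n)%N) ->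
  preimage_varphi p a w -> preimage_varphi p a (w \o h).
Proof.
move=> hh /preimageP[pw ha wa]; apply/preimageP; split=> //.
  exact: ptensor_subseq.
move=> e e0; have [N hN] := wa e e0; exists N => n Nn.
by apply: hN; exact: leq_trans Nn (hh n).
Qed.

Local Notation A := (frakR I p).

Let fibre_norms a := [set tnorm w | w in preimage_varphi p a].

Let fibre_lb a : lbound (fibre_norms a) 0.
Proof. by move=> _ [w [pw _] <-]; exact: (ptensor_norm_ge0 E_ge0 F_ge0 E_scale). Qed.

Lemma frakR_norm_le a w : preimage_varphi p a w -> nrm A a <= tnorm w.
Proof. by move=> aw; apply: ge_inf; [exists 0; exact: fibre_lb|exists w]. Qed.

Lemma frakR_norm_ge0 a : A a -> 0 <= nrm A a.
Proof. by move=> [w aw]; apply: lb_le_inf; [exists (tnorm w), w|exact: fibre_lb]. Qed.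

Lemma frakR_adherent a e : A a -> 0 < e ->
  exists2 w, preimage_varphi p a w & tnorm w < nrm A a + e.
Proof.
move=> [w aw] e0; have hi : has_inf (fibre_norms a).
  by split; [exists (tnorm w), w|exists 0; exact: fibre_lb].
by have [_ [w' aw' <-] h] := inf_adherent e0 hi; exists w'.
Qed.

Lemma frakR_schatten1 a : A a -> carrier1 a.
Proof. by move=> [w [_ []]]. Qed.

Lemma norm1_le_tnorm a w : preimage_varphi p a w -> norm1 a <= tnorm w.
Proof.
move=> /preimageP[pw ha wa]; apply/ler_addgt0Pr => e e0.
have e2 : 0 < e / 2 by rewrite divr_gt0.
have [N hN] := wa _ e2.
have /cvgrPdist_lt/(_ _ e2)[M _ hM] := ptensor_norm_cvg E_ge0 F_ge0 E_scale pw.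
have := hN _ (leq_maxl N M); have := hM _ (leq_maxr N M); set n := maxn N M.
have [c1 n1] := schur_sum_le (pw.1 n); set x := schur_sum (w n) in c1 n1 *.
rewrite /= ltr_norml => /andP[h1 _] h2.
have := (schatten1B c1 (schatten1B c1 ha).1).2; rewrite opprB addrC subrK => h3.
have {}h1 := ltW h1; rewrite lerBrDl lerBlDr in h1.
apply: le_trans h3 _; apply: (@le_trans _ _ (tnorm w + e / 2 + e / 2)); last first.
  by rewrite -addrA -splitr.
by apply: lerD (ltW h2); apply: le_trans n1 h1.
Qed.

(** The quotient norm dominates the trace norm; its definiteness is deduced from this. *)
Lemma norm1_le_frakR a : A a -> norm1 a <= nrm A a.
Proof.
move=> Aa; apply/ler_addgt0Pr => e e0; have [w aw h] := frakR_adherent Aa e0.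
by apply: le_trans (norm1_le_tnorm aw) (ltW h).
Qed.

Lemma frakR0 : A 0.
Proof.
exists (@tnull _ _ _); apply/preimageP; split.
- exact: (ptensor_null E_ge0 F_ge0).
- exact: schatten1_0.1.
- move=> e e0; exists 0%N => n _; rewrite /schur_sum big_nil subrr.
  by rewrite schatten1_0.2.
Qed.

Lemma frakRD a b : A a -> A b -> A (a + b) /\ nrm A (a + b) <= nrm A a + nrm A b.
Proof.
move=> Aa Ab; split.
  by have [w aw] := Aa; have [w' bw'] := Ab; exists (wadd w w'); exact: preimage_add.
apply/ler_addgt0Pr => e e0; have e2 : 0 < e / 2 by rewrite divr_gt0.
have [w aw h] := frakR_adherent Aa e2; have [w' bw' h'] := frakR_adherent Ab e2.
apply: le_trans (frakR_norm_le (preimage_add aw bw')) _.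
apply: le_trans (ptensor_norm_add E_ge0 F_ge0 E_scale aw.1 bw'.1) _.
by rewrite [e]splitr addrACA; apply: lerD (ltW h) (ltW h').
Qed.

Lemma frakRZ_le l a : A a -> A (l *: a) /\ nrm A (l *: a) <= normc l * nrm A a.
Proof.
move=> Aa; split.
  by have [w aw] := Aa; exists (wscale l w); exact: preimage_scale.
apply/ler_addgt0Pr => e e0.
have k1 : 0 < normc l + 1 by rewrite ltr_wpDl ?normc_ge0.
have [w aw h] := frakR_adherent Aa (divr_gt0 e0 k1).
apply: le_trans (frakR_norm_le (preimage_scale l aw)) _.
apply: le_trans (ptensor_norm_scale E_ge0 F_ge0 E_scale l aw.1) _.
apply: (@le_trans _ _ (normc l * (nrm A a + e / (normc l + 1)))).
  by rewrite ler_wpM2l ?normc_ge0// ltW.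
rewrite mulrDr lerD2l mulrA ler_pdivrMr// mulrC ler_wpM2l ?(ltW e0)//.
by rewrite lerDl.
Qed.

Lemma frakRM a b : A a -> A b -> A (schur a b) /\ nrm A (schur a b) <= nrm A a * nrm A b.
Proof.
move=> Aa Ab; split.
  by have [w aw] := Aa; have [w' bw'] := Ab; exists (wmul w w'); exact: preimage_mul.
have na := frakR_norm_ge0 Aa; have nb := frakR_norm_ge0 Ab.
apply: ler_mul_addgt0 => // d d0.
have [w aw h] := frakR_adherent Aa d0; have [w' bw' h'] := frakR_adherent Ab d0.
apply: le_trans (frakR_norm_le (preimage_mul aw bw')) _.
apply: le_trans (ptensor_norm_mul E_ge0 F_ge0 E_scale E_schur F_schur aw.1 bw'.1) _.
by apply: (ler_pM _ _ (ltW h) (ltW h'));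
  [exact: (ptensor_norm_ge0 E_ge0 F_ge0 E_scale aw.1)
  |exact: (ptensor_norm_ge0 E_ge0 F_ge0 E_scale bw'.1)].
Qed.

End FrakR.

Section Geometric.
Variable R : realType.

Lemma geo_half_sum (n : nat) : \sum_(k < n) (2^-1 : R) ^+ k = 2 - 2 * 2^-1 ^+ n.
Proof.
elim: n => [|n IH]; first by rewrite big_ord0 expr0; lra.
by rewrite big_ord_recr/= IH exprS; lra.
Qed.

Lemma geo_half_gt0 (n : nat) : 0 < (2^-1 : R) ^+ n.
Proof. by rewrite exprn_gt0. Qed.

Lemma geo_half_to0 (e : R) : 0 < e -> exists N : nat, forall n, (N <= n)%N -> 2^-1 ^+ n < e.
Proof.
move=> e0; have [N _ hN] := near_infty_natSinv_lt (PosNum e0); exists N => n Nn.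
apply: le_lt_trans (hN n Nn); rewrite exprVn lef_pV2 ?posrE ?exprn_gt0//.
by rewrite -natrX ler_nat ltn_expl.
Qed.

End Geometric.

(** * Banach spaces from the convergence of geometrically bounded series *)

Section BanachSeries.
Variables (R : realType) (V : lmodType R[i]) (A : normed_data V).
Hypothesis A0 : A 0.
Hypothesis Age0 : forall x, A x -> 0 <= nrm A x.
Hypothesis Aeq0 : forall x, A x -> nrm A x = 0 -> x = 0.
Hypothesis AD : forall x y, A x -> A y -> A (x + y) /\ nrm A (x + y) <= nrm A x + nrm A y.
Hypothesis AZ : forall (l : R[i]) x, A x -> A (l *: x) /\ nrm A (l *: x) <= normc l * nrm A x.
Hypothesis Aseries : forall d : nat -> V, (forall k, A (d k)) ->
  (forall k, nrm A (d k) < 2^-1 ^+ k) ->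
  exists2 l, A l & forall j, nrm A (l - \sum_(k < j) d k) <= 2 * 2^-1 ^+ j.

Let AB x y : A x -> A y -> A (x - y) /\ nrm A (x - y) <= nrm A x + nrm A y.
Proof.
move=> Ax Ay; have := AZ (-1) Ay; rewrite scaleN1r normcN normc1 mul1r => -[h1 h2].
by have [k1 k2] := AD Ax h1; split=> //; apply: le_trans k2 _; rewrite lerD2l.
Qed.

(** The reverse inequality is the given one for the inverse scalar applied to l x. *)
Let normZ l x : A x -> nrm A (l *: x) = normc l * nrm A x.
Proof.
move=> Ax; apply/eqP; rewrite eq_le (AZ l Ax).2/=.
have [->|l0] := eqVneq l 0; first by rewrite normc0 mul0r scale0r Age0.
have nl : 0 < normc l.
  by rewrite lt_neqAle normc_ge0 andbT eq_sym; apply: contra_neq l0 => /eq0_normc.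
have la : l^-1 *: (l *: x) = x by rewrite scalerA mulVf// scale1r.
have h := (AZ l^-1 (AZ l Ax).1).2; rewrite la normcV in h.
by rewrite -ler_pdivlMl.
Qed.

Let complete (x : nat -> V) : (forall n, A (x n)) ->
  (forall e : R, 0 < e -> exists n0 : nat, forall m n : nat,
     (n0 <= m)%N -> (n0 <= n)%N -> nrm A (x m - x n) < e) ->
  exists2 l, A l & nrm A (x n - l) @[n --> \oo] --> (0 : R).
Proof.
move=> Ax cx.
have /choice[h hh] := fun k => cx _ (geo_half_gt0 R k).
(* Cumulative sums make [g] nondecreasing and at least [h], so consecutive differences along [g] are
   below 2^-k and form a series to which [Aseries] applies. *)
pose g k := (\sum_(i < k.+1) h i)%N.
have gS k : (g k <= g k.+1)%N by rewrite /g [leqRHS]big_ord_recr/= leq_addr.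
have hg k : (h k <= g k)%N by rewrite /g big_ord_recr/= leq_addl.
pose d k := x (g k.+1) - x (g k).
have Ad k : A (d k) by exact: (AB (Ax _) (Ax _)).1.
have nd k : nrm A (d k) < 2^-1 ^+ k.
  by apply: hh; [exact: leq_trans (hg k) (gS k)|exact: hg].
have [l Al hl] := Aseries Ad nd.
have dE j : \sum_(k < j) d k = x (g j) - x (g 0%N).
  elim: j => [|j IH]; first by rewrite big_ord0 subrr.
  by rewrite big_ord_recr/= IH addrC addrA subrK.
pose L := l + x (g 0%N); have AL : A L by exact: (AD Al (Ax _)).1.
exists L => //; apply/cvgrPdist_lt => e e0.
have e3 : 0 < e / 3 by rewrite divr_gt0.
have [J hJ] := geo_half_to0 e3; have {}hJ := hJ J (leqnn J).
exists (g J) => // n /= Jn; have AxL := (AB (Ax n) AL).1.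
rewrite sub0r normrN ger0_norm; last exact: Age0.
have -> : x n - L = (x n - x (g J)) - (l - \sum_(k < J) d k).
  by rewrite dE opprB !addrA subrK /L opprD addrA [RHS]addrAC.
have A1 := (AB (Ax n) (Ax (g J))).1.
have A2 : A (l - \sum_(k < J) d k) by rewrite dE; exact: (AB Al (AB (Ax _) (Ax _)).1).1.
apply: le_lt_trans (AB A1 A2).2 _.
have h1 : nrm A (x n - x (g J)) < 2^-1 ^+ J.
  by apply: hh => //; exact: leq_trans (hg J) Jn.
have h2 := hl J; move: h1 h2 hJ; lra.
Qed.

Lemma banach_of_series : banach_space A.
Proof.
exact: (BanachSpace A0 (fun l x y Ax Ay => (AD (AZ l Ax).1 Ay).1) Age0 Aeq0 normZ
  (fun x y Ax Ay => (AD Ax Ay).2) complete).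
Qed.

End BanachSeries.

Section BigCat.
Variables (R : realType) (V W : lmodType R[i]) (E : normed_data V) (F : normed_data W).
Hypotheses (E0 : forall x, E x -> 0 <= nrm E x) (F0 : forall y, F y -> 0 <= nrm F y).

Definition bigcat (u : nat -> seq (V * W)) (K : nat) := \big[cat/[::]]_(k < K) u k.

Lemma tensor_bigcat u K : (forall k, tensor E F (u k)) -> tensor E F (bigcat u K).
Proof.
move=> hu; elim: K => [|K IH]; first by rewrite /bigcat big_ord0.
by rewrite /bigcat big_ord_recr/=; exact: tensor_cat.
Qed.

Lemma tsum_bigcat (Z : lmodType R[i]) (f : V -> W -> Z) u K :
  \sum_(z <- bigcat u K) f z.1 z.2 = \sum_(k < K) \sum_(z <- u k) f z.1 z.2.
Proof.
elim: K => [|K IH]; first by rewrite /bigcat !big_ord0 big_nil.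
by rewrite /bigcat big_ord_recr/= big_cat/= [RHS]big_ord_recr/= -IH.
Qed.

Lemma pn_bigcat u K : (forall k, tensor E F (u k)) ->
  projective_norm E F (bigcat u K) <= \sum_(k < K) projective_norm E F (u k).
Proof.
move=> hu; elim: K => [|K IH].
  rewrite /bigcat !big_ord0.
  have h : tensor_eq E F [::] [::] by [].
  by apply: le_trans (pn_le_weight E0 F0 _ h) _ => //; rewrite /weight big_nil.
have -> : bigcat u K.+1 = bigcat u K ++ u K by rewrite /bigcat big_ord_recr.
rewrite [leRHS]big_ord_recr/=.
apply: le_trans (pn_cat E0 F0 (tensor_bigcat hu) (hu K)) _.
by rewrite lerD2r.
Qed.

End BigCat.

(** * Summation of series in the quotient of the tensor product *)

Section FrakRSeries.
Variables (R : realType) (I : choiceType) (p : R).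
Hypothesis p1 : 1 <= p.
Local Notation mx := (I -> I -> C R).
Local Notation S := (@schatten R I).
Local Notation E := (S p%:E).
Local Notation F := (S (hoelder_conjugate p%:E)).
Local Notation carrier1 := (@schatten_carrier R I 1%:E).
Local Notation norm1 := (@schatten_norm R I 1%:E).
Local Notation tensor := (tensor E F).
Local Notation pn := (projective_norm E F).
Local Notation ptensor := (ptensor E F).
Local Notation tnorm := (ptensor_norm E F).
Local Notation A := (frakR I p).
Local Notation "''h_' k" := ((2^-1 : R) ^+ k) (at level 8, k at level 2).
Implicit Types (a b x y : mx) (e c : R) (u v : seq (mx * mx)) (w : nat -> seq (mx * mx)).

Let E0 := @E_ge0 R I p p1.
Let F0 := @F_ge0 R I p p1.
Let EZ := @E_scale R I p p1.

(* Passing to a subsequence makes the representing sequence geometrically Cauchy. *)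
Lemma fast_preimage a c : 0 < c -> A a -> nrm A a < c ->
  exists w, [/\ preimage_varphi p a w, forall n, pn (w n) <= c &
    forall K m n, (K <= m)%N -> (K <= n)%N -> pn (tensor_sub (w m) (w n)) <= c * 'h_K].
Proof.
move=> c0 Aa ac; have ca : 0 < c - nrm A a by rewrite subr_gt0.
have [w aw hw] := frakR_adherent p1 Aa ca.
have {}hw : tnorm w < c by rewrite addrC subrK in hw.
have [pw _ _] := (preimageP p1 a w).1 aw.
have ct : 0 < c - tnorm w by rewrite subr_gt0.
have /cvgrPdist_lt/(_ _ ct)[N _ hN] := ptensor_norm_cvg E0 F0 EZ pw.
have ck k : 0 < c * 'h_k by rewrite mulr_gt0// geo_half_gt0.
have /choice[h hh] := fun k => pw.2 _ (ck k).
(* [N] puts the norms below c, the sum dominates each h i with i <= k, and the last k gives k <= g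
   k, as [preimage_subseq] requires. *)
pose g k := (N + \sum_(i < k.+1) h i + k)%N.
have gh K m : (K <= m)%N -> (h K <= g m)%N.
  move=> Km; have hs : (h K <= \sum_(i < m.+1) h i)%N.
    by rewrite (bigD1 (Ordinal (Km : (K < m.+1)%N)))//= leq_addr.
  by apply: leq_trans hs _; rewrite /g addnAC leq_addl.
exists (w \o g); split.
- by apply: (preimage_subseq p1) aw => n; rewrite /g leq_addl.
- move=> n; have Nn : (N <= g n)%N by rewrite /g -addnA leq_addr.
  have := hN (g n) Nn; rewrite /= ltr_norml => /andP[h1 _].
  by have {}h1 := ltW h1; rewrite opprB lerD2l lerN2 in h1.
- by move=> K m n Km Kn; apply/ltW/hh; apply: gh.
Qed.

Lemma schatten1_sum (f : nat -> mx) K : (forall k, carrier1 (f k)) ->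
  carrier1 (\sum_(k < K) f k) /\ norm1 (\sum_(k < K) f k) <= \sum_(k < K) norm1 (f k).
Proof.
move=> hf; elim: K => [|K [h1 h2]].
  by rewrite !big_ord0; have [? ->] := schatten1_0 R I.
rewrite !big_ord_recr/=; have [k1 k2] := schatten1D h1 (hf K); split; first exact: k1.
by apply: le_trans k2 _; rewrite lerD2r.
Qed.

Lemma preimage_dist a w m e : preimage_varphi p a w ->
  (forall n, (m <= n)%N -> pn (tensor_sub (w m) (w n)) <= e) ->
  norm1 (schur_sum (w m) - a) <= e.
Proof.
move=> aw h; have [pw ha wa] := (preimageP p1 a w).1 aw.
apply/ler_addgt0Pr => d d0; have [N hN] := wa d d0.
have n1 := hN _ (leq_maxl N m); have n2 := h _ (leq_maxr N m).
set n := maxn N m in n1 n2.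
have cm := (schur_sum_le p1 (pw.1 m)).1; have cn := (schur_sum_le p1 (pw.1 n)).1.
have -> : schur_sum (w m) - a = (schur_sum (w m) - schur_sum (w n)) + (schur_sum (w n) - a).
  by rewrite addrA subrK.
apply: le_trans (schatten1D (schatten1B cm cn).1 (schatten1B cn ha).1).2 _.
apply: lerD (ltW n1); apply: le_trans n2.
exact: (schur_sum_dist p1 (pw.1 m) (pw.1 n)).
Qed.

(** Lifts of the terms are summed diagonally in the tensor product, and the image of this sum is
    compared in trace norm with the partial sums of the series. The scale c lets the same statement
    serve for every tail of a series. *)
Lemma frakR_series (d : nat -> mx) c : 0 < c -> (forall k, A (d k)) ->
  (forall k, nrm A (d k) < c * 'h_k) ->
  exists l, [/\ A l, nrm A l <= c * 2 & forall e, 0 < e -> exists N : nat,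
    forall K, (N <= K)%N -> norm1 (\sum_(k < K) d k - l) < e].
Proof.
move=> c0 Ad nd.
have ck k : 0 < c * 'h_k by rewrite mulr_gt0// geo_half_gt0.
have /choice[w hw] := fun k => fast_preimage (ck k) (Ad k) (nd k).
have wd k : preimage_varphi p (d k) (w k) by have [] := hw k.
have wn k n : pn (w k n) <= c * 'h_k by have [] := hw k.
have wc k K m n : (K <= m)%N -> (K <= n)%N ->
    pn (tensor_sub (w k m) (w k n)) <= c * 'h_k * 'h_K by have [_ _] := hw k; exact.
have wt k n : tensor (w k n) by exact: (wd k).1.1.
have cd k : carrier1 (d k) := frakR_schatten1 (Ad k).
(* W K is the K-th partial sum of the series, each term being replaced by its
   K-th approximation. *)
pose W K := bigcat (fun k => w k K) K.
have tW K : tensor (W K) := tensor_bigcat (fun k => wt k K).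
have sum_le2 K : \sum_(k < K) c * 'h_k <= c * 2.
  rewrite -mulr_sumr ler_wpM2l ?(ltW c0)// geo_half_sum gerBl.
  by rewrite mulr_ge0 ?(ltW (geo_half_gt0 R _)).
have W_le K : pn (W K) <= c * 2.
  apply: le_trans (pn_bigcat E0 F0 K (fun k => wt k K)) _.
  by apply: le_trans (sum_le2 K); apply: ler_sum => k _; exact: wn.
(* Terms with k < K contribute c 2^-k 2^-K each, and those with K <= k < M occur only in [W M] and
   contribute c 2^-k each. Both groups sum to at most 2 c 2^-K, whence the constant 4. *)
have W_dist K M : (K <= M)%N -> pn (tensor_sub (W M) (W K)) <= c * 4 * 'h_K.
  move=> KM.
  pose D k := if (k < K)%N then tensor_sub (w k M) (w k K) else w k M.
  have tD k : tensor (D k).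
    by rewrite /D; case: ifP => _; [exact: tensor_tsub|exact: wt].
  have -> : pn (tensor_sub (W M) (W K)) = pn (bigcat D M).
    apply: pn_eq => Z f bf; rewrite (tsum_sub _ bf (tW K)) !tsum_bigcat.
    rewrite (big_ord_widen M (fun k => \sum_(z <- w k K) f z.1 z.2) KM).
    rewrite [X in _ - X]big_mkcond/= -sumrB; apply: eq_bigr => k _; rewrite /D.
    by case: ifP => _; rewrite ?subr0//; rewrite (tsum_sub _ bf (wt k K)).
  apply: le_trans (pn_bigcat E0 F0 M tD) _.
  apply: (@le_trans _ _ (\sum_(k < M) (c * 'h_k * 'h_K +
      if (k < K)%N then 0 else c * 'h_k))).
    apply: ler_sum => k _; rewrite /D; case: ifP => _.
      by rewrite addr0; exact: wc.
    apply: le_trans (wn k M) _; rewrite lerDr.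
    by rewrite mulr_ge0 ?(ltW (ck _)) ?(ltW (geo_half_gt0 R _)).
  rewrite big_split/= -mulr_suml -(sum_ord_tail (fun k => c * 'h_k) KM).
  rewrite -!mulr_sumr !geo_half_sum.
  have hM : 0 <= c * 'h_M := ltW (ck M).
  have hMK : 0 <= c * 'h_M * 'h_K by rewrite mulr_ge0 ?(ltW (geo_half_gt0 R _)).
  rewrite -subr_ge0; move: hM hMK; set a := 'h_M; set b := 'h_K => hM hMK.
  have -> : c * 4 * b - (c * (2 - 2 * a) * b + (c * (2 - 2 * a) - c * (2 - 2 * b))) =
      2 * (c * a * b) + 2 * (c * a) by ring.
  exact: addr_ge0 (mulr_ge0 (ler0n R 2) hMK) (mulr_ge0 (ler0n R 2) hM).
have cW K : carrier1 (schur_sum (W K)) := (schur_sum_le p1 (tW K)).1.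
have small e : 0 < e -> exists N : nat, forall n, (N <= n)%N -> c * 4 * 'h_n < e.
  move=> e0; have c4 : 0 < c * 4 by rewrite mulr_gt0.
  have [N hN] := geo_half_to0 (divr_gt0 e0 c4); exists N => n Nn.
  by have := hN n Nn; rewrite ltr_pdivlMr// mulrC.
have pW : ptensor W.
  split=> // e e0; have [N hN] := small e e0; exists N => m n Nm Nn.
  have [nm|mn] := leqP n m.
    by apply: le_lt_trans (W_dist n m nm) _; exact: hN.
  rewrite (pn_sub_sym E0 F0 EZ (tW m) (tW n)).
  by apply: le_lt_trans (W_dist m n (ltnW mn)) _; exact: hN.
have [|l hl /(cvg_norm1P cW hl) Wl] := schatten1_complete cW.
  move=> e e0; have [N hN] := pW.2 e e0; exists N => m n Nm Nn.
  apply: le_lt_trans (hN m n Nm Nn); exact: schur_sum_dist.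
have preW : preimage_varphi p l W by apply/(preimageP p1).
exists l; split.
- by exists W.
- apply: le_trans (frakR_norm_le p1 preW) _.
  exact: (ptensor_norm_le E0 F0 EZ pW W_le).
move=> e e0; have e2 : 0 < e / 2 by rewrite divr_gt0.
have [N hN] := Wl _ e2; have [M hM] := small _ e2; exists (maxn N M) => K.
rewrite geq_max => /andP[NK MK].
pose r k := d k - schur_sum (w k K).
have cs k : carrier1 (schur_sum (w k K)) := (schur_sum_le p1 (wt k K)).1.
have cr k : carrier1 (r k) := (schatten1B (cd k) (cs k)).1.
(* Each [r k] is the error of the K-th approximation of the k-th term, at most c 2^-k 2^-K in trace
   norm; the other summand tends to 0 by the choice of [l]. *)
have -> : \sum_(k < K) d k - l = \sum_(k < K) r k + (schur_sum (W K) - l).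
  by rewrite sumrB /W [schur_sum (bigcat _ _)]tsum_bigcat addrA subrK.
have [s1 s2] := schatten1_sum K cr.
apply: le_lt_trans (schatten1D s1 (schatten1B (cW K) hl).1).2 _.
rewrite [ltRHS]splitr; apply: ltrD; last exact: hN.
apply: le_lt_trans (hM K MK); apply: le_trans s2 _.
apply: (@le_trans _ _ (\sum_(k < K) c * 'h_k * 'h_K)).
  apply: ler_sum => k _; rewrite (schatten1_distC (cd k) (cs k)).
  apply: (preimage_dist (wd k)) => n Kn.
  exact: wc.
rewrite -mulr_suml ler_wpM2r ?(ltW (geo_half_gt0 R _))//.
by apply: le_trans (sum_le2 K) _; rewrite ler_wpM2l ?(ltW c0)// ler_nat.
Qed.

(** Convergence of the partial sums in trace norm says nothing about remainders in the quotient
    norm. So every tail is summed separately, with a bound on its quotient norm, and its sum is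
    identified with the remainder by uniqueness of limits in S_1. *)
Lemma frakR_series_cvg (d : nat -> mx) : (forall k, A (d k)) ->
  (forall k, nrm A (d k) < 'h_k) ->
  exists2 l, A l & forall j, nrm A (l - \sum_(k < j) d k) <= 2 * 'h_j.
Proof.
move=> Ad nd.
(* Here c = 2^-j, and the bound 2 c on the sum of the tail is the required remainder estimate. *)
have tail j : exists l, [/\ A l, nrm A l <= 'h_j * 2 & forall e, 0 < e -> exists N : nat,
    forall K, (N <= K)%N -> norm1 (\sum_(k < K) d (j + k)%N - l) < e].
  apply: (@frakR_series (fun k => d (j + k)%N) _ (geo_half_gt0 R j)) => k; first exact: Ad.
  by rewrite -exprD; exact: nd.
have [l [Al _ hl]] := tail 0%N; exists l => // j.
have [m [Am nm hm]] := tail j.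
have cd k : carrier1 (d k) := frakR_schatten1 (Ad k).
have cl := frakR_schatten1 Al; have cm := frakR_schatten1 Am.
have cs K := (schatten1_sum K cd).1.
suff -> : l - \sum_(k < j) d k = m by rewrite mulrC.
have clj := (schatten1B cl (cs j)).1.
have cx := (schatten1B clj cm).1.
apply/eqP; rewrite -subr_eq0; apply/eqP; apply: (schatten1_eq0 cx).
apply: (@ler_eps_eq0 _ _ 2) => [||e e0].
- exact: (schatten_norm_ge0 ltr01 cx).
- by [].
have [N hN] := hl e e0; have [M hM] := hm e e0; pose K := maxn N M.
have h1 := hN (j + K)%N (leq_trans (leq_maxl N M) (leq_addl _ _)).
have h2 := hM K (leq_maxr N M).
have sE : \sum_(k < K) d (j + k)%N = \sum_(k < j + K) d k - \sum_(k < j) d k.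
  by rewrite big_split_ord/= addrAC subrr add0r.
have ct : carrier1 (\sum_(k < K) d (j + k)%N).
  exact: (schatten1_sum K (fun k => cd (j + k)%N)).1.
have -> : l - \sum_(k < j) d k - m =
    (l - \sum_(k < j + K) d k) + (\sum_(k < K) d (j + k)%N - m).
  by rewrite sE !addrA subrK.
apply: le_trans (schatten1D (schatten1B cl (cs _)).1 (schatten1B ct cm).1).2 _.
rewrite mulr2n mulrDl mul1r; apply: lerD (ltW h2).
by rewrite (schatten1_distC cl (cs _)); exact: ltW h1.
Qed.

End FrakRSeries.

Theorem proposition4p1 (R : realType) (I : choiceType) (p : R) (p1 : (1 <= p)%R) :
  commutative_banach_algebra (frakR I p) (@schur R I).
Proof.
split.
- apply: banach_of_series.
  + exact: frakR0.
  + exact: frakR_norm_ge0.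
  + move=> x Ax x0; apply: (schatten1_eq0 (frakR_schatten1 Ax)).
    have n1 := norm1_le_frakR p1 Ax; rewrite x0 in n1.
    by apply/eqP; rewrite eq_le n1 (schatten_norm_ge0 ltr01 (frakR_schatten1 Ax)).
  + exact: frakRD.
  + exact: frakRZ_le.
  + exact: frakR_series_cvg.
- by move=> x y Ax Ay; exact: (frakRM p1 Ax Ay).1.
- by move=> x y z _ _ _; exact: schurA.
- by move=> x y _ _; exact: schurC.
- by move=> a x y z _ _ _; exact: schur_linearl.
- by move=> a x y z _ _ _; exact: schur_linearr.
- by move=> x y Ax Ay; exact: (frakRM p1 Ax Ay).2.
Qed.
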